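(* Over $\Bbbk=\mathbb C(q)$, the $\mathbb C(q)$-linear monoidal categories $\mathbf{Schur}^{\bullet\prime}$ and $\mathbf{Schur}^\bullet$ are isomorphic by matching the generating objects and generating morphisms with the same symbols: there is an isomorphism of strict $\mathbb C(q)$-linear monoidal categories $\mathbf{Schur}^{\bullet\prime}\to\mathbf{Schur}^\bullet$ with $a\mapsto a$, $u\mapsto u$, $\mathsf m_{a,b}\mapsto\mathsf m_{a,b}$, $\mathsf s_{a,b}\mapsto\mathsf s_{a,b}$, $\mathsf c_{a,b}\mapsto\mathsf c_{a,b}$, $\mathsf r_{a,u}\mapsto\mathsf r_{a,u}$, $\mathsf l_{u,a}\mapsto\mathsf l_{u,a}$ and $\mathsf x_a\mapsto\mathsf x_a$ for all $a,b\ge1$, $u\in\mathbb C(q)$, where $\mathsf x_a$ for $a\ge2$ is defined in $\mathbf{Schur}^{\bullet\prime}$ by $\mathsf x_a=\frac1{[a]!}\mathsf m_{1^a}\mathsf x_1^{\otimes a}\mathsf s_{1^a}$ (and $\frac1{[a]!}\mathsf m_{1^a}(\mathsf x_1^{-1})^{\otimes a}\mathsf s_{1^a}$ is sent to $\mathsf x_a^{-1}$).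
   Context: **Notation.** $[n]=\frac{q^n-q^{-n}}{q-q^{-1}}$, $[a]!=[1][2]\cdots[a]$, $\begin{bmatrix}n\\ a\end{bmatrix}=\frac{[n][n-1]\cdots[n-a+1]}{[a]!}$. In a strict monoidal category, $fg=f\circ g$, $\otimes$ is horizontal juxtaposition. Strands of thickness $0$ are deleted: $0$ is the unit object, and merges, splits, crossings and dots involving a $0$ are identities. Iterated merges and splits (well defined by (W1)) are $\mathsf m_{a_1,\dots,a_k}$, $\mathsf s_{a_1,\dots,a_k}$; $1^a=(1,\dots,1)$ ($a$ ones). **$\mathbf{Schur}^\bullet$** (over $\mathbb C(q)$) is the strict $\mathbb C(q)$-linear monoidal category with generating objects $a\in\mathbb Z_{\ge1}$ (black) and $u\in\mathbb C(q)$ (red), generating morphisms $\mathsf m_{a,b}:a\otimes b\to a+b$, $\mathsf s_{a,b}:a+b\to a\otimes b$, $\mathsf c_{a,b}:a\otimes b\to b\otimes a$, $\mathsf x_a:a\to a$ ($\mathsf c_{a,b},\mathsf x_a$ invertible), $\mathsf r_{a,u}:a\otimes u\to u\otimes a$, $\mathsf l_{u,a}:u\otimes a\to a\otimes u$, subject to, for all $a,b,c,d\ge1$: (W1) $\mathsf m_{a+b,c}(\mathsf m_{a,b}\otimes1_c)=\mathsf m_{a,b+c}(1_a\otimes\mathsf m_{b,c})$, $(\mathsf s_{a,b}\otimes1_c)\mathsf s_{a+b,c}=(1_a\otimes\mathsf s_{b,c})\mathsf s_{a,b+c}$; (W2) if $a+c=b+d$: $\mathsf s_{b,d}\mathsf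 m_{a,c}=\sum q^{st}(\mathsf m_{s,b-s}\otimes\mathsf m_{a-s,t})(1_s\otimes\mathsf c_{a-s,c-t}\otimes1_t)(\mathsf s_{s,a-s}\otimes\mathsf s_{c-t,t})$, over $0\le s\le\min(a,b)$, $0\le t\le\min(c,d)$, $t-s=d-a$; (W3) $\mathsf m_{a,b}\mathsf s_{a,b}=\begin{bmatrix}a+b\\ a\end{bmatrix}1_{a+b}$; (W4) $\mathsf c_{a,b}(\mathsf x_a\otimes1_b)=(1_b\otimes\mathsf x_a)\mathsf c_{b,a}^{-1}$, $(\mathsf x_b\otimes1_a)\mathsf c_{a,b}=\mathsf c_{b,a}^{-1}(1_a\otimes\mathsf x_b)$; (W5) $\mathsf s_{a,b}\mathsf x_{a+b}=(\mathsf x_a\otimes\mathsf x_b)\mathsf s_{a,b}$, $\mathsf x_{a+b}\mathsf m_{a,b}=\mathsf m_{a,b}(\mathsf x_a\otimes\mathsf x_b)$; (W6) $\mathsf m_{1^a}\,\mathsf x_1^{\otimes a}\,\mathsf s_{1^a}=[a]!\,\mathsf x_a$, $\mathsf m_{1^a}(\mathsf x_1^{-1})^{\otimes a}\mathsf s_{1^a}=[a]!\,\mathsf x_a^{-1}$; (S1) $(1_u\otimes\mathsf s_{b,a})\mathsf r_{a+b,u}=(\mathsf r_{b,u}\otimes1_a)(1_b\otimes\mathsf r_{a,u})(\mathsf s_{b,a}\otimes1_u)$, $(\mathsf s_{a,b}\otimes1_u)\mathsf l_{u,a+b}=(1_a\otimes\mathsf l_{u,b})(\mathsf l_{u,a}\otimes1_b)(1_u\otimes\mathsf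 s_{a,b})$, $\mathsf l_{u,a+b}(1_u\otimes\mathsf m_{a,b})=(\mathsf m_{a,b}\otimes1_u)(1_a\otimes\mathsf l_{u,b})(\mathsf l_{u,a}\otimes1_b)$, $\mathsf r_{a+b,u}(\mathsf m_{a,b}\otimes1_u)=(1_u\otimes\mathsf m_{a,b})(\mathsf r_{a,u}\otimes1_b)(1_a\otimes\mathsf r_{b,u})$; (S2) $\mathsf l_{u,a}\mathsf r_{a,u}=\sum_{t=0}^a(-1)^tq^{-t(a-t)}u^t\,\omega_{a,a-t}\otimes1_u$, $\mathsf r_{a,u}\mathsf l_{u,a}=\sum_{t=0}^a(-1)^tq^{-t(a-t)}u^t\,1_u\otimes\omega_{a,a-t}$, where $\omega_{a,r}=\mathsf m_{r,a-r}(\mathsf x_r\otimes1_{a-r})\mathsf s_{r,a-r}$; (S3) $(\mathsf l_{u,b}\otimes1_a)(1_u\otimes\mathsf c_{a,b})(\mathsf r_{a,u}\otimes1_b)=\sum_{s=0}^{\min(a,b)}(-1)^sq^{s(s-1)/2}(q^{-1}-q)^s[s]!\,(\mathsf m_{s,b-s}\otimes1_u\otimes\mathsf m_{a-s,s})(1_s\otimes B_s\otimes\mathsf x_s)(\mathsf s_{s,a-s}\otimes1_u\otimes\mathsf s_{b-s,s})$, where $B_s=(1_{b-s}\otimes\mathsf r_{a-s,u})(\mathsf c_{a-s,b-s}\otimes1_u)(1_{a-s}\otimes\mathsf l_{u,b-s})$. **$\mathbf{Schur}^{\bullet\prime}$** is the strict $\mathbb C(q)$-linear monoidal category with generating objects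 $a\in\mathbb Z_{\ge1}$ and $u\in\mathbb C(q)$, generating morphisms $\mathsf m_{a,b},\mathsf s_{a,b},\mathsf c_{a,b},\mathsf r_{a,u},\mathsf l_{u,a}$ ($a,b\ge1$) and $\mathsf x_1:1\to1$, with $\mathsf c_{a,b}$ and $\mathsf x_1$ invertible, subject to (W1), (W2), (W3), (W4) only for $a=b=1$, (S1), and the cases $a=1$ of (S2) and $a=b=1$ of (S3), i.e. $\mathsf l_{u,1}\mathsf r_{1,u}=\mathsf x_1\otimes1_u-u\,1_{1\otimes u}$, $\mathsf r_{1,u}\mathsf l_{u,1}=1_u\otimes\mathsf x_1-u\,1_{u\otimes1}$, $(\mathsf l_{u,1}\otimes1_1)(1_u\otimes\mathsf c_{1,1})(\mathsf r_{1,u}\otimes1_1)=(1_1\otimes\mathsf r_{1,u})(\mathsf c_{1,1}\otimes1_u)(1_1\otimes\mathsf l_{u,1})-(q^{-1}-q)\,1_1\otimes1_u\otimes\mathsf x_1$. *)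

(* Defs.v *)
From HB Require Import structures.
From mathcomp Require Import all_boot all_order all_algebra.
From mathcomp Require Import generic_quotient fraction complex boolp reals.
From mathcomp Require Import zify.

Set Implicit Arguments.
Unset Strict Implicit.
Unset Printing Implicit Defensive.

Import GRing.Theory.
Local Open Scope ring_scope.
Local Open Scope quotient_scope.

(* A morphism together with its source and target.  Equations between
   morphisms whose endpoints agree only propositionally, such as
   (f # g) # h = f # (g # h), are stated as equations between arrows. *)
Record arrow_of (K : fieldType) (ob : Type) (mor : ob -> ob -> lmodType K) :=
  Arrow { arr_src : ob; arr_tgt : ob; arr_mor : mor arr_src arr_tgt }.

Definition mkarrow (K : fieldType) (ob : Type) (mor : ob -> ob -> lmodType K)
    (a b : ob) (f : mor a b) : arrow_of mor :=
  Arrow f.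

Record slmcat (K : fieldType) := SLMCat {
  ob : Type;
  mor : ob -> ob -> lmodType K;
  mid : forall a, mor a a;
  mcomp : forall a b c, mor b c -> mor a b -> mor a c;
  oneo : ob;
  otens : ob -> ob -> ob;
  mtens : forall a b c d, mor a b -> mor c d -> mor (otens a c) (otens b d);
  mcompA : forall a b c d (f : mor c d) (g : mor b c) (h : mor a b),
    mcomp f (mcomp g h) = mcomp (mcomp f g) h;
  mcomp1m : forall a b (f : mor a b), mcomp (mid b) f = f;
  mcompm1 : forall a b (f : mor a b), mcomp f (mid a) = f;
  mcomp_linl : forall a b c (k : K) (f f' : mor b c) (g : mor a b),
    mcomp (k *: f + f') g = k *: mcomp f g + mcomp f' g;
  mcomp_linr : forall a b c (k : K) (f : mor b c) (g g' : mor a b),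
    mcomp f (k *: g + g') = k *: mcomp f g + mcomp f g';
  otensA : forall a b c, otens a (otens b c) = otens (otens a b) c;
  otens1o : forall a, otens oneo a = a;
  otenso1 : forall a, otens a oneo = a;
  mtens_id : forall a b, mtens (mid a) (mid b) = mid (otens a b);
  mtens_comp : forall a b c a' b' c'
      (f : mor b c) (g : mor a b) (f' : mor b' c') (g' : mor a' b'),
    mtens (mcomp f g) (mcomp f' g') = mcomp (mtens f f') (mtens g g');
  mtens_linl : forall a b c d (k : K) (f f' : mor a b) (g : mor c d),
    mtens (k *: f + f') g = k *: mtens f g + mtens f' g;
  mtens_linr : forall a b c d (k : K) (f : mor a b) (g g' : mor c d),
    mtens f (k *: g + g') = k *: mtens f g + mtens f g';
  mtensA : forall a b c a' b' c' (f : mor a a') (g : mor b b') (h : mor c c'),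
    mkarrow (mtens f (mtens g h)) = mkarrow (mtens (mtens f g) h);
  mtens1m : forall a b (f : mor a b), mkarrow (mtens (mid oneo) f) = mkarrow f;
  mtensm1 : forall a b (f : mor a b), mkarrow (mtens f (mid oneo)) = mkarrow f
}.

Definition arrow (K : fieldType) (C : slmcat K) := arrow_of (@mor K C).
Definition arr (K : fieldType) (C : slmcat K) (a b : ob C) (f : mor a b) :
  arrow C := mkarrow f.

Record slmfunctor (K : fieldType) (C D : slmcat K) := SLMFunctor {
  fob :> ob C -> ob D;
  fmor : forall a b, mor a b -> mor (fob a) (fob b);
  fmor_lin : forall a b (k : K) (f g : mor a b),
    fmor (k *: f + g) = k *: fmor f + fmor g;
  fmor_id : forall a, fmor (mid a) = mid (fob a);
  fmor_comp : forall a b c (f : mor b c) (g : mor a b),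
    fmor (mcomp f g) = mcomp (fmor f) (fmor g);
  fob_one : fob (oneo C) = oneo D;
  fob_tens : forall a b, fob (otens a b) = otens (fob a) (fob b);
  fmor_tens : forall a b c d (f : mor a b) (g : mor c d),
    arr (fmor (mtens f g)) = arr (mtens (fmor f) (fmor g))
}.

Definition is_slmiso (K : fieldType) (C D : slmcat K) (F : slmfunctor C D) :=
  exists G : slmfunctor D C,
    [/\ forall a, G (F a) = a,
        forall a b (f : mor a b), arr (fmor G (fmor F f)) = arr f,
        forall a, F (G a) = a &
        forall a b (f : mor a b), arr (fmor F (fmor G f)) = arr f].

Record signature := Signature {
  gob : Type;
  gmor : Type;
  gdom : gmor -> seq gob;
  gcod : gmor -> seq gob
}.

(* Raw expressions; typing is a separate judgement, so that an expression may
   be typed along any provable equality of words. *)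
Inductive tm (K : fieldType) (S : signature) : Type :=
| tid of seq (gob S)
| tgen of gmor S
| tcomp of tm K S & tm K S
| ttens of tm K S & tm K S
| tzero of seq (gob S) & seq (gob S)
| tadd of tm K S & tm K S
| tscale of K & tm K S.

Arguments tid {K S} _.
Arguments tgen {K S} _.
Arguments tzero {K S} _ _.
Arguments tadd {K S} _ _.

Declare Scope tm_scope.
Delimit Scope tm_scope with tm.
Bind Scope tm_scope with tm.
Local Open Scope tm_scope.
Notation "f ⊗ g" := (ttens f g) (at level 38, left associativity) : tm_scope.
Notation "f ∘ g" := (tcomp f g) (at level 40, left associativity) : tm_scope.
Notation "k •: f" := (tscale k f) (at level 42, right associativity) : tm_scope.
Notation "f ⊞ g" := (tadd f g) (at level 44, left associativity) : tm_scope.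

Inductive ty (K : fieldType) (S : signature) :
    tm K S -> seq (gob S) -> seq (gob S) -> Prop :=
| ty_id v : ty (tid v) v v
| ty_gen g : ty (tgen g) (gdom g) (gcod g)
| ty_comp u v w f g : ty f v w -> ty g u v -> ty (f ∘ g) u w
| ty_tens v w v' w' f g : ty f v w -> ty g v' w' -> ty (f ⊗ g) (v ++ v') (w ++ w')
| ty_zero v w : ty (tzero v w) v w
| ty_add v w f g : ty f v w -> ty g v w -> ty (f ⊞ g) v w
| ty_scale v w k f : ty f v w -> ty (k •: f) v w.

(* The least congruence on well-typed expressions that contains rel and the
   axioms of strict linear monoidal categories. *)
Inductive eqm (K : fieldType) (S : signature) (rel : tm K S -> tm K S -> Prop) :
    seq (gob S) -> seq (gob S) -> tm K S -> tm K S -> Prop :=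
| eqm_rel v w f g : ty f v w -> ty g v w -> rel f g -> eqm rel v w f g
| eqm_refl v w f : ty f v w -> eqm rel v w f f
| eqm_sym v w f g : eqm rel v w f g -> eqm rel v w g f
| eqm_trans v w f g h : eqm rel v w f g -> eqm rel v w g h -> eqm rel v w f h
| eqm_comp u v w f f' g g' :
    eqm rel v w f f' -> eqm rel u v g g' -> eqm rel u w (f ∘ g) (f' ∘ g')
| eqm_tens v w v' w' f f' g g' :
    eqm rel v w f f' -> eqm rel v' w' g g' ->
    eqm rel (v ++ v') (w ++ w') (f ⊗ g) (f' ⊗ g')
| eqm_add v w f f' g g' :
    eqm rel v w f f' -> eqm rel v w g g' -> eqm rel v w (f ⊞ g) (f' ⊞ g')
| eqm_scale v w k f f' : eqm rel v w f f' -> eqm rel v w (k •: f) (k •: f')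
| eqm_addA v w f g h : ty f v w -> ty g v w -> ty h v w ->
    eqm rel v w (f ⊞ (g ⊞ h)) (f ⊞ g ⊞ h)
| eqm_addC v w f g : ty f v w -> ty g v w -> eqm rel v w (f ⊞ g) (g ⊞ f)
| eqm_add0 v w f : ty f v w -> eqm rel v w (tzero v w ⊞ f) f
| eqm_addN v w f : ty f v w -> eqm rel v w ((-1 •: f) ⊞ f) (tzero v w)
| eqm_scaleA v w k l f : ty f v w -> eqm rel v w (k •: (l •: f)) ((k * l) •: f)
| eqm_scale1 v w f : ty f v w -> eqm rel v w (1 •: f) f
| eqm_scaleDr v w k f g : ty f v w -> ty g v w ->
    eqm rel v w (k •: (f ⊞ g)) ((k •: f) ⊞ (k •: g))
| eqm_scaleDl v w k l f : ty f v w ->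
    eqm rel v w ((k + l) •: f) ((k •: f) ⊞ (l •: f))
| eqm_compA t u v w f g h : ty f v w -> ty g u v -> ty h t u ->
    eqm rel t w (f ∘ (g ∘ h)) (f ∘ g ∘ h)
| eqm_comp1m v w f : ty f v w -> eqm rel v w (tid w ∘ f) f
| eqm_compm1 v w f : ty f v w -> eqm rel v w (f ∘ tid v) f
| eqm_compDl u v w f f' g : ty f v w -> ty f' v w -> ty g u v ->
    eqm rel u w ((f ⊞ f') ∘ g) ((f ∘ g) ⊞ (f' ∘ g))
| eqm_compZl u v w k f g : ty f v w -> ty g u v ->
    eqm rel u w ((k •: f) ∘ g) (k •: (f ∘ g))
| eqm_compDr u v w f g g' : ty f v w -> ty g u v -> ty g' u v ->
    eqm rel u w (f ∘ (g ⊞ g')) ((f ∘ g) ⊞ (f ∘ g'))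
| eqm_compZr u v w k f g : ty f v w -> ty g u v ->
    eqm rel u w (f ∘ (k •: g)) (k •: (f ∘ g))
| eqm_tens_id v w : eqm rel (v ++ w) (v ++ w) (tid v ⊗ tid w) (tid (v ++ w))
| eqm_tens_comp u v w u' v' w' f g f' g' :
    ty f v w -> ty g u v -> ty f' v' w' -> ty g' u' v' ->
    eqm rel (u ++ u') (w ++ w') ((f ∘ g) ⊗ (f' ∘ g')) ((f ⊗ f') ∘ (g ⊗ g'))
| eqm_tensDl v w v' w' f f' g : ty f v w -> ty f' v w -> ty g v' w' ->
    eqm rel (v ++ v') (w ++ w') ((f ⊞ f') ⊗ g) ((f ⊗ g) ⊞ (f' ⊗ g))
| eqm_tensZl v w v' w' k f g : ty f v w -> ty g v' w' ->
    eqm rel (v ++ v') (w ++ w') ((k •: f) ⊗ g) (k •: (f ⊗ g))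
| eqm_tensDr v w v' w' f g g' : ty f v w -> ty g v' w' -> ty g' v' w' ->
    eqm rel (v ++ v') (w ++ w') (f ⊗ (g ⊞ g')) ((f ⊗ g) ⊞ (f ⊗ g'))
| eqm_tensZr v w v' w' k f g : ty f v w -> ty g v' w' ->
    eqm rel (v ++ v') (w ++ w') (f ⊗ (k •: g)) (k •: (f ⊗ g))
| eqm_tensA u u' v v' w w' f g h : ty f u u' -> ty g v v' -> ty h w w' ->
    eqm rel (u ++ (v ++ w)) (u' ++ (v' ++ w')) (f ⊗ (g ⊗ h)) (f ⊗ g ⊗ h)
| eqm_tens1m v w f : ty f v w -> eqm rel v w (tid [::] ⊗ f) f
| eqm_tensm1 v w f : ty f v w -> eqm rel v w (f ⊗ tid [::]) f.

Section Presentation.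
Context (K : fieldType) (S : signature) (rel : tm K S -> tm K S -> Prop).
Local Notation word := (seq (gob S)).

Lemma ty_cast (f : tm K S) v w v' w' :
  ty f v w -> v = v' -> w = w' -> ty f v' w'.
Proof. by move=> ? <- <-. Qed.

Lemma eqm_cast f g (v w v' w' : word) :
  eqm rel v w f g -> v = v' -> w = w' -> eqm rel v' w' f g.
Proof. by move=> ? <- <-. Qed.

Record tmor (v w : word) := TMor { tval : tm K S; tvalP : ty tval v w }.

HB.instance Definition _ v w := gen_eqMixin (tmor v w).
HB.instance Definition _ v w := gen_choiceMixin (tmor v w).

Definition eqmb v w (f g : tmor v w) : bool :=
  `[< eqm rel v w (tval f) (tval g) >].

Lemma eqmb_refl v w : reflexive (@eqmb v w).
Proof. by move=> f; apply/asboolP/eqm_refl/tvalP. Qed.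

Lemma eqmb_sym v w : symmetric (@eqmb v w).
Proof. by move=> f g; apply/idP/idP => /asboolP h; apply/asboolP/eqm_sym. Qed.

Lemma eqmb_trans v w : transitive (@eqmb v w).
Proof.
by move=> g f h /asboolP fg /asboolP gh; apply/asboolP; apply: eqm_trans fg gh.
Qed.

Canonical eqmb_equiv v w :=
  EquivRel (@eqmb v w) (@eqmb_refl v w) (@eqmb_sym v w) (@eqmb_trans v w).

Definition phom v w := {eq_quot (eqmb_equiv v w)}.
HB.instance Definition _ v w := EqQuotient.on (phom v w).
HB.instance Definition _ v w := Choice.on (phom v w).

Definition cls v w (f : tm K S) (h : ty f v w) : phom v w :=
  \pi_(phom v w) (TMor h).

Lemma clsP v w f g (hf : ty f v w) (hg : ty g v w) :
  cls hf = cls hg <-> eqm rel v w f g.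
Proof.
split=> [e|h]; last by apply/eqmodP/asboolP.
by move/eqmodP/asboolP: e.
Qed.

Lemma clsW v w (P : phom v w -> Prop) :
  (forall f (h : ty f v w), P (cls h)) -> forall x, P x.
Proof. by move=> H; elim/quotW => -[f h]; apply: H. Qed.

Lemma eqm_repr v w f (h : ty f v w) : eqm rel v w (tval (repr (cls h))) f.
Proof. by apply/(clsP (tvalP _) h); rewrite /cls; case: (repr _) (reprK (\pi_(phom v w) (TMor h))). Qed.

Definition padd v w (x y : phom v w) : phom v w :=
  cls (ty_add (tvalP (repr x)) (tvalP (repr y))).
Definition pscale v w (k : K) (x : phom v w) : phom v w :=
  cls (ty_scale k (tvalP (repr x))).
Definition pzero v w : phom v w := cls (ty_zero K v w).
Definition popp v w (x : phom v w) : phom v w := pscale (-1) x.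
Definition pcomp u v w (x : phom v w) (y : phom u v) : phom u w :=
  cls (ty_comp (tvalP (repr x)) (tvalP (repr y))).
Definition ptens v w v' w' (x : phom v w) (y : phom v' w') :
    phom (v ++ v') (w ++ w') :=
  cls (ty_tens (tvalP (repr x)) (tvalP (repr y))).

Lemma paddE v w f g (hf : ty f v w) (hg : ty g v w) :
  padd (cls hf) (cls hg) = cls (ty_add hf hg).
Proof. by apply/clsP; apply: eqm_add; apply: eqm_repr. Qed.
Lemma pscaleE v w k f (hf : ty f v w) :
  pscale k (cls hf) = cls (ty_scale k hf).
Proof. by apply/clsP; apply: eqm_scale; apply: eqm_repr. Qed.
Lemma pcompE u v w f g (hf : ty f v w) (hg : ty g u v) :
  pcomp (cls hf) (cls hg) = cls (ty_comp hf hg).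
Proof. by apply/clsP; apply: eqm_comp; apply: eqm_repr. Qed.
Lemma ptensE v w v' w' f g (hf : ty f v w) (hg : ty g v' w') :
  ptens (cls hf) (cls hg) = cls (ty_tens hf hg).
Proof. by apply/clsP; apply: eqm_tens; apply: eqm_repr. Qed.

Lemma paddA v w : associative (@padd v w).
Proof.
elim/clsW => f hf; elim/clsW => g hg; elim/clsW => h hh.
by rewrite !paddE; apply/clsP; apply: eqm_addA.
Qed.
Lemma paddC v w : commutative (@padd v w).
Proof.
elim/clsW => f hf; elim/clsW => g hg.
by rewrite !paddE; apply/clsP; apply: eqm_addC.
Qed.
Lemma padd0 v w : left_id (pzero v w) (@padd v w).
Proof. by elim/clsW => f hf; rewrite paddE; apply/clsP; apply: eqm_add0. Qed.
Lemma paddN v w : left_inverse (pzero v w) (@popp v w) (@padd v w).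
Proof.
by elim/clsW => f hf; rewrite /popp pscaleE paddE; apply/clsP; apply: eqm_addN.
Qed.

HB.instance Definition _ v w :=
  GRing.isZmodule.Build (phom v w) (@paddA v w) (@paddC v w) (@padd0 v w) (@paddN v w).

Lemma pscaleA v w k l (x : phom v w) : pscale k (pscale l x) = pscale (k * l) x.
Proof. by elim/clsW: x => f hf; rewrite !pscaleE; apply/clsP; apply: eqm_scaleA. Qed.
Lemma pscale1 v w : left_id 1 (@pscale v w).
Proof. by elim/clsW => f hf; rewrite !pscaleE; apply/clsP; apply: eqm_scale1. Qed.
Lemma pscaleDr v w : right_distributive (@pscale v w) +%R.
Proof.
move=> k; elim/clsW => f hf; elim/clsW => g hg.
change (pscale k (padd (cls hf) (cls hg)) =
  padd (pscale k (cls hf)) (pscale k (cls hg))).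
by rewrite (paddE hf hg) !pscaleE paddE; apply/clsP; apply: eqm_scaleDr.
Qed.
Lemma pscaleDl v w (x : phom v w) : {morph (@pscale v w)^~ x : k l / k + l}.
Proof.
elim/clsW: x => f hf k l.
rewrite /= !pscaleE; change (cls (ty_scale (k + l) hf) =
  padd (cls (ty_scale k hf)) (cls (ty_scale l hf))).
by rewrite paddE; apply/clsP; apply: eqm_scaleDl.
Qed.

HB.instance Definition _ v w :=
  GRing.Zmodule_isLmodule.Build K (phom v w)
    (@pscaleA v w) (@pscale1 v w) (@pscaleDr v w) (@pscaleDl v w).

Lemma cls_add v w f g (hf : ty f v w) (hg : ty g v w) :
  cls hf + cls hg = cls (ty_add hf hg).
Proof. exact: paddE. Qed.
Lemma cls_scale v w k f (hf : ty f v w) : k *: cls hf = cls (ty_scale k hf).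
Proof. exact: pscaleE. Qed.

Definition parr v w (x : phom v w) :=
  mkarrow (mor := fun v w => phom v w : lmodType K) x.

Lemma parr_cls v w v' w' f g (hf : ty f v w) (hg : ty g v' w') :
  v = v' -> w = w' -> eqm rel v w f g -> parr (cls hf) = parr (cls hg).
Proof.
move=> ev ew; case: v' / ev hg => hg; case: w' / ew hg => hg h.
by congr parr; apply/clsP.
Qed.

Fact pcompA t u v w (x : phom v w) (y : phom u v) (z : phom t u) :
  pcomp x (pcomp y z) = pcomp (pcomp x y) z.
Proof.
elim/clsW: x => f hf; elim/clsW: y => g hg; elim/clsW: z => h hh.
by rewrite !pcompE; apply/clsP; apply: eqm_compA hf hg hh.
Qed.
Fact pcomp1m v w (x : phom v w) : pcomp (cls (ty_id K w)) x = x.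
Proof. by elim/clsW: x => f hf; rewrite pcompE; apply/clsP; apply: eqm_comp1m. Qed.
Fact pcompm1 v w (x : phom v w) : pcomp x (cls (ty_id K v)) = x.
Proof. by elim/clsW: x => f hf; rewrite pcompE; apply/clsP; apply: eqm_compm1. Qed.
Fact pcomp_linl u v w k (x x' : phom v w) (y : phom u v) :
  pcomp (k *: x + x') y = k *: pcomp x y + pcomp x' y.
Proof.
elim/clsW: x => f hf; elim/clsW: x' => f' hf'; elim/clsW: y => g hg.
rewrite (cls_scale k hf) (cls_add (ty_scale k hf) hf') !pcompE cls_scale cls_add; apply/clsP.
apply: eqm_trans (eqm_compDl _ (ty_scale k hf) hf' hg) _; apply: eqm_add.
  exact: eqm_compZl hf hg.
exact: eqm_refl (ty_comp hf' hg).
Qed.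
Fact pcomp_linr u v w k (x : phom v w) (y y' : phom u v) :
  pcomp x (k *: y + y') = k *: pcomp x y + pcomp x y'.
Proof.
elim/clsW: x => f hf; elim/clsW: y => g hg; elim/clsW: y' => g' hg'.
rewrite (cls_scale k hg) (cls_add (ty_scale k hg) hg') !pcompE cls_scale cls_add; apply/clsP.
apply: eqm_trans (eqm_compDr _ hf (ty_scale k hg) hg') _; apply: eqm_add.
  exact: eqm_compZr hf hg.
exact: eqm_refl (ty_comp hf hg').
Qed.
Fact ptens_id v w :
  ptens (cls (ty_id K v)) (cls (ty_id K w)) = cls (ty_id K (v ++ w)).
Proof. by rewrite ptensE; apply/clsP; apply: eqm_tens_id. Qed.
Fact ptens_comp u v w u' v' w'
    (x : phom v w) (y : phom u v) (x' : phom v' w') (y' : phom u' v') :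
  ptens (pcomp x y) (pcomp x' y') = pcomp (ptens x x') (ptens y y').
Proof.
elim/clsW: x => f hf; elim/clsW: y => g hg.
elim/clsW: x' => f' hf'; elim/clsW: y' => g' hg'.
by rewrite !(pcompE, ptensE); apply/clsP; apply: eqm_tens_comp hf hg hf' hg'.
Qed.
Fact ptens_linl v w v' w' k (x x' : phom v w) (y : phom v' w') :
  ptens (k *: x + x') y = k *: ptens x y + ptens x' y.
Proof.
elim/clsW: x => f hf; elim/clsW: x' => f' hf'; elim/clsW: y => g hg.
rewrite (cls_scale k hf) (cls_add (ty_scale k hf) hf') !ptensE cls_scale cls_add; apply/clsP.
apply: eqm_trans (eqm_tensDl _ (ty_scale k hf) hf' hg) _; apply: eqm_add.
  exact: eqm_tensZl hf hg.
exact: eqm_refl (ty_tens hf' hg).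
Qed.
Fact ptens_linr v w v' w' k (x : phom v w) (y y' : phom v' w') :
  ptens x (k *: y + y') = k *: ptens x y + ptens x y'.
Proof.
elim/clsW: x => f hf; elim/clsW: y => g hg; elim/clsW: y' => g' hg'.
rewrite (cls_scale k hg) (cls_add (ty_scale k hg) hg') !ptensE cls_scale cls_add; apply/clsP.
apply: eqm_trans (eqm_tensDr _ hf (ty_scale k hg) hg') _; apply: eqm_add.
  exact: eqm_tensZr hf hg.
exact: eqm_refl (ty_tens hf hg').
Qed.
Fact ptensA u v w u' v' w' (x : phom u u') (y : phom v v') (z : phom w w') :
  parr (ptens x (ptens y z)) = parr (ptens (ptens x y) z).
Proof.
elim/clsW: x => f hf; elim/clsW: y => g hg; elim/clsW: z => h hh.
rewrite (ptensE hg hh) (ptensE hf hg) !ptensE.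
by apply: parr_cls; [exact: catA | exact: catA | apply: eqm_tensA].
Qed.
Fact ptens1m v w (x : phom v w) : parr (ptens (cls (ty_id K [::])) x) = parr x.
Proof.
by elim/clsW: x => f hf; rewrite ptensE; apply: parr_cls => //; apply: eqm_tens1m.
Qed.
Fact ptensm1 v w (x : phom v w) : parr (ptens x (cls (ty_id K [::]))) = parr x.
Proof.
elim/clsW: x => f hf; rewrite ptensE.
apply: parr_cls; [exact: cats0 | exact: cats0 |].
by apply: eqm_cast (eqm_tensm1 _ hf) _ _; rewrite ?cats0.
Qed.

Definition presented : slmcat K :=
  {| ob := word; mor v w := phom v w;
     mid v := cls (ty_id K v); mcomp := pcomp;
     oneo := [::]; otens := cat; mtens := ptens;
     mcompA := pcompA; mcomp1m := pcomp1m; mcompm1 := pcompm1;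
     mcomp_linl := pcomp_linl; mcomp_linr := pcomp_linr;
     otensA := @catA _; otens1o := @cat0s _; otenso1 := @cats0 _;
     mtens_id := ptens_id; mtens_comp := ptens_comp;
     mtens_linl := ptens_linl; mtens_linr := ptens_linr;
     mtensA := ptensA; mtens1m := ptens1m; mtensm1 := ptensm1 |}.

Definition pmor v w (f : tm K S) (h : ty f v w) : @mor K presented v w := cls h.
End Presentation.

Section Quantum.
Context (K : fieldType) (q : K).

Definition qnum (n : nat) : K := (q ^+ n - q ^- n) / (q - q^-1).
Definition qfact (a : nat) : K := \prod_(1 <= i < a.+1) qnum i.
Definition qbin (n a : nat) : K := (\prod_(i < a) qnum (n - i)) / qfact a.
End Quantum.

(* Black a is the black generating object of thickness a.+1. *)
Inductive strand (K : Type) : Type := Black of nat | Red of K.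
Arguments Black {K} _.

(* The black object of thickness a; thickness 0 is the unit object. *)
Definition bl {K : Type} (a : nat) : seq (strand K) :=
  if a is a'.+1 then [:: Black a'] else [::].
Definition rd {K : Type} (u : K) : seq (strand K) := [:: Red u].

(* As for strands, the numeric arguments are thicknesses minus one: GM a b is
   m_{a+1,b+1}.  GCi and GXi are the inverses of GC and GX.  The type D indexes
   the available dots, the dot d living on a strand of thickness th d. *)
Inductive sgen (K D : Type) : Type :=
| GM of nat & nat
| GS of nat & nat
| GC of nat & nat
| GCi of nat & nat
| GR of nat & K
| GL of K & nat
| GX of D
| GXi of D.
Arguments GM {K D} _ _.
Arguments GS {K D} _ _.
Arguments GC {K D} _ _.
Arguments GCi {K D} _ _.
Arguments GR {K D} _ _.
Arguments GL {K D} _ _.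
Arguments GX {K D} _.
Arguments GXi {K D} _.

Definition sdom (K D : Type) (th : D -> nat) (g : sgen K D) : seq (strand K) :=
  match g with
  | GM a b => bl a.+1 ++ bl b.+1
  | GS a b => bl (a.+1 + b.+1)
  | GC a b => bl a.+1 ++ bl b.+1
  | GCi a b => bl b.+1 ++ bl a.+1
  | GR a u => bl a.+1 ++ rd u
  | GL u a => rd u ++ bl a.+1
  | GX d | GXi d => bl (th d)
  end.

Definition scod (K D : Type) (th : D -> nat) (g : sgen K D) : seq (strand K) :=
  match g with
  | GM a b => bl (a.+1 + b.+1)
  | GS a b => bl a.+1 ++ bl b.+1
  | GC a b => bl b.+1 ++ bl a.+1
  | GCi a b => bl a.+1 ++ bl b.+1
  | GR a u => rd u ++ bl a.+1
  | GL u a => bl a.+1 ++ rd u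
  | GX d | GXi d => bl (th d)
  end.

Definition ssig (K D : Type) (th : D -> nat) : signature :=
  Signature (@sdom K D th) (@scod K D th).

Section Webs.
Context {K : fieldType} {D : Type} {th : D -> nat}.
Local Notation sg := (ssig K th).
Local Notation term := (tm K sg).

Definition idb (a : nat) : term := @tid K sg (bl a).
Definition idr (u : K) : term := @tid K sg (rd u).

(* From here on the arguments are the actual thicknesses; a merge, split or
   crossing with a strand of thickness 0 is an identity. *)
Definition mm (a b : nat) : term :=
  match a, b with
  | a'.+1, b'.+1 => @tgen K sg (GM a' b')
  | _, _ => idb (a + b)
  end.
Definition ss (a b : nat) : term :=
  match a, b with
  | a'.+1, b'.+1 => @tgen K sg (GS a' b')
  | _, _ => idb (a + b)
  end.
Definition cc (a b : nat) : term :=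
  match a, b with
  | a'.+1, b'.+1 => @tgen K sg (GC a' b')
  | _, _ => idb (a + b)
  end.
Definition cci (a b : nat) : term :=
  match a, b with
  | a'.+1, b'.+1 => @tgen K sg (GCi a' b')
  | _, _ => idb (a + b)
  end.
Definition rr (a : nat) (u : K) : term :=
  if a is a'.+1 then @tgen K sg (GR a' u) else idr u.
Definition ll (u : K) (a : nat) : term :=
  if a is a'.+1 then @tgen K sg (GL u a') else idr u.

Fixpoint merges (w : seq nat) : term :=
  if w is a :: w' then mm a (sumn w') ∘ (idb a ⊗ merges w') else idb 0.
Fixpoint splits (w : seq nat) : term :=
  if w is a :: w' then (idb a ⊗ splits w') ∘ ss a (sumn w') else idb 0.

Fixpoint tpow (f : term) (n : nat) : term :=
  if n is n'.+1 then f ⊗ tpow f n' else idb 0.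

Definition merge_ones (a : nat) : term := merges (nseq a 1%N).
Definition split_ones (a : nat) : term := splits (nseq a 1%N).

Lemma ty_idb a : ty (idb a) (bl a) (bl a). Proof. exact: ty_id. Qed.
Lemma ty_idr u : ty (idr u) (rd u) (rd u). Proof. exact: ty_id. Qed.
Lemma ty_mm a b : ty (mm a b) (bl a ++ bl b) (bl (a + b)).
Proof.
by case: a b => [|a] [|b]; do [exact: ty_gen | rewrite /= ?addn0; exact: ty_id].
Qed.
Lemma ty_ss a b : ty (ss a b) (bl (a + b)) (bl a ++ bl b).
Proof.
by case: a b => [|a] [|b]; do [exact: ty_gen | rewrite /= ?addn0; exact: ty_id].
Qed.
Lemma ty_cc a b : ty (cc a b) (bl a ++ bl b) (bl b ++ bl a).
Proof.
by case: a b => [|a] [|b]; do [exact: ty_gen | rewrite /= ?addn0; exact: ty_id].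
Qed.
Lemma ty_cci a b : ty (cci a b) (bl b ++ bl a) (bl a ++ bl b).
Proof.
by case: a b => [|a] [|b]; do [exact: ty_gen | rewrite /= ?addn0; exact: ty_id].
Qed.
Lemma ty_rr a u : ty (rr a u) (bl a ++ rd u) (rd u ++ bl a).
Proof. by case: a => [|a]; [exact: ty_id | exact: ty_gen]. Qed.
Lemma ty_ll u a : ty (ll u a) (rd u ++ bl a) (bl a ++ rd u).
Proof. by case: a => [|a]; [exact: ty_id | exact: ty_gen]. Qed.

Lemma ty_merges w : ty (merges w) (flatten (map bl w)) (bl (sumn w)).
Proof.
elim: w => [|a w IH] /=; first exact: ty_id.
exact: ty_comp (ty_mm _ _) (ty_tens (ty_idb a) IH).
Qed.
Lemma ty_splits w : ty (splits w) (bl (sumn w)) (flatten (map bl w)).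
Proof.
elim: w => [|a w IH] /=; first exact: ty_id.
exact: ty_comp (ty_tens (ty_idb a) IH) (ty_ss _ _).
Qed.
Lemma ty_tpow (f : term) a b n : ty f (bl a) (bl b) ->
  ty (tpow f n) (flatten (map bl (nseq n a))) (flatten (map bl (nseq n b))).
Proof.
by move=> hf; elim: n => [|n IH] /=; [exact: ty_id | exact: ty_tens].
Qed.
Lemma ty_ones (f : term) a : ty f (bl 1) (bl 1) ->
  ty (merge_ones a ∘ tpow f a ∘ split_ones a) (bl a) (bl a).
Proof.
move=> hf; have e : sumn (nseq a 1%N) = a by rewrite sumn_nseq mul1n.
rewrite -[in bl a]e; apply: ty_comp (ty_splits _).
exact: ty_comp (ty_merges _) (ty_tpow a hf).
Qed.

Context (q : K).

(* The relations without dots, which both presentations share.  Invertibility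
   of the crossings is imposed by making cci the inverse of cc. *)
Inductive web_rel : term -> term -> Prop :=
| rel_cK a b : (0 < a)%N -> (0 < b)%N ->
    web_rel (cci a b ∘ cc a b) (idb a ⊗ idb b)
| rel_cVK a b : (0 < a)%N -> (0 < b)%N ->
    web_rel (cc a b ∘ cci a b) (idb b ⊗ idb a)
| rel_W1m a b c : (0 < a)%N -> (0 < b)%N -> (0 < c)%N ->
    web_rel (mm (a + b) c ∘ (mm a b ⊗ idb c)) (mm a (b + c) ∘ (idb a ⊗ mm b c))
| rel_W1s a b c : (0 < a)%N -> (0 < b)%N -> (0 < c)%N ->
    web_rel ((ss a b ⊗ idb c) ∘ ss (a + b) c) ((idb a ⊗ ss b c) ∘ ss a (b + c))
| rel_W2 a b c d : (0 < a)%N -> (0 < b)%N -> (0 < c)%N -> (0 < d)%N ->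
    (a + c = b + d)%N ->
    web_rel (ss b d ∘ mm a c)
      (\big[tadd/@tzero K sg (bl a ++ bl c) (bl b ++ bl d)]_(0 <= s < (minn a b).+1)
       \big[tadd/@tzero K sg (bl a ++ bl c) (bl b ++ bl d)]_(0 <= t < (minn c d).+1
                                                       | (t + a == d + s)%N)
         (q ^+ (s * t) •: (mm s (b - s) ⊗ mm (a - s) t)
                          ∘ (idb s ⊗ cc (a - s) (c - t) ⊗ idb t)
                          ∘ (ss s (a - s) ⊗ ss (c - t) t)))
| rel_W3 a b : (0 < a)%N -> (0 < b)%N ->
    web_rel (mm a b ∘ ss a b) (qbin q (a + b) a •: idb (a + b))
| rel_S1rs a b u : (0 < a)%N -> (0 < b)%N ->
    web_rel ((idr u ⊗ ss b a) ∘ rr (a + b) u)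
            ((rr b u ⊗ idb a) ∘ (idb b ⊗ rr a u) ∘ (ss b a ⊗ idr u))
| rel_S1ls a b u : (0 < a)%N -> (0 < b)%N ->
    web_rel ((ss a b ⊗ idr u) ∘ ll u (a + b))
            ((idb a ⊗ ll u b) ∘ (ll u a ⊗ idb b) ∘ (idr u ⊗ ss a b))
| rel_S1lm a b u : (0 < a)%N -> (0 < b)%N ->
    web_rel (ll u (a + b) ∘ (idr u ⊗ mm a b))
            ((mm a b ⊗ idr u) ∘ (idb a ⊗ ll u b) ∘ (ll u a ⊗ idb b))
| rel_S1rm a b u : (0 < a)%N -> (0 < b)%N ->
    web_rel (rr (a + b) u ∘ (mm a b ⊗ idr u))
            ((idr u ⊗ mm a b) ∘ (rr a u ⊗ idb b) ∘ (idb a ⊗ rr b u)).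

End Webs.

Section SchurBullet.
Context (K : fieldType) (q : K).

(* The dot d lives on the strand of thickness d.+1. *)
Definition SchurBullet_sig : signature := ssig K succn.
Local Notation term := (tm K SchurBullet_sig).

Definition xx (a : nat) : term :=
  if a is a'.+1 then @tgen K SchurBullet_sig (GX a') else idb 0.
Definition xxi (a : nat) : term :=
  if a is a'.+1 then @tgen K SchurBullet_sig (GXi a') else idb 0.

Lemma ty_xx a : ty (xx a) (bl a) (bl a).
Proof. by case: a => [|a]; [exact: ty_id | exact: ty_gen]. Qed.
Lemma ty_xxi a : ty (xxi a) (bl a) (bl a).
Proof. by case: a => [|a]; [exact: ty_id | exact: ty_gen]. Qed.

Definition omega (a k : nat) : term :=
  mm k (a - k) ∘ (xx k ⊗ idb (a - k)) ∘ ss k (a - k).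

Inductive SchurBullet_rel : term -> term -> Prop :=
| rel_web f g : web_rel q f g -> SchurBullet_rel f g
| rel_xK a : (0 < a)%N -> SchurBullet_rel (xxi a ∘ xx a) (idb a)
| rel_xVK a : (0 < a)%N -> SchurBullet_rel (xx a ∘ xxi a) (idb a)
| rel_W4l a b : (0 < a)%N -> (0 < b)%N ->
    SchurBullet_rel (cc a b ∘ (xx a ⊗ idb b)) ((idb b ⊗ xx a) ∘ cci b a)
| rel_W4r a b : (0 < a)%N -> (0 < b)%N ->
    SchurBullet_rel ((xx b ⊗ idb a) ∘ cc a b) (cci b a ∘ (idb a ⊗ xx b))
| rel_W5s a b : (0 < a)%N -> (0 < b)%N ->
    SchurBullet_rel (ss a b ∘ xx (a + b)) ((xx a ⊗ xx b) ∘ ss a b)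
| rel_W5m a b : (0 < a)%N -> (0 < b)%N ->
    SchurBullet_rel (xx (a + b) ∘ mm a b) (mm a b ∘ (xx a ⊗ xx b))
| rel_W6 a : (0 < a)%N ->
    SchurBullet_rel (merge_ones a ∘ tpow (xx 1) a ∘ split_ones a) (qfact q a •: xx a)
| rel_W6V a : (0 < a)%N ->
    SchurBullet_rel (merge_ones a ∘ tpow (xxi 1) a ∘ split_ones a) (qfact q a •: xxi a)
| rel_S2lr a u : (0 < a)%N ->
    SchurBullet_rel (ll u a ∘ rr a u)
      (\big[tadd/@tzero K SchurBullet_sig (bl a ++ rd u) (bl a ++ rd u)]_(0 <= t < a.+1)
         ((-1) ^+ t * q ^- (t * (a - t)) * u ^+ t •: omega a (a - t) ⊗ idr u))
| rel_S2rl a u : (0 < a)%N ->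
    SchurBullet_rel (rr a u ∘ ll u a)
      (\big[tadd/@tzero K SchurBullet_sig (rd u ++ bl a) (rd u ++ bl a)]_(0 <= t < a.+1)
         ((-1) ^+ t * q ^- (t * (a - t)) * u ^+ t •: idr u ⊗ omega a (a - t)))
| rel_S3 a b u : (0 < a)%N -> (0 < b)%N ->
    SchurBullet_rel ((ll u b ⊗ idb a) ∘ (idr u ⊗ cc a b) ∘ (rr a u ⊗ idb b))
      (\big[tadd/@tzero K SchurBullet_sig (bl a ++ rd u ++ bl b) (bl b ++ rd u ++ bl a)]_(
           0 <= s < (minn a b).+1)
         ((-1) ^+ s * q ^+ (s * s.-1)./2 * (q^-1 - q) ^+ s * qfact q s •:
            (mm s (b - s) ⊗ idr u ⊗ mm (a - s) s)
            ∘ (idb s ⊗ ((idb (b - s) ⊗ rr (a - s) u)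
                        ∘ (cc (a - s) (b - s) ⊗ idr u)
                        ∘ (idb (a - s) ⊗ ll u (b - s))) ⊗ xx s)
            ∘ (ss s (a - s) ⊗ idr u ⊗ ss (b - s) s))).

Definition SchurBullet : slmcat K := presented SchurBullet_rel.

Definition SchurBullet'_sig : signature := ssig K (fun _ : unit => 1%N).
Local Notation term' := (tm K SchurBullet'_sig).

Definition x1 : term' := @tgen K SchurBullet'_sig (GX tt).
Definition x1i : term' := @tgen K SchurBullet'_sig (GXi tt).

Inductive SchurBullet'_rel : term' -> term' -> Prop :=
| rel'_web f g : web_rel q f g -> SchurBullet'_rel f g
| rel'_xK : SchurBullet'_rel (x1i ∘ x1) (idb 1)
| rel'_xVK : SchurBullet'_rel (x1 ∘ x1i) (idb 1)
| rel'_W4l : SchurBullet'_rel (cc 1 1 ∘ (x1 ⊗ idb 1)) ((idb 1 ⊗ x1) ∘ cci 1 1)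
| rel'_W4r : SchurBullet'_rel ((x1 ⊗ idb 1) ∘ cc 1 1) (cci 1 1 ∘ (idb 1 ⊗ x1))
| rel'_S2lr u :
    SchurBullet'_rel (ll u 1 ∘ rr 1 u) (x1 ⊗ idr u ⊞ (- u •: idb 1 ⊗ idr u))
| rel'_S2rl u :
    SchurBullet'_rel (rr 1 u ∘ ll u 1) (idr u ⊗ x1 ⊞ (- u •: idr u ⊗ idb 1))
| rel'_S3 u :
    SchurBullet'_rel ((ll u 1 ⊗ idb 1) ∘ (idr u ⊗ cc 1 1) ∘ (rr 1 u ⊗ idb 1))
      ((idb 1 ⊗ rr 1 u) ∘ (cc 1 1 ⊗ idr u) ∘ (idb 1 ⊗ ll u 1)
       ⊞ (- (q^-1 - q) •: idb 1 ⊗ idr u ⊗ x1)).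

Definition SchurBullet' : slmcat K := presented SchurBullet'_rel.

Definition xx' (a : nat) : term' :=
  match a with
  | 0 => idb 0
  | 1 => x1
  | _ => (qfact q a)^-1 •: merge_ones a ∘ tpow x1 a ∘ split_ones a
  end.
Definition xxi' (a : nat) : term' :=
  (qfact q a)^-1 •: merge_ones a ∘ tpow x1i a ∘ split_ones a.

Lemma ty_x1 : ty x1 (bl 1) (bl 1). Proof. exact: ty_gen. Qed.
Lemma ty_x1i : ty x1i (bl 1) (bl 1). Proof. exact: ty_gen. Qed.
Lemma ty_xx' a : ty (xx' a) (bl a) (bl a).
Proof.
case: a => [|[|a]]; [exact: ty_id | exact: ty_x1 |].
exact/ty_scale/ty_ones/ty_x1.
Qed.
Lemma ty_xxi' a : ty (xxi' a) (bl a) (bl a).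
Proof. exact/ty_scale/ty_ones/ty_x1i. Qed.

End SchurBullet.

Lemma ty_comp_eq (K : fieldType) (S : signature) (f g : tm K S) u v v' w :
  ty f v w -> ty g u v' -> v' = v -> ty (f ∘ g) u w.
Proof. by move=> hf hg e; apply: ty_comp hf _; rewrite -e. Qed.

Lemma ty_sum (K : fieldType) (S : signature) (v w : seq (gob S)) n (P : pred nat)
    (F : nat -> tm K S) :
  (forall i, (i < n)%N -> P i -> ty (F i) v w) ->
  ty (\big[tadd/tzero v w]_(0 <= i < n | P i) F i) v w.
Proof.
move=> H; rewrite big_seq_cond; apply: (big_ind (fun f => ty f v w)).
- exact: ty_zero.
- by move=> f g; apply: ty_add.
by move=> i; rewrite mem_index_iota => /andP[/andP[_ lt_in] Pi]; apply: H.
Qed.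

Ltac tyauto :=
  try eapply ty_cast;
  [ repeat first
      [ eapply ty_comp_eq | eapply ty_tens | eapply ty_scale | eapply ty_add
      | eapply ty_idb | eapply ty_idr | eapply ty_mm | eapply ty_ss
      | eapply ty_cc | eapply ty_cci | eapply ty_rr | eapply ty_ll
      | eapply ty_xx | eapply ty_xxi | eapply ty_x1 | eapply ty_x1i ] | .. ];
  rewrite -?catA ?cats0 //=;
  repeat first [congr (_ ++ _) | congr (_ :: _)]; try by congr bl; lia.

Section Typed.
Context (K : fieldType) (q : K).

Lemma web_rel_typed (D : Type) (th : D -> nat) (f g : tm K (ssig K th)) :
  web_rel q f g -> exists v w, ty f v w /\ ty g v w.
Proof.
case.
- by move=> a b _ _; exists (bl a ++ bl b), (bl a ++ bl b); split; tyauto.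
- by move=> a b _ _; exists (bl b ++ bl a), (bl b ++ bl a); split; tyauto.
- move=> a b c _ _ _; exists (bl a ++ bl b ++ bl c), (bl (a + b + c)).
  by split; tyauto.
- move=> a b c _ _ _; exists (bl (a + b + c)), (bl a ++ bl b ++ bl c).
  by split; tyauto.
- move=> a b c d _ _ _ _ e; exists (bl a ++ bl c), (bl b ++ bl d).
  split; first by tyauto.
  apply: ty_sum => s lt_s _; apply: ty_sum => t lt_t /eqP et.
  by tyauto.
- by move=> a b _ _; exists (bl (a + b)), (bl (a + b)); split; tyauto.
- move=> a b u _ _; exists (bl (a + b) ++ rd u), (rd u ++ bl b ++ bl a).
  by split; tyauto.
- move=> a b u _ _; exists (rd u ++ bl (a + b)), (bl a ++ bl b ++ rd u).
  by split; tyauto.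
- move=> a b u _ _; exists (rd u ++ bl a ++ bl b), (bl (a + b) ++ rd u).
  by split; tyauto.
- move=> a b u _ _; exists (bl a ++ bl b ++ rd u), (rd u ++ bl (a + b)).
  by split; tyauto.
Qed.

Lemma SchurBullet_rel_typed f g :
  SchurBullet_rel q f g -> exists v w, ty f v w /\ ty g v w.
Proof.
case.
- by move=> {}f {}g; apply: web_rel_typed.
- by move=> a _; exists (bl a), (bl a); split; tyauto.
- by move=> a _; exists (bl a), (bl a); split; tyauto.
- by move=> a b _ _; exists (bl a ++ bl b), (bl b ++ bl a); split; tyauto.
- by move=> a b _ _; exists (bl a ++ bl b), (bl b ++ bl a); split; tyauto.
- by move=> a b _ _; exists (bl (a + b)), (bl a ++ bl b); split; tyauto.
- by move=> a b _ _; exists (bl a ++ bl b), (bl (a + b)); split; tyauto.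
- move=> a _; exists (bl a), (bl a); split; last by tyauto.
  exact: ty_ones a (ty_xx K 1).
- move=> a _; exists (bl a), (bl a); split; last by tyauto.
  exact: ty_ones a (ty_xxi K 1).
- move=> a u _; exists (bl a ++ rd u), (bl a ++ rd u); split; first by tyauto.
  by apply: ty_sum => t lt_t _; rewrite /omega; tyauto.
- move=> a u _; exists (rd u ++ bl a), (rd u ++ bl a); split; first by tyauto.
  by apply: ty_sum => t lt_t _; rewrite /omega; tyauto.
- move=> a b u _ _; exists (bl a ++ rd u ++ bl b), (bl b ++ rd u ++ bl a).
  split; first by tyauto.
  by apply: ty_sum => s lt_s _; tyauto.
Qed.

Lemma SchurBullet'_rel_typed f g :
  SchurBullet'_rel q f g -> exists v w, ty f v w /\ ty g v w.
Proof.
case.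
- by move=> {}f {}g; apply: web_rel_typed.
- by exists (bl 1), (bl 1); split; tyauto.
- by exists (bl 1), (bl 1); split; tyauto.
- by exists (bl 1 ++ bl 1), (bl 1 ++ bl 1); split; tyauto.
- by exists (bl 1 ++ bl 1), (bl 1 ++ bl 1); split; tyauto.
- by move=> u; exists (bl 1 ++ rd u), (bl 1 ++ rd u); split; tyauto.
- by move=> u; exists (rd u ++ bl 1), (rd u ++ bl 1); split; tyauto.
- move=> u; exists (bl 1 ++ rd u ++ bl 1), (bl 1 ++ rd u ++ bl 1).
  split; first by tyauto.
  by apply: ty_add; [| apply: ty_scale]; tyauto.
Qed.
End Typed.

(* R[i] is the field of complex numbers over the reals R, and q is the
   indeterminate. *)
Definition Cq (R : realType) : fieldType := {fraction {poly R[i]}}.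
Definition qvar (R : realType) : Cq R := tofrac 'X.

(* Main.v *)
(* The point is to derive the thick dot relations from the thin ones.

   Since m_{1,a} s_{1,a} = [a+1] is invertible, a relation may be checked after
   composing with a merge with a strand of thickness one, which reduces it by
   induction on the thickness.  The dotless relations give everything needed
   about crossings: expanding s_{b,a+1} m_{a,1,b} by (W2) along both
   bracketings shows that merges slide through crossings, and (W2) for
   strands of thickness one yields m_{1,a} c_{a,1} = q^{-a} m_{a,1} and
   c_{b,1}^{-1} = s_{b,1} m_{1,b} - q^{-1} (m_{1,b-1} x 1) (1 x s_{b-1,1}).

   The dots satisfy m_{1,a} (x_1 x x_a) s_{1,a} = [a+1] x_{a+1}, and x_1 x x_a
   commutes with s_{1,a} m_{1,a}, which (W2) expresses through c_{1,1}; hence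
   (W5) and invertibility.  Sliding one strand at a time gives
   c_{a,b} (x_a x 1) c_{b,a} = 1 x x_a, that is (W4).  For (S2) one peels off
   one strand; the coefficients match by [m+n] = q^n [m] + q^{-m} [n].  For (S3)
   one first peels off strands of b for a = 1, and then strands of a: the two
   terms coming from (S3) for a = 1 are the two terms of (W2) for
   s_{s,a+1-s} m_{a,1}. *)

Require Import Defs.
From mathcomp Require Import all_boot all_order all_algebra reals.
From mathcomp Require Import fraction complex boolp zify ring.

Set Implicit Arguments.
Unset Strict Implicit.
Unset Printing Implicit Defensive.

Import GRing.Theory.
Local Open Scope ring_scope.
Local Open Scope tm_scope.

Section Whiskers.
Context (K : fieldType) (S : signature) (rel : tm K S -> tm K S -> Prop).
Local Notation word := (seq (gob S)).
Local Notation eqv := (eqm rel).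
Implicit Types (P Q R u v w : word) (f g h : tm K S).

Lemma eqm_ty v w f g : eqv v w f g -> ty f v w /\ ty g v w.
Proof.
elim=> {v w f g}; try by [].
all: try by move=> *; split; eauto using ty.
- by move=> v w f g _ [].
- by move=> v w f g h _ [? _] _ [_ ?].
- by move=> u v w f f' g g' _ [? ?] _ [? ?]; split; apply: ty_comp; eassumption.
- by move=> v w v' w' f f' g g' _ [? ?] _ [? ?]; split; apply: ty_tens.
- by move=> v w f f' g g' _ [? ?] _ [? ?]; split; apply: ty_add.
- by move=> v w k f f' _ [? ?]; split; apply: ty_scale.
- move=> u u' v v' w w' f g h *; split; first by do 2?apply: ty_tens.
  by apply: ty_cast (esym (catA _ _ _)) (esym (catA _ _ _)); do 2?apply: ty_tens.
- move=> v w f hf; split=> //; exact: (ty_tens (@ty_id K S [::]) hf).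
- move=> v w f hf; split=> //; apply: ty_cast (cats0 _) (cats0 _).
  exact: (ty_tens hf (@ty_id K S [::])).
Qed.

Definition whisk P f R : tm K S := tid P ⊗ f ⊗ tid R.

Lemma whisk_ty P R v w f : ty f v w -> ty (whisk P f R) (P ++ v ++ R) (P ++ w ++ R).
Proof.
move=> hf; apply: ty_cast (esym (catA _ _ _)) (esym (catA _ _ _)).
by do 2?apply: ty_tens=> //; apply: ty_id.
Qed.

Lemma whisk_eq P R v w f g :
  eqv v w f g -> eqv (P ++ v ++ R) (P ++ w ++ R) (whisk P f R) (whisk P g R).
Proof.
move=> hf; apply: eqm_cast (esym (catA _ _ _)) (esym (catA _ _ _)).
by do 2?apply: eqm_tens => //; apply/eqm_refl/ty_id.
Qed.

Lemma whisk_comp P R u v w f g : ty f v w -> ty g u v ->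
  eqv (P ++ u ++ R) (P ++ w ++ R) (whisk P (f ∘ g) R) (whisk P f R ∘ whisk P g R).
Proof.
move=> hf hg; apply: eqm_cast (esym (catA _ _ _)) (esym (catA _ _ _)).
have e T : eqv T T (tid T) (tid T ∘ tid T).
  by apply/eqm_sym/eqm_comp1m/ty_id.
apply: (@eqm_trans _ _ _ _ _ _ ((tid P ∘ tid P) ⊗ (f ∘ g) ⊗ (tid R ∘ tid R))).
  apply: eqm_tens (e R); apply: eqm_tens (e P) _.
  exact/eqm_refl/ty_comp/hg.
have t T := @ty_id K S T.
apply: (@eqm_trans _ _ _ _ _ _ (((tid P ⊗ f) ∘ (tid P ⊗ g)) ⊗ (tid R ∘ tid R))).
  apply: eqm_tens; last exact/eqm_refl/ty_comp/t.
  exact: eqm_tens_comp _ (t P) (t P) hf hg.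
exact: eqm_tens_comp _ (ty_tens (t P) hf) (ty_tens (t P) hg) (t R) (t R).
Qed.

Lemma whisk_id P v R :
  eqv (P ++ v ++ R) (P ++ v ++ R) (whisk P (tid v) R) (tid (P ++ v ++ R)).
Proof.
rewrite catA; apply: eqm_trans (eqm_tens_id _ _ _).
by apply: eqm_tens (eqm_tens_id _ _ _) (eqm_refl _ (ty_id _ _)).
Qed.

Lemma tens_tid3 P Q f v w : ty f v w ->
  eqv (P ++ Q ++ v) (P ++ Q ++ w) (tid P ⊗ (tid Q ⊗ f)) (tid (P ++ Q) ⊗ f).
Proof.
move=> hf; apply: eqm_trans (eqm_tensA _ (ty_id _ _) (ty_id _ _) hf) _.
apply: eqm_cast (esym (catA _ _ _)) (esym (catA _ _ _)).
by apply: eqm_tens (eqm_tens_id _ _ _) (eqm_refl _ hf).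
Qed.

Lemma tid_tens3 P Q f v w : ty f v w ->
  eqv ((v ++ P) ++ Q) ((w ++ P) ++ Q) (f ⊗ tid P ⊗ tid Q) (f ⊗ tid (P ++ Q)).
Proof.
move=> hf; rewrite -!catA.
apply: eqm_trans (eqm_sym (eqm_tensA _ hf (ty_id _ _) (ty_id _ _))) _.
by apply: eqm_tens (eqm_refl _ hf) (eqm_tens_id _ _ _).
Qed.

Lemma whisk_whisk P P' R R' v w f : ty f v w ->
  eqv ((P ++ P') ++ v ++ R' ++ R) ((P ++ P') ++ w ++ R' ++ R)
    (whisk P (whisk P' f R') R) (whisk (P ++ P') f (R' ++ R)).
Proof.
move=> hf; have t T := @ty_id K S T.
have tf : ty (tid P' ⊗ f) (P' ++ v) (P' ++ w) by apply: ty_tens.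
apply: (@eqm_cast _ _ _ _ _ ((P ++ (P' ++ v) ++ R') ++ R) ((P ++ (P' ++ w) ++ R') ++ R));
  rewrite -?catA //.
rewrite /whisk.
apply: (@eqm_trans _ _ _ _ _ _ (tid P ⊗ (tid P' ⊗ f) ⊗ tid R' ⊗ tid R)).
  have := eqm_tens (eqm_tensA rel (t P) tf (t R')) (eqm_refl rel (t R)).
  by rewrite -!catA.
have := tid_tens3 R' R (ty_tens (t P) tf).
rewrite -!catA => h; apply: eqm_trans h _.
have := eqm_tens (tens_tid3 P P' hf) (eqm_refl rel (t (R' ++ R))).
by rewrite -!catA.
Qed.

Lemma whisk_swap P Q R v w v' w' f g : ty f v w -> ty g v' w' ->
  eqv (P ++ v ++ Q ++ v' ++ R) (P ++ w ++ Q ++ w' ++ R)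
    (whisk P f (Q ++ w' ++ R) ∘ whisk (P ++ v ++ Q) g R)
    (whisk (P ++ w ++ Q) g R ∘ whisk P f (Q ++ v' ++ R)).
Proof.
move=> hf hg; have t T := @ty_id K S T.
have i T : eqv T T (tid T) (tid T) by apply: eqm_refl.
(* Both sides equal [tid P ⊗ f ⊗ whisk Q g R]. *)
have B x : eqv ((P ++ x) ++ Q ++ v' ++ R) ((P ++ x) ++ Q ++ w' ++ R)
    (whisk (P ++ x ++ Q) g R) (tid (P ++ x) ⊗ whisk Q g R).
  have h := eqm_sym (whisk_whisk (P ++ x) Q R [::] hg).
  have := h; rewrite /= -!catA => {}h; apply: eqm_trans h _.
  rewrite {1}/whisk.
  have tq : ty (tid Q ⊗ g) (Q ++ v') (Q ++ w') by apply: ty_tens.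
  have e1 : eqv (P ++ x ++ Q ++ v') (P ++ x ++ Q ++ w')
      (tid (P ++ x) ⊗ whisk Q g [::]) (tid (P ++ x) ⊗ (tid Q ⊗ g)).
    have := eqm_tens (i (P ++ x)) (eqm_tensm1 rel tq).
    by rewrite -!catA.
  have := eqm_tens e1 (i R); rewrite -!catA => {}h; apply: eqm_trans h _.
  have := eqm_sym (eqm_tensA rel (t (P ++ x)) tq (t R)).
  by rewrite -!catA.
have tP x : ty (tid (P ++ x) : tm K S) (P ++ x) (P ++ x) by apply: t.
have tpf : ty (tid P ⊗ f) (P ++ v) (P ++ w) by apply: ty_tens.
have tg : ty (whisk Q g R) (Q ++ v' ++ R) (Q ++ w' ++ R) by apply: whisk_ty.
apply: (@eqm_trans _ _ _ _ _ _ ((tid P ⊗ f) ⊗ whisk Q g R)).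
  have e1 : eqv ((P ++ v) ++ Q ++ w' ++ R) ((P ++ w) ++ Q ++ w' ++ R)
    (whisk P f (Q ++ w' ++ R)) (whisk P f (Q ++ w' ++ R)).
    rewrite -!catA; exact/eqm_refl/whisk_ty.
  have := eqm_comp e1 (B v); rewrite -!catA => h; apply: eqm_trans h _.
  have := eqm_sym (eqm_tens_comp rel tpf (tP v) (t _) tg).
  rewrite -!catA => h; apply: eqm_trans h _.
  have := eqm_tens (eqm_compm1 rel tpf) (eqm_comp1m rel tg).
  by rewrite -!catA.
apply: eqm_sym.
have e1 : eqv ((P ++ v) ++ Q ++ v' ++ R) ((P ++ w) ++ Q ++ v' ++ R)
  (whisk P f (Q ++ v' ++ R)) (whisk P f (Q ++ v' ++ R)).
  rewrite -!catA; exact/eqm_refl/whisk_ty.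
have := eqm_comp (B w) e1; rewrite -!catA => h; apply: eqm_trans h _.
have := eqm_sym (eqm_tens_comp rel (tP w) tpf tg (t _)).
rewrite -!catA => h; apply: eqm_trans h _.
have := eqm_tens (eqm_comp1m rel tpf) (eqm_compm1 rel tg).
by rewrite -!catA.
Qed.

Lemma whisk_lin P R v w k f g : ty f v w -> ty g v w ->
  eqv (P ++ v ++ R) (P ++ w ++ R) (whisk P ((k •: f) ⊞ g) R)
     ((k •: whisk P f R) ⊞ whisk P g R).
Proof.
move=> hf hg; have t T := @ty_id K S T.
have tk : ty (k •: f) v w by apply: ty_scale.
rewrite !catA.
apply: eqm_trans (eqm_tens (eqm_tensDr _ (t P) tk hg) (eqm_refl _ (t R))) _.
apply: eqm_trans (eqm_tensDl _ (ty_tens (t P) tk) (ty_tens (t P) hg) (t R)) _.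
apply: eqm_add; last by apply: eqm_refl; do 2?apply: ty_tens.
apply: eqm_trans (eqm_tens (eqm_tensZr _ k (t P) hf) (eqm_refl _ (t R))) _.
exact: eqm_tensZl (ty_tens (t P) hf) (t R).
Qed.

End Whiskers.

(** * Layered diagrams *)

Section Diagrams.
Context (K : fieldType) (q : K).
Local Notation sg := (SchurBullet'_sig K).
Local Notation term := (tm K sg).
Local Notation eqv := (eqm (SchurBullet'_rel q)).

(* A state is a list of letters; the letter [LB 0] stands for the empty word, so
   that strands of thickness zero need no special treatment. *)
Inductive letter := LB of nat | LR of K.
Definition wd (l : letter) : seq (gob sg) :=
  match l with LB a => bl a | LR u => rd u end.
Definition wds (s : seq letter) : seq (gob sg) := flatten (map wd s).

Lemma wds_cat s t : wds (s ++ t) = wds s ++ wds t.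
Proof. by rewrite /wds map_cat flatten_cat. Qed.

(* [Dt false a] is the dot x_a and [Dt true a] its inverse. *)
Inductive atom :=
| Mg of nat & nat
| Sp of nat & nat
| Cr of nat & nat
| Ci of nat & nat
| Rr of nat & K
| Ll of K & nat
| Dt of bool & nat.

Definition atm (A : atom) : term :=
  match A with
  | Mg a b => mm a b
  | Sp a b => ss a b
  | Cr a b => cc a b
  | Ci a b => cci a b
  | Rr a u => rr a u
  | Ll u a => ll u a
  | Dt e a => if e then xxi' q a else xx' q a
  end.

Definition ains (A : atom) : seq letter :=
  match A with
  | Mg a b | Cr a b => [:: LB a; LB b]
  | Ci a b => [:: LB b; LB a]
  | Sp a b => [:: LB (a + b)]
  | Rr a u => [:: LB a; LR u]
  | Ll u a => [:: LR u; LB a]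
  | Dt _ a => [:: LB a]
  end.

Definition aouts (A : atom) : seq letter :=
  match A with
  | Mg a b => [:: LB (a + b)]
  | Cr a b => [:: LB b; LB a]
  | Sp a b | Ci a b => [:: LB a; LB b]
  | Rr a u => [:: LR u; LB a]
  | Ll u a => [:: LB a; LR u]
  | Dt _ a => [:: LB a]
  end.

Lemma atm_ty A : ty (atm A) (wds (ains A)) (wds (aouts A)).
Proof.
case: A => [a b|a b|a b|a b|a u|u a|[] a]; rewrite /wds /= ?cats0.
- exact: ty_mm.
- exact: ty_ss.
- exact: ty_cc.
- exact: ty_cci.
- exact: ty_rr.
- exact: ty_ll.
- exact: ty_xxi'.
- exact: ty_xx'.
Qed.

Lemma ains_gt0 A : (0 < size (ains A))%N. Proof. by case: A. Qed.

(* Arithmetic on positions has its own constants, so that it can be evaluated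
   without unfolding the thicknesses. *)
Fixpoint addp (m n : nat) := if m is m'.+1 then (addp m' n).+1 else n.
Fixpoint subp (m n : nat) :=
  match m, n with m'.+1, n'.+1 => subp m' n' | _, _ => m end.
Fixpoint lep (m n : nat) :=
  match m, n with 0, _ => true | m'.+1, n'.+1 => lep m' n' | _, _ => false end.

Lemma addpE m n : addp m n = (m + n)%N. Proof. by elim: m => //= m ->. Qed.
Lemma subpE m n : subp m n = (m - n)%N.
Proof. by elim: m n => [|m IH] [|n] //=; rewrite IH. Qed.
Lemma lepE m n : lep m n = (m <= n)%N.
Proof. by elim: m n => [|m IH] [|n] //=; rewrite IH. Qed.

(* The layer [(i, A)] applies [A] to the letters of the state from the [i]-th on. *)
Definition diag := seq (nat * atom).
Definition shift n (d : diag) : diag := [seq (addp n p.1, p.2) | p <- d].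
Definition step (s : seq letter) (p : nat * atom) :=
  take p.1 s ++ aouts p.2 ++ drop (addp p.1 (size (ains p.2))) s.
Definition st s d := foldl step s d.
Fixpoint valid s t (d : diag) : Prop :=
  if d is p :: d' then
    take (size (ains p.2)) (drop p.1 s) = ains p.2 /\ valid (step s p) t d'
  else s = t.
Definition layer s (p : nat * atom) : term :=
  whisk (wds (take p.1 s)) (atm p.2) (wds (drop (addp p.1 (size (ains p.2))) s)).
Fixpoint run s (d : diag) : term :=
  if d is p :: d' then run (step s p) d' ∘ layer s p else tid (wds s).

Lemma valid_st s t d : valid s t d -> st s d = t.
Proof. by elim: d s => [|p d IH] s //= [_]; apply: IH. Qed.

Lemma layerP s p : take (size (ains p.2)) (drop p.1 s) = ains p.2 ->
  exists P R, [/\ s = P ++ ains p.2 ++ R, size P = p.1,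
    step s p = P ++ aouts p.2 ++ R & layer s p = whisk (wds P) (atm p.2) (wds R)].
Proof.
case: p => i A /= e; exists (take i s), (drop (addp i (size (ains A))) s).
split=> //.
- by rewrite -[X in X ++ drop _ _]e addpE addnC -drop_drop !cat_take_drop.
- rewrite size_takel //; case: (leqP i (size s)) => // /ltnW h.
  by have := ains_gt0 A; rewrite -e drop_oversize.
Qed.

Lemma layerK P R i A : size P = i ->
  [/\ take (size (ains A)) (drop i (P ++ ains A ++ R)) = ains A,
    step (P ++ ains A ++ R) (i, A) = P ++ aouts A ++ R &
    layer (P ++ ains A ++ R) (i, A) = whisk (wds P) (atm A) (wds R)].
Proof.
move=> <-; rewrite /step /layer /= drop_size_cat // take_size_cat //.
by rewrite addpE [(_ + size _)%N]addnC -drop_drop drop_size_cat // take_size_cat // drop_size_cat.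
Qed.

Lemma layer_ty s p : take (size (ains p.2)) (drop p.1 s) = ains p.2 ->
  ty (layer s p) (wds s) (wds (step s p)).
Proof.
move=> /layerP[P [R [-> _ -> ->]]]; rewrite !wds_cat.
exact/whisk_ty/atm_ty.
Qed.

Lemma run_ty s t d : valid s t d -> ty (run s d) (wds s) (wds t).
Proof.
elim: d s => [|p d IH] s /= => [->|[h /IH hd]]; first exact: ty_id.
by apply: ty_comp hd _; apply: layer_ty.
Qed.

Lemma valid_cat s r t d d' : valid s r d -> valid r t d' -> valid s t (d ++ d').
Proof. by elim: d s => [|p d IH] s /= => [->|[? ?] ?] //; split=> //; apply: IH. Qed.

Lemma valid_catE s t d d' :
  valid s t (d ++ d') -> valid s (st s d) d /\ valid (st s d) t d'.
Proof.
elim: d s => [|p d IH] s /= => [//|[h /IH [h1 h2]]]; split=> //.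
Qed.

Lemma run_cat s r t d d' : valid s r d -> valid r t d' ->
  eqv (wds s) (wds t) (run s (d ++ d')) (run r d' ∘ run s d).
Proof.
elim: d s => [|p d IH] s /=.
  by move=> -> hd; apply/eqm_sym/eqm_compm1/run_ty.
move=> [hp hd] hd'.
apply: eqm_trans (eqm_comp (IH _ hd hd') (eqm_refl _ (layer_ty hp))) _.
exact/eqm_sym/(eqm_compA _ (run_ty hd') (run_ty hd) (layer_ty hp)).
Qed.

(* [shp n d]: [d] only looks at the first [n] letters. *)
Fixpoint shp n (d : diag) : bool :=
  if d is p :: d' then
    lep (addp p.1 (size (ains p.2))) n &&
    shp (addp (subp n (size (ains p.2))) (size (aouts p.2))) d'
  else true.

Lemma valid_shift P s R d : shp (size s) d ->
  valid (P ++ s ++ R) (st (P ++ s ++ R) (shift (size P) d)) (shift (size P) d) ->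
  valid s (st s d) d /\
  st (P ++ s ++ R) (shift (size P) d) = P ++ st s d ++ R.
Proof.
elim: d s => [|[i A] d IH] s //=.
rewrite !addpE lepE subpE => /andP[le_s hd].
rewrite drop_cat ltnNge leq_addr /= addKn.
have le_is : (i <= size s)%N by apply: leq_trans le_s; rewrite leq_addr.
have -> : take (size (ains A)) (drop i (s ++ R)) = take (size (ains A)) (drop i s).
  rewrite drop_cat; case: ltngtP le_is => // [lt_i _|e _]; last first.
    by move: le_s (ains_gt0 A); rewrite e; lia.
  rewrite takel_cat // size_drop; lia.
have -> : step (P ++ s ++ R) ((size P + i)%N, A) = P ++ step s (i, A) ++ R.
  rewrite /step /= !addpE take_cat ltnNge leq_addr /= addKn -!catA; congr (_ ++ _).
  rewrite takel_cat //; congr (_ ++ (_ ++ _)).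
  rewrite -addnA drop_cat ltnNge leq_addr /= addKn drop_cat.
  by case: ltngtP le_s => // -> _; rewrite subnn drop0 drop_size.
move=> [e h]; have := IH (step s (i, A)).
have es : size (step s (i, A)) = (size s - size (ains A) + size (aouts A))%N.
  rewrite /step !size_cat /= addpE size_drop size_takel //; lia.
by rewrite es => /(_ hd h) [h1 h2].
Qed.

Lemma shift_valid P s R t d : valid s t d ->
  valid (P ++ s ++ R) (P ++ t ++ R) (shift (size P) d) /\
  eqv (wds (P ++ s ++ R)) (wds (P ++ t ++ R))
    (run (P ++ s ++ R) (shift (size P) d)) (whisk (wds P) (run s d) (wds R)).
Proof.
elim: d s => [|[i A] d IH] s /=.
  move=> ->; split=> //; rewrite !wds_cat; exact/eqm_sym/whisk_id.
move=> [/(@layerP s (i, A)) [P' [R' [-> /= sP' es el]]] hd].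
have [h1 h2] := IH _ hd; rewrite es in h1 h2 hd *.
have -> : P ++ (P' ++ ains A ++ R') ++ R = (P ++ P') ++ ains A ++ (R' ++ R).
  by rewrite -!catA.
have sPP : size (P ++ P') = addp (size P) i by rewrite size_cat sP' addpE.
have [k1 k2 k3] := layerK (R' ++ R) A sPP.
rewrite k1 k2 k3 el; rewrite -!catA in h1 h2 *; split=> //.
apply: eqm_trans (eqm_comp h2 _) _.
  have := eqm_sym (whisk_whisk (SchurBullet'_rel q) (wds P) (wds P') (wds R) (wds R') (atm_ty A)).
  rewrite -!catA -!wds_cat => h; apply: eqm_trans h _.
  apply: eqm_refl; rewrite !wds_cat.
  have := whisk_ty (wds P) (wds R) (whisk_ty (wds P') (wds R') (atm_ty A)).
  by rewrite -!catA.
have tr := run_ty hd; have tl := whisk_ty (wds P') (wds R') (atm_ty A).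
rewrite !wds_cat in tr tl.
have := eqm_sym (whisk_comp (SchurBullet'_rel q) (wds P) (wds R) tr tl).
by rewrite !wds_cat -!catA.
Qed.

(* Ill-typed diagrams represent 0; hence the sums below may run over any range
   that contains the terms of the paper. *)
Definition D s t d : phom (SchurBullet'_rel q) (wds s) (wds t) :=
  match pselect (valid s t d) with
  | left h => cls _ (run_ty h)
  | right _ => 0
  end.

Lemma D_valid s t d (h : valid s t d) : D s t d = cls _ (run_ty h).
Proof.
by rewrite /D; case: pselect => // h'; apply/clsP/eqm_refl/run_ty.
Qed.

Lemma D_invalid s t d : ~ valid s t d -> D s t d = 0.
Proof. by rewrite /D; case: pselect. Qed.

Lemma D_eq s t d d' : (valid s t d <-> valid s t d') ->
  (valid s t d -> valid s t d' -> eqv (wds s) (wds t) (run s d) (run s d')) ->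
  D s t d = D s t d'.
Proof.
move=> e h; have [v|v] := pselect (valid s t d).
  have v' := e.1 v; rewrite (D_valid v) (D_valid v'); exact/clsP/h.
by rewrite !D_invalid // -e.
Qed.

Lemma D_cons s t p d (h : take (size (ains p.2)) (drop p.1 s) = ains p.2) :
  D s t (p :: d) = Defs.pcomp (D (step s p) t d) (cls (SchurBullet'_rel q) (layer_ty h)).
Proof.
have [v|v] := pselect (valid (step s p) t d).
  by rewrite (D_valid v) (D_valid (conj h v : valid s t (p :: d))) pcompE; apply/clsP/eqm_refl/ty_comp/layer_ty/h/run_ty.
rewrite (D_invalid v) D_invalid => [|[_ /v]] //.
have := pcomp_linl (-1) 0 0 (cls (SchurBullet'_rel q) (layer_ty h)) => /(_ (wds t)).
by rewrite scaler0 addr0 scaleN1r addNr => <-.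
Qed.

Lemma D_cons_eq s s' t p d d' : take (size (ains p.2)) (drop p.1 s) = ains p.2 ->
  step s p = s' -> D s' t d = D s' t d' -> D s t (p :: d) = D s t (p :: d').
Proof. by move=> h <- e; rewrite !(D_cons _ _ h) e. Qed.

Lemma lin_sum (V W : lmodType K) (L : V -> W) :
  (forall k x y, L (k *: x + y) = k *: L x + L y) ->
  forall (I : Type) (r : seq I) (P : pred I) (k : I -> K) (F : I -> V),
  L (\sum_(i <- r | P i) k i *: F i) = \sum_(i <- r | P i) k i *: L (F i).
Proof.
move=> lin I r P k F.
have L0 : L 0 = 0 by have := lin (-1) 0 0; rewrite scaler0 addr0 scaleN1r addNr.
elim: r => [|i r IH]; first by rewrite !big_nil.
by rewrite !big_cons; case: ifP => // _; rewrite lin IH.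
Qed.

Lemma valid_inj s s' t d : size s = size s' ->
  valid s t d -> valid s' t d -> s = s'.
Proof.
elim: d s s' => [|p d IH] s s' e /= => [-> //|].
move=> [/layerP[P [R [es sP -> _]]] h] [/layerP[P' [R' [es' sP' -> _]]] h'].
have : P ++ aouts p.2 ++ R = P' ++ aouts p.2 ++ R'.
  apply: IH h h'; move: e; rewrite es es' !size_cat sP sP'; lia.
move=> eq; rewrite es es'.
have eP : P = P' by have := congr1 (take p.1) eq; rewrite -{1}sP -sP' !take_size_cat.
move: eq; rewrite eP => /(congr1 (drop (size P'))); rewrite !drop_size_cat // => eq.
by have := congr1 (drop (size (aouts p.2))) eq; rewrite !drop_size_cat // => ->.
Qed.

Lemma ctx_lin s t P r r' R pre post :
  valid s (P ++ r ++ R) pre -> valid (P ++ r' ++ R) t post ->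
  exists L : phom (SchurBullet'_rel q) (wds r) (wds r') ->
             phom (SchurBullet'_rel q) (wds s) (wds t),
  (forall k x y, L (k *: x + y) = k *: L x + L y) /\
  forall d, shp (size r) d ->
    (size (st r d) = size r') ->
    D s t (pre ++ shift (size P) d ++ post) = L (D r r' d).
Proof.
move=> h1 h2; have t1 := run_ty h1; have t2 := run_ty h2.
have tx f (h : ty f (wds r) (wds r')) :
  ty (run (P ++ r' ++ R) post ∘ (whisk (wds P) f (wds R) ∘ run s pre)) (wds s) (wds t).
  apply: ty_comp t2 _; apply: ty_comp t1; rewrite !wds_cat; exact: whisk_ty.
pose L (x : phom (SchurBullet'_rel q) (wds r) (wds r')) := cls (SchurBullet'_rel q) (tx _ (tvalP (repr x))).
have LE f (h : ty f (wds r) (wds r')) : L (cls _ h) = cls _ (tx _ h).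
  apply/clsP; apply: eqm_comp (eqm_refl _ t2) (eqm_comp _ (eqm_refl _ t1)).
  rewrite !wds_cat; apply: whisk_eq; exact: eqm_repr.
have lin k x y : L (k *: x + y) = k *: L x + L y.
  elim/clsW: x => f hf; elim/clsW: y => g hg.
  rewrite cls_scale cls_add !LE cls_scale cls_add; apply/clsP.
  have wf := whisk_ty (wds P) (wds R) hf; have wg := whisk_ty (wds P) (wds R) hg.
  rewrite -!wds_cat in wf wg.
  have kf := ty_scale k wf.
  apply: eqm_trans (eqm_comp (eqm_refl _ t2) (eqm_comp _ (eqm_refl _ t1))) _.
    have := whisk_lin (SchurBullet'_rel q) (wds P) (wds R) k hf hg; rewrite -!wds_cat; exact.
  apply: eqm_trans (eqm_comp (eqm_refl _ t2) (eqm_compDl _ kf wg t1)) _.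
  apply: eqm_trans (eqm_compDr _ t2 (ty_comp kf t1) (ty_comp wg t1)) _.
  apply: eqm_add; last by apply: eqm_refl; apply: ty_comp t2 (ty_comp wg t1).
  apply: eqm_trans (eqm_comp (eqm_refl _ t2) (eqm_compZl _ k wf t1)) _.
  exact (eqm_compZr (SchurBullet'_rel q) k t2 (ty_comp wf t1)).
exists L; split=> // d hs sz.
have [v|v] := pselect (valid r r' d).
  have [v' e] := shift_valid P R v.
  have v2 := valid_cat h1 (valid_cat v' h2).
  rewrite (D_valid v) (D_valid v2) LE; apply/clsP.
  apply: eqm_trans (run_cat h1 (valid_cat v' h2)) _.
  apply: eqm_trans (eqm_comp (run_cat v' h2) (eqm_refl _ t1)) _.
  apply: eqm_trans (eqm_comp (eqm_comp (eqm_refl _ t2) e) (eqm_refl _ t1)) _.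
  apply/eqm_sym/(eqm_compA _ t2 _ t1); rewrite !wds_cat; apply/whisk_ty/run_ty/v.
rewrite (D_invalid v).
have L0 : L 0 = 0 by have := lin (-1) 0 0; rewrite scaler0 addr0 scaleN1r addNr.
rewrite L0 D_invalid // => /valid_catE[v1 /valid_catE[v2 v3]]; apply: v.
rewrite (valid_st h1) in v2 v3.
have [w1 w2] := valid_shift hs v2.
rewrite w2 in v3.
have : P ++ st r d ++ R = P ++ r' ++ R.
  by apply: valid_inj v3 h2; rewrite !size_cat sz.
by move/(congr1 (fun x => take (size r') (drop (size P) x))); rewrite !drop_size_cat //
  (take_size_cat _ sz) take_size_cat // => <-.
Qed.

(* [d1] is the block of [m] layers of [d] that follows the first [n] ones, moved
   [i] letters to the right. *)
Lemma D_ctx (I : Type) (r : seq I) (P : pred I) (k : I -> K) (F : I -> diag)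
    n m i s t d a b d1 :
  D a b d1 = \sum_(j <- r | P j) k j *: D a b (F j) ->
  take m (drop n d) = shift i d1 ->
  let S := st s (take n d) in
  let R := drop (addp i (size a)) S in
  [/\ valid s (take i S ++ a ++ R) (take n d), size (take i S) = i &
      valid (take i S ++ b ++ R) t (drop (addp n m) d)] ->
  shp (size a) d1 /\ size (st a d1) = size b ->
  (forall j, P j -> shp (size a) (F j) /\ size (st a (F j)) = size b) ->
  D s t d = \sum_(j <- r | P j)
    k j *: D s t (take n d ++ shift i (F j) ++ drop (addp n m) d).
Proof.
move=> e e1 S R [v1 si v2] [h1 h2] hF.
have [L [lin HL]] := ctx_lin v1 v2.
have {1}-> : d = take n d ++ shift i d1 ++ drop (addp n m) d.
  by rewrite -e1 addpE addnC -drop_drop !cat_take_drop.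
rewrite -{1}si HL // e lin_sum //; apply: eq_bigr => j Pj.
by have [? ?] := hF _ Pj; rewrite -HL // si.
Qed.

Lemma D_ctx1 n m i s t d a b d1 d2 :
  D a b d1 = D a b d2 ->
  take m (drop n d) = shift i d1 ->
  let S := st s (take n d) in
  let R := drop (addp i (size a)) S in
  [/\ valid s (take i S ++ a ++ R) (take n d), size (take i S) = i &
      valid (take i S ++ b ++ R) t (drop (addp n m) d)] ->
  shp (size a) d1 /\ size (st a d1) = size b ->
  shp (size a) d2 /\ size (st a d2) = size b ->
  D s t d = D s t (take n d ++ shift i d2 ++ drop (addp n m) d).
Proof.
move=> e e1 S R h h1 h2.
have e' : D a b d1 = \sum_(j <- [:: tt]) 1 *: D a b d2 by rewrite big_seq1 scale1r.
by rewrite (D_ctx e' e1 h h1) // big_seq1 scale1r.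
Qed.

Lemma D_ctxZ n m i s t d a b d1 k d2 :
  D a b d1 = k *: D a b d2 ->
  take m (drop n d) = shift i d1 ->
  let S := st s (take n d) in
  let R := drop (addp i (size a)) S in
  [/\ valid s (take i S ++ a ++ R) (take n d), size (take i S) = i &
      valid (take i S ++ b ++ R) t (drop (addp n m) d)] ->
  shp (size a) d1 /\ size (st a d1) = size b ->
  shp (size a) d2 /\ size (st a d2) = size b ->
  D s t d = k *: D s t (take n d ++ shift i d2 ++ drop (addp n m) d).
Proof.
move=> e e1 S R h h1 h2.
have e' : D a b d1 = \sum_(j <- [:: tt]) k *: D a b d2 by rewrite big_seq1.
by rewrite (D_ctx e' e1 h h1) // big_seq1.
Qed.

Lemma D_ctx2 n m i s t d a b d1 k d2 l d3 :
  D a b d1 = k *: D a b d2 + l *: D a b d3 ->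
  take m (drop n d) = shift i d1 ->
  let S := st s (take n d) in
  let R := drop (addp i (size a)) S in
  [/\ valid s (take i S ++ a ++ R) (take n d), size (take i S) = i &
      valid (take i S ++ b ++ R) t (drop (addp n m) d)] ->
  shp (size a) d1 /\ size (st a d1) = size b ->
  shp (size a) d2 /\ size (st a d2) = size b ->
  shp (size a) d3 /\ size (st a d3) = size b ->
  D s t d = k *: D s t (take n d ++ shift i d2 ++ drop (addp n m) d) +
            l *: D s t (take n d ++ shift i d3 ++ drop (addp n m) d).
Proof.
move=> e e1 S R h h1 h2 h3.
have e' : D a b d1 = \sum_(j <- [:: true; false])
    (if j then k else l) *: D a b (if j then d2 else d3).
  by rewrite big_cons big_seq1.
by rewrite (D_ctx e' e1 h h1) => [|[] _] //; rewrite big_cons big_seq1.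
Qed.

Definition dsim (d d' : diag) := forall s t,
  (valid s t d <-> valid s t d') /\
  (valid s t d -> eqv (wds s) (wds t) (run s d) (run s d')).

Lemma dsim_refl d : dsim d d.
Proof. by move=> s t; split=> // h; apply/eqm_refl/run_ty. Qed.

Lemma dsim_trans d1 d2 d3 : dsim d1 d2 -> dsim d2 d3 -> dsim d1 d3.
Proof.
move=> h1 h2 s t; have [a1 b1] := h1 s t; have [a2 b2] := h2 s t.
split; first by rewrite a1.
by move=> v; apply: eqm_trans (b1 v) (b2 _); apply/a1.
Qed.

Lemma dsim_cons p d d' : dsim d d' -> dsim (p :: d) (p :: d').
Proof.
move=> h s t; have [a b] := h (step s p) t; split=> /=.
  by split=> -[? ?]; split=> //; apply/a.
by move=> [hp hd]; apply: eqm_comp (b hd) (eqm_refl _ (layer_ty hp)).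
Qed.

Lemma cat_split (T : Type) (P0 X P Y : seq T) : P ++ X = P0 ++ Y ->
  (size P0 <= size P)%N -> exists2 Q, P = P0 ++ Q & Y = Q ++ X.
Proof.
move=> e h; exists (drop (size P0) P).
  have := congr1 (take (size P0)) e; rewrite takel_cat // take_size_cat // => {1}<-.
  by rewrite cat_take_drop.
have := congr1 (drop (size P0)) e; rewrite (drop_size_cat Y erefl) => <-.
rewrite drop_cat; case: ltngtP h => // e0 _.
by rewrite e0 subnn drop0 drop_size.
Qed.

Lemma dsim_swap i A j B d : (j + size (ains B) <= i)%N ->
  dsim ((i, A) :: (j, B) :: d)
       ((j, B) :: ((i - size (ains B) + size (aouts B))%N, A) :: d).
Proof.
move=> le_ji s t.
pose good P Q R := [/\ s = P ++ ains B ++ Q ++ ains A ++ R, size P = j &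
  size (P ++ ains B ++ Q) = i].
have H P Q R : good P Q R ->
  (valid s t ((i, A) :: (j, B) :: d) <->
   valid s t ((j, B) :: ((i - size (ains B) + size (aouts B))%N, A) :: d)) /\
  (valid s t ((i, A) :: (j, B) :: d) -> eqv (wds s) (wds t)
    (run s ((i, A) :: (j, B) :: d))
    (run s ((j, B) :: ((i - size (ains B) + size (aouts B))%N, A) :: d))).
  move=> [-> sP sQ].
  have [k1 k2 k3] := layerK R A sQ.
  have [l1 l2 l3] := layerK (Q ++ aouts A ++ R) B sP.
  have [m1 m2 m3] := layerK (Q ++ ains A ++ R) B sP.
  have sQ' : size (P ++ aouts B ++ Q) = (i - size (ains B) + size (aouts B))%N.
    by rewrite -sQ !size_cat; lia.
  have [n1 n2 n3] := layerK R A sQ'.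
  rewrite -!catA in k1 k2 k3 n1 n2 n3.
  rewrite /= k1 k2 k3 l1 l2 l3 m1 m2 m3 n1 n2 n3; split; first by split=> -[_ [_ ?]].
  move=> [_ [_ hd]].
  have tr := run_ty hd.
  rewrite !wds_cat in tr *.
  have wA X Y := whisk_ty X Y (atm_ty A); have wB X Y := whisk_ty X Y (atm_ty B).
  have e1 := wB (wds P) (wds Q ++ wds (aouts A) ++ wds R).
  have e2 := wA (wds P ++ wds (ains B) ++ wds Q) (wds R).
  have e3 := wB (wds P) (wds Q ++ wds (ains A) ++ wds R).
  have e4 := wA (wds P ++ wds (aouts B) ++ wds Q) (wds R).
  rewrite -!catA in e1 e2 e3 e4.
  apply: eqm_trans (eqm_sym (eqm_compA _ tr e1 e2)) _.
  apply: eqm_trans (eqm_compA _ tr e4 e3).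
  apply: eqm_comp (eqm_refl _ tr) _.
  exact: whisk_swap (atm_ty B) (atm_ty A).
have [v|v] := pselect (exists P Q R, good P Q R).
  by have [P [Q [R /H]]] := v.
have n1 : ~ valid s t ((i, A) :: (j, B) :: d).
  move=> [/layerP[P [R [es /= sP ep _]]]]; rewrite ep /=.
  move=> [/(@layerP _ (j, B))[P' [R' [es' /= sP' _ _]]] _].
  have {}es' : P ++ (aouts A ++ R) = (P' ++ ains B) ++ R' by rewrite es' catA.
  have [|Q eP _] := cat_split es'; first by rewrite size_cat; lia.
  by apply: v; exists P', Q, R; split; rewrite // ?es ?eP -?catA // catA -eP.
have n2 : ~ valid s t ((j, B) :: ((i - size (ains B) + size (aouts B))%N, A) :: d).
  move=> [/layerP[P [R [es /= sP ep _]]]]; rewrite ep /=.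
  move=> [/(@layerP _ (_, A))[P' [R' [es' /= sP' _ _]]] _].
  have {}es' : P' ++ (ains A ++ R') = (P ++ aouts B) ++ R by rewrite -es' catA.
  have [|Q eP eR] := cat_split es'; first by rewrite size_cat; lia.
  apply: v; exists P, Q, R'; split; rewrite // ?es ?eR //.
  by move: sP'; rewrite eP !size_cat; lia.
by split=> // /n1.
Qed.

(* Normal form for interchange: of two independent adjacent layers, the left one
   comes first. *)
Fixpoint ins_layer i A (d : diag) : diag :=
  match d with
  | (j, B) :: d' =>
    if lep (addp j (size (ains B))) i
    then (j, B) :: ins_layer (addp (subp i (size (ains B))) (size (aouts B))) A d'
    else (i, A) :: d
  | [::] => [:: (i, A)]
  end.

Fixpoint nf (d : diag) : diag :=
  if d is (i, A) :: d' then ins_layer i A (nf d') else [::].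

Lemma dsim_nf d : dsim d (nf d).
Proof.
have H i A d' : dsim ((i, A) :: d') (ins_layer i A d').
  elim: d' i => [|[j B] d' IH] i /=; first exact: dsim_refl.
  case: ifP => h; last exact: dsim_refl.
  rewrite !addpE subpE lepE in h *.
  by apply: dsim_trans (dsim_swap _ _ h) _; apply/dsim_cons/IH.
elim: d => [|[i A] d IH] /=; first exact: dsim_refl.
exact: dsim_trans (dsim_cons _ IH) (H _ _ _).
Qed.

Lemma D_nf s t d : D s t d = D s t (nf d).
Proof. by have [h1 h2] := @dsim_nf d s t; apply: D_eq => // v _; apply: h2. Qed.

Lemma D_nf_eq s t d d' : nf d = nf d' -> D s t d = D s t d'.
Proof. by move=> e; rewrite D_nf e -D_nf. Qed.

Definition triv (A : atom) : bool :=
  match A with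
  | Mg a b | Sp a b | Cr a b | Ci a b => (a == 0%N) || (b == 0%N)
  | Rr a _ | Ll _ a | Dt _ a => a == 0%N
  end.

Lemma triv_id A : triv A -> wds (ains A) = wds (aouts A) /\
  eqv (wds (ains A)) (wds (ains A)) (atm A) (tid (wds (ains A))).
Proof.
have r v : eqv v v (tid v) (tid v) by apply/eqm_refl/ty_id.
case: A => [a b|a b|a b|a b|a u|u a|[] a] /=; rewrite /wds /= ?cats0.
- by case/orP => /eqP->; case: (a) (b) => [|?] [|?]; rewrite /= ?addn0 //; split.
- by case/orP => /eqP->; case: (a) (b) => [|?] [|?]; rewrite /= ?addn0 //; split.
- by case/orP => /eqP->; case: (a) (b) => [|?] [|?]; rewrite /= ?addn0 //; split.
- by case/orP => /eqP->; case: (a) (b) => [|?] [|?]; rewrite /= ?addn0 //; split.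
- by move=> /eqP->; split.
- by move=> /eqP->; split.
- move=> /eqP->; split=> //.
  rewrite /xxi' /qfact big_nil invr1 /merge_ones /split_ones /=.
  have i := @ty_id K sg [::].
  have tc : ty (tid [::] ∘ tid [::] ∘ tid [::] : term) [::] [::].
    by apply: ty_comp (ty_comp i i) i.
  apply: eqm_trans (eqm_scale1 _ tc) _.
  exact: eqm_trans (eqm_compm1 _ (ty_comp i i)) (eqm_compm1 _ i).
- by move=> /eqP->; split.
Qed.

(* Equality up to layers that are identities because a thickness vanishes. *)
Inductive zsim : seq letter -> diag -> seq letter -> diag -> Prop :=
| zsim_nil s s' : wds s = wds s' -> zsim s [::] s' [::]
| zsim_l s p d s' d' :
    triv p.2 -> zsim (step s p) d s' d' -> zsim s (p :: d) s' d'
| zsim_r s p d s' d' :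
    triv p.2 -> zsim s' d' (step s p) d -> zsim s' d' s (p :: d)
| zsim_cons s i d s' i' d' A :
    wds (take i s) = wds (take i' s') ->
    wds (drop (addp i (size (ains A))) s) = wds (drop (addp i' (size (ains A))) s') ->
    zsim (step s (i, A)) d (step s' (i', A)) d' ->
    zsim s ((i, A) :: d) s' ((i', A) :: d').

Lemma triv_layer s p : triv p.2 -> take (size (ains p.2)) (drop p.1 s) = ains p.2 ->
  wds s = wds (step s p) /\ eqv (wds s) (wds s) (layer s p) (tid (wds s)).
Proof.
move=> /triv_id [e1 e2] /layerP[P [R [-> _ -> ->]]]; rewrite !wds_cat e1; split=> //.
rewrite e1 in e2.
exact: eqm_trans (whisk_eq _ _ e2) (whisk_id _ _ _ _).
Qed.

Lemma zsimP s d s' d' t t' : zsim s d s' d' -> valid s t d -> valid s' t' d' ->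
  [/\ wds s = wds s', wds t = wds t' & eqv (wds s) (wds t) (run s d) (run s' d')].
Proof.
elim=> {s d s' d'}.
- by move=> s s' e /= <- <-; rewrite e; split=> //; apply/eqm_refl/ty_id.
- move=> s p d s' d' hp _ IH /= [h hd] hd'.
  have [e1 e2 e3] := IH hd hd'; have [f1 f2] := triv_layer hp h.
  rewrite -f1 in e1 e3; split=> //; apply: eqm_trans (eqm_comp e3 f2) _.
  by apply: eqm_compm1; case: (eqm_ty e3).
- move=> s p d s' d' hp _ IH /= hd' [h hd].
  have [e1 e2 e3] := IH hd' hd; have [f1 f2] := triv_layer hp h.
  rewrite -f1 in e1; split=> //; rewrite e1 in e3 *.
  have [_ tr] := eqm_ty e3.
  apply: eqm_trans e3 (eqm_sym _).
  rewrite f1 in tr f2 *.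
  apply: eqm_trans (eqm_comp (eqm_refl _ tr) f2) _.
  exact: eqm_compm1.
- move=> s i d s' i' d' A e1 e2 _ IH /= [h hd] [h' hd'].
  have [f1 f2 f3] := IH hd hd'.
  have el : layer s (i, A) = layer s' (i', A) by rewrite /layer /= e1 e2.
  split=> //.
    rewrite -[s](cat_take_drop i) -[drop i s](cat_take_drop (size (ains A))).
    rewrite -[s'](cat_take_drop i') -[drop i' s'](cat_take_drop (size (ains A))).
    by rewrite !drop_drop [(_ + i)%N]addnC [(_ + i')%N]addnC h h' !wds_cat e1 -!addpE e2.
  by rewrite el in h *; apply: eqm_comp f3 _; rewrite -el; apply/eqm_refl/layer_ty.
Qed.

Lemma D_zsim s t d d' : zsim s d s d' -> valid s t d -> valid s t d' ->
  D s t d = D s t d'.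
Proof.
by move=> z v v'; apply: D_eq => // _ _; case: (zsimP z v v').
Qed.

Definition mono f s t d := valid s t d /\ eqv (wds s) (wds t) f (run s d).

Lemma mono_atom A : mono (atm A) (ains A) (aouts A) [:: (0%N, A)].
Proof.
have [k1 k2 k3] := @layerK [::] [::] 0 A erefl.
rewrite cats0 in k1 k2 k3; rewrite /mono /= k1 k2 k3 ?cats0 /=; split=> //.
have t := atm_ty A.
apply: eqm_sym; apply: eqm_trans (eqm_comp1m _ _) _.
  by have := whisk_ty [::] [::] t; rewrite !cats0.
apply: eqm_trans (eqm_tensm1 _ _) (eqm_tens1m _ t).
exact: (ty_tens (@ty_id K sg [::]) t).
Qed.

Lemma mono_id s : mono (tid (wds s)) s s [::].
Proof. by split=> //; apply/eqm_refl/ty_id. Qed.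

Lemma mono_comp f g s r t d d' :
  mono f r t d -> mono g s r d' -> mono (f ∘ g) s t (d' ++ d).
Proof.
move=> [v e] [v' e']; split; first exact: valid_cat v' v.
exact: eqm_trans (eqm_comp e e') (eqm_sym (run_cat v' v)).
Qed.

Lemma shift0 d : shift 0 d = d.
Proof. by rewrite /shift /= -[RHS]map_id; apply: eq_map => -[]. Qed.

Lemma mono_tens f g s t s' t' d d' : mono f s t d -> mono g s' t' d' ->
  mono (f ⊗ g) (s ++ s') (t ++ t') (d ++ shift (size t) d').
Proof.
move=> [v e] [v' e'].
have [w1 w2] := shift_valid [::] s' v; rewrite shift0 /= in w1 w2.
have [w3 w4] := shift_valid t [::] v'; rewrite !cats0 in w3 w4.
split; first exact: valid_cat w1 w3.
apply: eqm_sym; apply: eqm_trans (run_cat w1 w3) _.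
apply: eqm_trans (eqm_comp w4 w2) _; rewrite !wds_cat.
have tr := run_ty v; have tr' := run_ty v'.
have tx T := @ty_id K sg T.
have tf := (eqm_ty e).1; have tg := (eqm_ty e').1.
apply: (@eqm_trans _ _ _ _ _ _ ((tid (wds t) ⊗ run s' d') ∘ (run s d ⊗ tid (wds s')))).
  apply: eqm_comp.
    have := eqm_tensm1 (SchurBullet'_rel q) (ty_tens (tx (wds t)) tr').
    exact.
  have := eqm_tens (eqm_tens1m (SchurBullet'_rel q) tr) (eqm_refl _ (tx (wds s'))).
  exact.
apply: eqm_trans (eqm_sym (eqm_tens_comp _ (tx _) tr tr' (tx _))) _.
apply: eqm_tens.
  exact: eqm_trans (eqm_comp1m _ tr) (eqm_sym e).
exact: eqm_trans (eqm_compm1 _ tr') (eqm_sym e').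
Qed.

Definition rep f s t (x : phom (SchurBullet'_rel q) (wds s) (wds t)) :=
  exists h : ty f (wds s) (wds t), cls _ h = x.

Lemma rep_mono f s t d : mono f s t d -> rep f (D s t d).
Proof.
move=> [v e]; have [h _] := eqm_ty e; exists h.
by rewrite (D_valid v); apply/clsP.
Qed.

Lemma rep_add f g s t (x y : phom _ (wds s) (wds t)) :
  rep f x -> rep g y -> rep (f ⊞ g) (x + y).
Proof. by move=> [h <-] [h' <-]; exists (ty_add h h'); rewrite cls_add. Qed.

Lemma rep_scale f s t k (x : phom _ (wds s) (wds t)) :
  rep f x -> rep (k •: f) (k *: x).
Proof. by move=> [h <-]; exists (ty_scale k h); rewrite cls_scale. Qed.

Lemma rep_sum n (P : pred nat) (F : nat -> term) s t v w
    (x : nat -> phom _ (wds s) (wds t)) : v = wds s -> w = wds t ->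
  (forall i, (i < n)%N -> P i -> rep (F i) (x i)) ->
  rep (\big[tadd/tzero v w]_(0 <= i < n | P i) F i) (\sum_(0 <= i < n | P i) x i).
Proof.
move=> -> -> h; rewrite !big_mkord.
elim/big_rec2: _ => [|i y f Pi hf]; first by exists (ty_zero _ _ _).
exact: rep_add (h _ (ltn_ord i) Pi) hf.
Qed.

Lemma mono_idb a : mono (idb a) [:: LB a] [:: LB a] [::].
Proof. by have := mono_id [:: LB a]; rewrite /wds /= cats0. Qed.

Lemma mono_idr u : mono (idr u) [:: LR u] [:: LR u] [::].
Proof. exact: (mono_id [:: LR u]). Qed.

Lemma mono_mm a b : mono (mm a b) [:: LB a; LB b] [:: LB (a + b)] [:: (0%N, Mg a b)].
Proof. exact: mono_atom. Qed.
Lemma mono_ss a b : mono (ss a b) [:: LB (a + b)] [:: LB a; LB b] [:: (0%N, Sp a b)].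
Proof. exact: mono_atom. Qed.
Lemma mono_cc a b : mono (cc a b) [:: LB a; LB b] [:: LB b; LB a] [:: (0%N, Cr a b)].
Proof. exact: mono_atom. Qed.
Lemma mono_cci a b : mono (cci a b) [:: LB b; LB a] [:: LB a; LB b] [:: (0%N, Ci a b)].
Proof. exact: mono_atom. Qed.
Lemma mono_rr a u : mono (rr a u) [:: LB a; LR u] [:: LR u; LB a] [:: (0%N, Rr a u)].
Proof. exact: mono_atom. Qed.
Lemma mono_ll u a : mono (ll u a) [:: LR u; LB a] [:: LB a; LR u] [:: (0%N, Ll u a)].
Proof. exact: mono_atom. Qed.
Lemma mono_xx' a : mono (xx' q a) [:: LB a] [:: LB a] [:: (0%N, Dt false a)].
Proof. exact: (mono_atom (Dt false a)). Qed.
Lemma mono_xxi' a : mono (xxi' q a) [:: LB a] [:: LB a] [:: (0%N, Dt true a)].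
Proof. exact: (mono_atom (Dt true a)). Qed.
Lemma mono_x1 : mono (x1 K) [:: LB 1] [:: LB 1] [:: (0%N, Dt false 1)].
Proof. exact: (mono_atom (Dt false 1)). Qed.

Lemma mono_comp_eq f g s r r' t d d' :
  mono f r t d -> mono g s r' d' -> r' = r -> mono (f ∘ g) s t (d' ++ d).
Proof. by move=> hf hg e; apply: mono_comp hf _; rewrite -e. Qed.

Lemma mono_cast f s t s' t' d d' :
  mono f s t d -> s = s' -> t = t' -> nf d = nf d' -> mono f s' t' d'.
Proof.
move=> [v e] <- <- en; have [a1 b1] := dsim_nf d s t; have [a2 b2] := dsim_nf d' s t.
rewrite -en in a2 b2; have v' : valid s t d' by apply/a2/a1.
split=> //; apply: eqm_trans e (eqm_trans (b1 v) (eqm_sym (b2 v'))).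
Qed.

Lemma rel_D f g s t d (x : phom _ (wds s) (wds t)) :
  SchurBullet'_rel q f g -> mono f s t d -> rep g x -> D s t d = x.
Proof.
move=> r m [h <-]; have [h' <-] := rep_mono m.
exact/clsP/eqm_rel.
Qed.

Lemma repP f g s t (x y : phom _ (wds s) (wds t)) : rep f x -> rep g y ->
  x = y <-> eqv (wds s) (wds t) f g.
Proof. by move=> [h <-] [h' <-]; apply: clsP. Qed.

End Diagrams.

Arguments LB {K} _.
Arguments Mg {K} _ _.
Arguments Sp {K} _ _.
Arguments Cr {K} _ _.
Arguments Ci {K} _ _.
Arguments Dt {K} _ _.

Class generic (K : fieldType) (q : K) : Prop := Generic {
  q_neq0 : q != 0;
  qnum_neq0 : forall n, qnum q n.+1 != 0
}.
Arguments qnum_neq0 {K} q {generic} n.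

Notation "i @ A" := (i%N, A) (at level 24).

Lemma cons_eq (T : Type) (x y : T) s t : x = y -> s = t -> x :: s = y :: t.
Proof. by move=> -> ->. Qed.
Lemma layer_eq (K : fieldType) (i j : nat) (A B : atom K) : i = j -> A = B -> (i, A) = (j, B).
Proof. by move=> -> ->. Qed.
Lemma Rr_eq (K : fieldType) a b (u : K) : a = b -> Rr a u = Rr b u.
Proof. by move=> ->. Qed.

Ltac dcbv := cbv beta iota zeta delta [valid st foldl step shp take drop cat size
  map shift addp subp lep ains aouts fst snd andb nf ins_layer].
Ltac dcbv_in H := cbv beta iota zeta delta [valid st foldl step shp take drop cat size
  map shift addp subp lep ains aouts fst snd andb nf ins_layer] in H.

Ltac nateq := first [reflexivity | lia].
Ltac deq := lazymatch goal with
  | |- _ :: _ = _ :: _ => apply: cons_eq; [deq | deq]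
  | |- (_, _) = (_, _) => apply: layer_eq; [reflexivity | deq]
  | |- LB _ = LB _ => apply: (congr1 (@LB _)); nateq
  | |- Mg _ _ = Mg _ _ => apply: (congr2 (@Mg _)); nateq
  | |- Sp _ _ = Sp _ _ => apply: (congr2 (@Sp _)); nateq
  | |- Cr _ _ = Cr _ _ => apply: (congr2 (@Cr _)); nateq
  | |- Ci _ _ = Ci _ _ => apply: (congr2 (@Ci _)); nateq
  | |- Dt _ _ = Dt _ _ => apply: (congr1 (@Dt _ _)); nateq
  | |- Rr _ _ = Rr _ _ => apply: Rr_eq; nateq
  | |- Ll _ _ = Ll _ _ => apply: (congr1 (@Ll _ _)); nateq
  | |- _ => reflexivity
  end.
Ltac dval := dcbv; repeat lazymatch goal with |- _ /\ _ => split | |- and3 _ _ _ => split end; deq.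
Ltac dsame := apply: D_nf_eq; dcbv; deq.
Ltac dinvalid := apply: D_invalid; let H := fresh in intros H; dcbv_in H;
  repeat match goal with
  | H : _ /\ _ |- _ => destruct H
  | H : _ :: _ = _ :: _ |- _ => injection H; clear H; intros
  | H : [::] = _ :: _ |- _ => discriminate H
  | H : _ :: _ = [::] |- _ => discriminate H
  end; lia.

Tactic Notation "dto" uconstr(d) :=
  lazymatch goal with |- @D ?K ?q ?s ?t _ = _ => transitivity (@D K q s t d); [dsame|] end.

Ltac dside := first [ by [] | by move=> *; dval | dval].
(* [dstep n m i H] applies [H], or a linear expansion given by [H], to the [m]
   layers that follow the first [n], at the [i]-th letter; [dto d] passes to a
   diagram equal to [d] up to interchange and arithmetic; [dz] erases strands of
   thickness zero. *)
Ltac dstep_at n m i H :=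
  etransitivity;
  [ first [ eapply (@D_ctx1 _ _ n m i) ; [eapply H; try lia | dcbv; deq | .. ]
          | eapply (@D_ctxZ _ _ n m i) ; [eapply H; try lia | dcbv; deq | .. ]
          | eapply (@D_ctx2 _ _ n m i) ; [eapply H; try lia | dcbv; deq | .. ]
          | eapply (@D_ctx _ _ _ _ _ _ _ n m i) ; [eapply H; try lia | dcbv; deq | .. ] ]; dside
  | dcbv ].
Tactic Notation "dstep" integer(n) integer(m) integer(i) uconstr(H) :=
  let n' := constr:(ltac:(do n apply S; exact O) : nat) in
  let m' := constr:(ltac:(do m apply S; exact O) : nat) in
  let i' := constr:(ltac:(do i apply S; exact O) : nat) in
  dstep_at n' m' i' H.

Ltac monob := first
  [ eapply mono_comp_eq; [monob | monob | dcbv; deq]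
  | eapply mono_tens; [monob | monob]
  | eapply mono_idb | eapply mono_idr
  | eapply mono_mm | eapply mono_ss | eapply mono_cc | eapply mono_cci
  | eapply mono_rr | eapply mono_ll | eapply mono_x1 | eapply mono_xx'
  | eapply mono_xxi' ].
Ltac mono := eapply mono_cast; [monob | dcbv; deq | dcbv; deq | dcbv; deq].

Lemma bl0 (K : fieldType) : @bl K 0 = [::]. Proof. by []. Qed.
Ltac zword := rewrite /wds /wd; cbv beta iota zeta delta [map flatten foldr take drop addp size ains];
  rewrite ?bl0 ?cats0 ?cat0s; repeat first [reflexivity
  | lazymatch goal with
    | |- _ ++ _ = _ ++ _ => apply: (congr2 cat)
    | |- bl _ = bl _ => apply: (congr1 bl); lia end].
Ltac zs := repeat (cbv beta iota zeta delta [step take drop cat size addp ains aouts fst snd];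
  first [ apply: zsim_l; [by rewrite /= ?orbT | ] | apply: zsim_r; [by rewrite /= ?orbT | ]
        | apply: zsim_cons; [zword | zword | ] | apply: zsim_nil; zword ]).
Ltac dz := solve [apply: D_zsim; [zs | dval | dval]].

(** * The dotless relations, including thickness zero *)

Section Relations.
Context (K : fieldType) (q : K).
Local Notation D := (@D K q).

Local Notation th1 := (fun _ : unit => 1%N).

Lemma CK a b : D [:: LB a; LB b] [:: LB a; LB b] [:: 0 @ Cr a b; 0 @ Ci a b]
  = D [:: LB a; LB b] [:: LB a; LB b] [::].
Proof.
case: a b => [|a] [|b]; try dz.
apply: rel_D; first by apply: rel'_web; apply: (rel_cK q (th := th1) (a:=a.+1)(b:=b.+1)).
  mono.
apply: rep_mono; mono.
Qed.

Lemma CiK a b : D [:: LB b; LB a] [:: LB b; LB a] [:: 0 @ Ci a b; 0 @ Cr a b]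
  = D [:: LB b; LB a] [:: LB b; LB a] [::].
Proof.
case: a b => [|a] [|b]; try dz.
apply: rel_D; first by apply: rel'_web; apply: (rel_cVK q (th := th1) (a:=a.+1)(b:=b.+1)).
  mono.
apply: rep_mono; mono.
Qed.

Lemma W1m a b c : D [:: LB a; LB b; LB c] [:: LB (a + b + c)]
    [:: 0 @ Mg a b; 0 @ Mg (a + b) c]
  = D [:: LB a; LB b; LB c] [:: LB (a + b + c)] [:: 1 @ Mg b c; 0 @ Mg a (b + c)].
Proof.
case: a b c => [|a] [|b] [|c]; rewrite ?addn0 ?add0n; try dz.
apply: rel_D; first by apply: rel'_web; apply: (rel_W1m q (th := th1) (a:=a.+1)(b:=b.+1)(c:=c.+1)).
  mono.
apply: rep_mono; mono.
Qed.

Lemma W1s a b c : D [:: LB (a + b + c)] [:: LB a; LB b; LB c]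
    [:: 0 @ Sp (a + b) c; 0 @ Sp a b]
  = D [:: LB (a + b + c)] [:: LB a; LB b; LB c] [:: 0 @ Sp a (b + c); 1 @ Sp b c].
Proof.
case: a b c => [|a] [|b] [|c]; rewrite ?addn0 ?add0n; try dz.
apply: rel_D; first by apply: rel'_web; apply: (rel_W1s q (th := th1) (a:=a.+1)(b:=b.+1)(c:=c.+1)).
  mono.
apply: rep_mono; mono.
Qed.

Lemma S1lm a b u : D [:: LR u; LB a; LB b] [:: LB (a + b); LR u]
    [:: 1 @ Mg a b; 0 @ Ll u (a + b)]
  = D [:: LR u; LB a; LB b] [:: LB (a + b); LR u]
    [:: 0 @ Ll u a; 1 @ Ll u b; 0 @ Mg a b].
Proof.
case: a b => [|a] [|b]; rewrite ?addn0 ?add0n; try dz.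
apply: rel_D; first by apply: rel'_web; apply: (rel_S1lm q (th := th1) (a:=a.+1)(b:=b.+1) u).
  mono.
apply: rep_mono; mono.
Qed.

Lemma S1rm a b u : D [:: LB a; LB b; LR u] [:: LR u; LB (a + b)]
    [:: 0 @ Mg a b; 0 @ Rr (a + b) u]
  = D [:: LB a; LB b; LR u] [:: LR u; LB (a + b)]
    [:: 1 @ Rr b u; 0 @ Rr a u; 1 @ Mg a b].
Proof.
case: a b => [|a] [|b]; rewrite ?addn0 ?add0n; try dz.
apply: rel_D; first by apply: rel'_web; apply: (rel_S1rm q (th := th1) (a:=a.+1)(b:=b.+1) u).
  mono.
apply: rep_mono; mono.
Qed.

Context {gq : generic q}.

Lemma qnum1 : qnum q 1 = 1.
Proof.
have := @qnum_neq0 _ q gq 0; rewrite /qnum expr1; case: (eqVneq (q - q^-1) 0) => [->|h _].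
  by rewrite mul0r eqxx.
by rewrite divff.
Qed.

Lemma qfactS n : qfact q n.+1 = qfact q n * qnum q n.+1.
Proof. by rewrite /qfact big_nat_recr. Qed.

Lemma qfact0 : qfact q 0 = 1. Proof. by rewrite /qfact big_nil. Qed.
Lemma qfact1 : qfact q 1 = 1. Proof. by rewrite qfactS qfact0 qnum1 mulr1. Qed.

Lemma qfact_neq0 n : qfact q n != 0.
Proof. by elim: n => [|n IH]; rewrite ?qfact0 ?oner_eq0 // qfactS mulf_neq0 ?qnum_neq0. Qed.

Lemma qbin1 n : qbin q n.+1 1 = qnum q n.+1.
Proof. by rewrite /qbin big_ord1 subn0 qfact1 divr1. Qed.

Lemma qbinS n : qbin q n.+1 n = qnum q n.+1.
Proof.
rewrite /qbin; suff -> : \prod_(i < n) qnum q (n.+1 - i) = qfact q n.+1.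
  by rewrite qfactS mulrAC divff ?mul1r // qfact_neq0.
rewrite (reindex_inj rev_ord_inj) /= /qfact big_add1 /= big_mkord big_ord_recl.
rewrite qnum1 mul1r; apply: eq_bigr => i _; congr qnum.
by rewrite /= /bump leq0n; have := ltn_ord i; lia.
Qed.

Lemma W3l a : D [:: LB (1 + a)] [:: LB (1 + a)] [:: 0 @ Sp 1 a; 0 @ Mg 1 a]
  = qnum q a.+1 *: D [:: LB (1 + a)] [:: LB (1 + a)] [::].
Proof.
case: a => [|a]; first by rewrite qnum1 scale1r; dz.
rewrite -[qnum _ _]qbin1.
apply: rel_D; first by apply: rel'_web; apply: (rel_W3 q (th := th1) (a:=1)(b:=a.+1)).
  mono.
by apply: rep_scale; apply: rep_mono; mono.
Qed.

Lemma W3r a : D [:: LB (a + 1)] [:: LB (a + 1)] [:: 0 @ Sp a 1; 0 @ Mg a 1]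
  = qnum q a.+1 *: D [:: LB (a + 1)] [:: LB (a + 1)] [::].
Proof.
case: a => [|a]; first by rewrite qnum1 scale1r; dz.
rewrite -[qnum _ _]qbinS -[in qbin _ _ _]addn1.
apply: rel_D; first by apply: rel'_web; apply: (rel_W3 q (th := th1) (a:=a.+1)(b:=1)).
  mono.
by apply: rep_scale; apply: rep_mono; mono.
Qed.

Definition W2d a b c d s t := D [:: LB a; LB c] [:: LB b; LB d]
  [:: 0 @ Sp s (a - s); 2 @ Sp (c - t) t; 1 @ Cr (a - s) (c - t);
      0 @ Mg s (b - s); 1 @ Mg (a - s) t].

Lemma W2d_invalid a b c d s t : ~ (t + a = d + s /\ s <= a /\ s <= b /\ t <= c /\ t <= d)%N ->
  W2d a b c d s t = 0.
Proof. move=> h; rewrite /W2d; dinvalid. Qed.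

(* In (W2) the index t is determined by s. *)
Lemma W2 a b c d N : (a + c = b + d)%N -> (minn a b < N)%N ->
  D [:: LB a; LB c] [:: LB b; LB d] [:: 0 @ Mg a c; 0 @ Sp b d] =
  \sum_(0 <= s < N) q ^+ (s * (s + d - a)) *: W2d a b c d s (s + d - a).
Proof.
move=> e hN.
have one s0 : (s0 < N)%N -> (forall s, s != s0 -> W2d a b c d s (s + d - a) = 0) ->
  \sum_(0 <= s < N) q ^+ (s * (s + d - a)) *: W2d a b c d s (s + d - a) =
  q ^+ (s0 * (s0 + d - a)) *: W2d a b c d s0 (s0 + d - a).
  move=> h0 hs; rewrite big_mkord (bigD1 (Ordinal h0)) //= big1 ?addr0 // => i ni.
  by rewrite hs ?scaler0.
have [a0|a0] := posnP a.
  rewrite (one 0%N) => [||s s0]; last 1 first.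
  - by apply: W2d_invalid; lia.
  - rewrite mul0n expr0 scale1r /W2d; have -> : (0 + d - a = d)%N by lia.
    have -> : (c - d = b)%N by lia.
    subst a; rewrite !subn0; have e' : c = (b + d)%N by lia.
    by subst c; rewrite ?add0n; dz.
  lia.
have [b0|b0] := posnP b.
  rewrite (one 0%N) => [||s s0]; last 1 first.
  - by apply: W2d_invalid; lia.
  - rewrite mul0n expr0 scale1r /W2d; have -> : (0 + d - a = c)%N by lia.
    subst b; rewrite !subn0 subnn; have e' : d = (a + c)%N by lia.
    by subst d; rewrite ?add0n; dz.
  lia.
have [c0|c0] := posnP c.
  rewrite (one b) => [||s s0]; last 1 first.
  - by apply: W2d_invalid; lia.
  - rewrite /W2d; have -> : (b + d - a = 0)%N by lia.
    rewrite muln0 expr0 scale1r; have -> : (a - b = d)%N by lia.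
    subst c; rewrite !subnn; have e' : a = (b + d)%N by lia.
    by subst a; rewrite ?addn0; dz.
  lia.
have [d0|d0] := posnP d.
  rewrite (one a) => [||s s0]; last 1 first.
  - by apply: W2d_invalid; lia.
  - rewrite /W2d; have -> : (a + d - a = 0)%N by lia.
    rewrite muln0 expr0 scale1r subnn subn0; have -> : (b - a = c)%N by lia.
    subst d; have e' : b = (a + c)%N by lia.
    by subst b; rewrite ?addn0; dz.
  lia.
have {one}-> : \sum_(0 <= s < N) q ^+ (s * (s + d - a)) *: W2d a b c d s (s + d - a) =
  \sum_(0 <= s < (minn a b).+1) \sum_(0 <= t < (minn c d).+1 | (t + a == d + s)%N)
     q ^+ (s * t) *: W2d a b c d s t.
  rewrite (big_cat_nat (n := (minn a b).+1)) //= [X in _ + X]big_nat [X in _ + X]big1 ?addr0; last first.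
    by move=> s hs; rewrite W2d_invalid ?scaler0 //; lia.
  rewrite !big_nat; apply: eq_bigr => s hs.
  have [h|h] := boolP ((s + d - a <= minn c d)%N && (a <= s + d)%N).
    have h' : (s + d - a < (minn c d).+1)%N by lia.
    rewrite big_mkord (bigD1 (Ordinal h')) /=; last by apply/eqP; lia.
    rewrite big1 ?addr0 // => t /andP[/eqP ht nt]; move: nt.
    by rewrite -val_eqE /=; lia.
  rewrite W2d_invalid ?scaler0; last by lia.
  by rewrite big_nat_cond big1 // => t ht; rewrite W2d_invalid ?scaler0 //; lia.
apply: rel_D; first by apply: rel'_web; apply: (rel_W2 q (th := th1) a0 b0 c0 d0 e).
  mono.
apply: rep_sum => //; try by rewrite /wds /= ?cats0.
move=> s hs _; apply: rep_sum => //; try by rewrite /wds /= ?cats0.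
by move=> t ht /eqP et; apply: rep_scale; apply: rep_mono; mono.
Qed.

Lemma W2l b p r : (p + r = 1 + b)%N ->
  D [:: LB 1; LB b] [:: LB p; LB r] [:: 0 @ Mg 1 b; 0 @ Sp p r] =
  q ^+ r *: D [:: LB 1; LB b] [:: LB p; LB r] [:: 1 @ Sp p.-1 r; 0 @ Mg 1 p.-1] +
  1 *: D [:: LB 1; LB b] [:: LB p; LB r] [:: 1 @ Sp p r.-1; 0 @ Cr 1 p; 1 @ Mg 1 r.-1].
Proof.
move=> e; rewrite (@W2 _ _ _ _ 2) ?big_nat_recr ?big_nat1 //=; try lia.
rewrite [LHS]addrC; congr (_ + _).
  have -> : (1 + r - 1 = r)%N by lia.
  rewrite mul1n; congr (_ *: _).
  case: p e => [|p] e.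
    by rewrite W2d_invalid; [symmetry; dinvalid | lia].
  have e' : b = (p + r)%N by lia.
  by subst b; rewrite /W2d /= addnK ?subn1 ?subnn /=; dz.
rewrite big_nil add0r mul0n expr0; congr (_ *: _).
case: r e => [|r] e.
  by rewrite W2d_invalid; [symmetry; dinvalid | lia].
have e' : b = (p + r)%N by lia.
by subst b; rewrite /W2d /= add0n subn1 /= addnK !subn0; dz.
Qed.

Lemma W2r a p r : (p + r = a + 1)%N ->
  D [:: LB a; LB 1] [:: LB p; LB r] [:: 0 @ Mg a 1; 0 @ Sp p r] =
  q ^+ p *: D [:: LB a; LB 1] [:: LB p; LB r] [:: 0 @ Sp p r.-1; 1 @ Mg r.-1 1] +
  1 *: D [:: LB a; LB 1] [:: LB p; LB r] [:: 0 @ Sp p.-1 r; 1 @ Cr r 1; 0 @ Mg p.-1 1].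
Proof.
move=> e; rewrite (@W2 _ _ _ _ p.+1) ?big_nat_recr //=; try lia.
rewrite [LHS]addrC; congr (_ + _).
  have -> : (p + r - a = 1)%N by lia.
  rewrite muln1; congr (_ *: _).
  case: r e => [|r] e.
    by rewrite W2d_invalid; [symmetry; dinvalid | lia].
  have e' : a = (p + r)%N by lia.
  by subst a; rewrite /W2d !subnn addKn /=; dz.
case: p e => [|p] e.
  by rewrite big_nil scale1r; symmetry; dinvalid.
rewrite big_nat_recr //= big_nat big1 ?add0r; last first.
  by move=> s hs; rewrite W2d_invalid ?scaler0 //; lia.
have -> : (p + r - a = 0)%N by lia.
rewrite muln0 expr0; congr (_ *: _).
have e' : a = (p + r)%N by lia.
by subst a; rewrite /W2d /= addKn subn0 subSnn; dz.
Qed.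

End Relations.

(** * Sliding a merge with a strand of thickness one through a crossing *)

Section SlidesOneStrand.
Context (K : fieldType) (q : K).
Local Notation D := (@D K q).
Context {gq : generic q}.

Lemma W2u a b c d N : (a + c = b + d)%N -> (minn a b < N)%N ->
  D [:: LB a; LB c] [:: LB b; LB d] [:: 0 @ Mg a c; 0 @ Sp b d] =
  \sum_(0 <= s < N) q ^+ (s * (s + d - a)) *: D [:: LB a; LB c] [:: LB b; LB d]
    [:: 0 @ Sp s (a - s); 2 @ Sp (c - (s + d - a)) (s + d - a);
        1 @ Cr (a - s) (c - (s + d - a)); 0 @ Mg s (b - s); 1 @ Mg (a - s) (s + d - a)].
Proof. exact: W2. Qed.

Lemma CrL b : D [:: LB 1; LB b] [:: LB b; LB 1] [:: 0 @ Cr 1 b] =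
  1 *: D [:: LB 1; LB b] [:: LB b; LB 1] [:: 0 @ Mg 1 b; 0 @ Sp b 1] +
  - q *: D [:: LB 1; LB b] [:: LB b; LB 1] [:: 1 @ Sp b.-1 1; 0 @ Mg 1 b.-1].
Proof.
rewrite scale1r (W2l q (r := 1)) 1?addnC //= expr1 scale1r addrC addrA scaleNr addNr add0r.
by dz.
Qed.

Lemma CrR a : D [:: LB a; LB 1] [:: LB 1; LB a] [:: 0 @ Cr a 1] =
  1 *: D [:: LB a; LB 1] [:: LB 1; LB a] [:: 0 @ Mg a 1; 0 @ Sp 1 a] +
  - q *: D [:: LB a; LB 1] [:: LB 1; LB a] [:: 0 @ Sp 1 a.-1; 1 @ Mg a.-1 1].
Proof.
rewrite scale1r (W2r q (p := 1)) 1?addnC //= expr1 scale1r addrC addrA scaleNr addNr add0r.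
by dz.
Qed.

Definition slideR a b := D [:: LB a; LB 1; LB b] [:: LB b; LB (a + 1)]
    [:: 0 @ Mg a 1; 0 @ Cr (a + 1) b]
  = D [:: LB a; LB 1; LB b] [:: LB b; LB (a + 1)]
    [:: 1 @ Cr 1 b; 0 @ Cr a b; 1 @ Mg a 1].

Definition slideL a b := D [:: LB a; LB 1; LB b] [:: LB (1 + b); LB a]
    [:: 1 @ Mg 1 b; 0 @ Cr a (1 + b)]
  = D [:: LB a; LB 1; LB b] [:: LB (1 + b); LB a]
    [:: 0 @ Cr a 1; 1 @ Cr a b; 0 @ Mg 1 b].

Local Notation D1 a b := (D [:: LB a; LB 1; LB b] [:: LB b; LB (a + 1)]).
Local Notation D2 a b := (D [:: LB a; LB 1; LB b] [:: LB (1 + b); LB a]).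

(* Both expansions of s_{b,a+1} m_{a,1,b} by (W2) are compared: [A] comes from the
   bracketing (a 1) b, and [B] from a (1 b), which splits further into [U1] and
   [U2]; the term [A 0] is one side of the claim and [U1 0] the other. *)
Lemma slideR_step a b :
  (forall a' b', (a' + b' < a + b)%N -> slideR a' b' /\ slideL a' b') -> slideR a b.
Proof.
move=> IH; rewrite /slideR.
pose A s := D1 a b [:: 0 @ Mg a 1; 0 @ Sp s (a + 1 - s); 2 @ Sp (b - s) s;
  1 @ Cr (a + 1 - s) (b - s); 0 @ Mg s (b - s); 1 @ Mg (a + 1 - s) s].
pose B s := D1 a b [:: 1 @ Mg 1 b; 0 @ Sp s (a - s); 2 @ Sp (b - s) s.+1;
  1 @ Cr (a - s) (b - s); 0 @ Mg s (b - s); 1 @ Mg (a - s) s.+1].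
pose U1 s := D1 a b [:: 0 @ Sp s (a - s); 3 @ Sp (b - s) s; 2 @ Cr 1 (b - s);
  3 @ Mg 1 s; 1 @ Cr (a - s) (b - s); 0 @ Mg s (b - s); 1 @ Mg (a - s) s.+1].
pose U2 s := D1 a b [:: 0 @ Sp s (a - s); 3 @ Sp (b - s).-1 s.+1; 2 @ Mg 1 (b - s).-1;
  1 @ Cr (a - s) (b - s); 0 @ Mg s (b - s); 1 @ Mg (a - s) s.+1].
pose N := (a + b).+2.
have E1 : D1 a b [:: 0 @ Mg a 1; 0 @ Mg (a + 1) b; 0 @ Sp b (a + 1)] =
    \sum_(0 <= s < N) q ^+ (s * s) *: A s.
  dstep 1 2 0 (@W2u (a + 1) b b (a + 1) N).
  by apply: eq_bigr => s _; rewrite addnK.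
have E2 : D1 a b [:: 0 @ Mg a 1; 0 @ Mg (a + 1) b; 0 @ Sp b (a + 1)] =
    \sum_(0 <= s < N) q ^+ (s * s.+1) *: B s.
  dstep 0 2 0 (W1m q a 1 b).
  dstep 1 2 0 (@W2u a b (1 + b) (a + 1) N).
  apply: eq_bigr => s _; have -> : (s + (a + 1) - a = s.+1)%N by lia.
  by have -> : (1 + b - s.+1 = b - s)%N by lia.
have EB s : B s = U1 s + q ^+ s.+1 *: U2 s.
  have [h|h] := boolP ((s <= a) && (s <= b))%N; last first.
    have -> : B s = 0 by dinvalid.
    have -> : U1 s = 0 by dinvalid.
    have -> : U2 s = 0 by dinvalid.
    by rewrite scaler0 addr0.
  rewrite addrC -[U1 s]scale1r /B.
  dto [:: 0 @ Sp s (a - s); 2 @ Mg 1 b; 2 @ Sp (b - s) s.+1;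
  1 @ Cr (a - s) (b - s); 0 @ Mg s (b - s); 1 @ Mg (a - s) s.+1].
  dstep 1 2 2 (@W2l K q b (b - s) s.+1).
  by [].
have EA s : q ^+ (s.+1 * s.+1) *: A s.+1 =
    q ^+ (s.+1 * s.+2) *: U1 s.+1 + q ^+ (s * s.+1 + s.+1) *: U2 s.
  have [h|h] := boolP ((s <= a) && (s < b))%N; last first.
    have -> : A s.+1 = 0 by dinvalid.
    have -> : U1 s.+1 = 0 by dinvalid.
    have -> : U2 s = 0 by dinvalid.
    by rewrite !scaler0 addr0.
  have -> : A s.+1 = q ^+ s.+1 *: U1 s.+1 + 1 *: U2 s.
    etransitivity.
      rewrite /A; dstep 0 2 0 (@W2r K q a s.+1 (a + 1 - s.+1)).
      by [].
    congr (_ *: _ + _ *: _).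
      have [h'|h'] := boolP (s < a)%N; last by rewrite (_ : U1 s.+1 = 0); dinvalid.
      dto [:: 0 @ Sp s.+1 (a - s.+1); 3 @ Sp (b - s.+1) s.+1; 1 @ Mg (a - s.+1) 1;
         1 @ Cr (a - s.+1 + 1) (b - s.+1); 0 @ Mg s.+1 (b - s.+1); 1 @ Mg (a - s.+1 + 1) s.+1].
      have [IHR _] := IH (a - s.+1)%N (b - s.+1)%N ltac:(lia).
      dstep 2 2 1 IHR.
      dto [:: 0 @ Sp s.+1 (a - s.+1); 3 @ Sp (b - s.+1) s.+1; 2 @ Cr 1 (b - s.+1);
         1 @ Cr (a - s.+1) (b - s.+1); 0 @ Mg s.+1 (b - s.+1);
         1 @ Mg (a - s.+1) 1; 1 @ Mg (a - s.+1 + 1) s.+1].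
      dstep 5 2 1 (W1m q (a - s.+1) 1 s.+1).
      by dsame.
    have [_ IHL] := IH (a - s)%N (b - s.+1)%N ltac:(lia).
    rewrite /U2; symmetry.
    dto [:: 0 @ Sp s (a - s); 3 @ Sp (b - s.+1) s.+1; 2 @ Mg 1 (b - s.+1);
      1 @ Cr (a - s) (1 + (b - s.+1)); 0 @ Mg s (1 + (b - s.+1)); 1 @ Mg (a - s) s.+1].
    dstep 2 2 1 IHL.
    dstep 4 2 0 (esym (W1m q s 1 (b - s.+1))).
    by dsame.
  rewrite scalerDr !scalerA -!exprD mulr1; congr (_ ^+ _ *: _ + _ ^+ _ *: _); lia.
have EA0 : A 0%N = D1 a b [:: 0 @ Mg a 1; 0 @ Cr (a + 1) b].
  by rewrite /A !subn0; dz.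
have EU0 : U1 0%N = D1 a b [:: 1 @ Cr 1 b; 0 @ Cr a b; 1 @ Mg a 1].
  by rewrite /U1 !subn0; dz.
move: E1; rewrite E2 /N big_nat_recr // [in RHS]big_nat_recl //= mul0n expr0 scale1r EA0.
have -> : B (a + b).+1 = 0 by dinvalid.
rewrite scaler0 addr0.
under eq_bigr => s _ do rewrite EB scalerDr scalerA -exprD.
under [in RHS]eq_bigr => s _ do rewrite EA.
rewrite !big_split /= addrA => /addIr e.
pose f s := q ^+ (s * s.+1) *: U1 s.
have fN : f (a + b).+1 = 0.
  by rewrite /f (_ : U1 _ = 0) ?scaler0 //; dinvalid.
have e2 : \sum_(0 <= i < (a + b).+1) f i = f 0%N + \sum_(0 <= i < (a + b).+1) f i.+1.
  by rewrite -big_nat_recl // [RHS]big_nat_recr // fN /= addr0.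
by move: e; rewrite -/f [LHS]e2 => /addIr <-; rewrite /f mul0n expr0 scale1r EU0.
Qed.

Lemma slideL_step a b :
  (forall a' b', (a' + b' < a + b)%N -> slideR a' b' /\ slideL a' b') -> slideL a b.
Proof.
move=> IH; rewrite /slideL.
pose A s := D2 a b [:: 1 @ Mg 1 b; 0 @ Sp s (a - s); 2 @ Sp (1 + b - s) s;
  1 @ Cr (a - s) (1 + b - s); 0 @ Mg s (1 + b - s); 1 @ Mg (a - s) s].
pose B s := D2 a b [:: 0 @ Mg a 1; 0 @ Sp s.+1 (a - s); 2 @ Sp (b - s) s;
  1 @ Cr (a - s) (b - s); 0 @ Mg s.+1 (b - s); 1 @ Mg (a - s) s].
pose U1 s := D2 a b [:: 0 @ Sp s (a - s); 1 @ Cr (a - s) 1; 0 @ Mg s 1; 2 @ Sp (b - s) s;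
  1 @ Cr (a - s) (b - s); 0 @ Mg s.+1 (b - s); 1 @ Mg (a - s) s].
pose U2 s := D2 a b [:: 0 @ Sp s.+1 (a - s).-1; 1 @ Mg (a - s).-1 1; 2 @ Sp (b - s) s;
  1 @ Cr (a - s) (b - s); 0 @ Mg s.+1 (b - s); 1 @ Mg (a - s) s].
pose N := (a + b).+2.
have E1 : D2 a b [:: 1 @ Mg 1 b; 0 @ Mg a (1 + b); 0 @ Sp (1 + b) a] =
    \sum_(0 <= s < N) q ^+ (s * s) *: A s.
  dstep 1 2 0 (@W2u a (1 + b) (1 + b) a N).
  by apply: eq_bigr => s _; rewrite addnK.
have E2 : D2 a b [:: 1 @ Mg 1 b; 0 @ Mg a (1 + b); 0 @ Sp (1 + b) a] =
    \sum_(0 <= s < N) q ^+ (s * s.+1) *: B s.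
  dstep 0 2 0 (esym (W1m q a 1 b)).
  dstep 1 2 0 (@W2u (a + 1) (1 + b) b a N.+1).
  rewrite big_nat_recl // [X in _ *: X + _](_ : _ = 0) ?scaler0 ?add0r; last by dinvalid.
  apply: eq_bigr => s _; have -> : (s.+1 + a - (a + 1) = s)%N by lia.
  have -> : (1 + b - s.+1 = b - s)%N by lia.
  have -> : (a + 1 - s.+1 = a - s)%N by lia.
  by rewrite /B mulnC.
have EB s : B s = U1 s + q ^+ s.+1 *: U2 s.
  have [h|h] := boolP ((s <= a) && (s <= b))%N; last first.
    have -> : B s = 0 by dinvalid.
    have -> : U1 s = 0 by dinvalid.
    have -> : U2 s = 0 by dinvalid.
    by rewrite scaler0 addr0.
  rewrite addrC -[U1 s]scale1r /B.
  dstep 0 2 0 (@W2r K q a s.+1 (a - s)).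
  by [].
have EA s : q ^+ (s.+1 * s.+1) *: A s.+1 =
    q ^+ (s.+1 * s.+2) *: U1 s.+1 + q ^+ (s * s.+1 + s.+1) *: U2 s.
  have [h|h] := boolP ((s < a) && (s <= b))%N; last first.
    have -> : A s.+1 = 0 by dinvalid.
    have -> : U1 s.+1 = 0 by dinvalid.
    have -> : U2 s = 0 by dinvalid.
    by rewrite !scaler0 addr0.
  have -> : A s.+1 = q ^+ s.+1 *: U1 s.+1 + 1 *: U2 s.
    etransitivity.
      rewrite /A.
      dto [:: 0 @ Sp s.+1 (a - s.+1); 2 @ Mg 1 b; 2 @ Sp (1 + b - s.+1) s.+1;
        1 @ Cr (a - s.+1) (1 + b - s.+1); 0 @ Mg s.+1 (1 + b - s.+1); 1 @ Mg (a - s.+1) s.+1].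
      dstep 1 2 2 (@W2l K q b (1 + b - s.+1) s.+1).
      by [].
    congr (_ *: _ + _ *: _).
      have [h'|h'] := boolP (s < b)%N; last by rewrite (_ : U1 s.+1 = 0); dinvalid.
      dto [:: 0 @ Sp s.+1 (a - s.+1); 3 @ Sp (b - s.+1) s.+1; 2 @ Mg 1 (b - s.+1);
        1 @ Cr (a - s.+1) (1 + (b - s.+1)); 0 @ Mg s.+1 (1 + (b - s.+1)); 1 @ Mg (a - s.+1) s.+1].
      have [_ IHL] := IH (a - s.+1)%N (b - s.+1)%N ltac:(lia).
      dstep 2 2 1 IHL.
      dstep 4 2 0 (esym (W1m q s.+1 1 (b - s.+1))).
      by dsame.
    have [IHR _] := IH (a - s.+1)%N (b - s)%N ltac:(lia).
    rewrite /U2; symmetry.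
    dto [:: 0 @ Sp s.+1 (a - s.+1); 3 @ Sp (b - s) s; 1 @ Mg (a - s.+1) 1;
      1 @ Cr (a - s.+1 + 1) (b - s); 0 @ Mg s.+1 (b - s); 1 @ Mg (a - s.+1 + 1) s].
    dstep 2 2 1 IHR.
    dto [:: 0 @ Sp s.+1 (a - s.+1); 3 @ Sp (b - s) s; 2 @ Cr 1 (b - s);
      1 @ Cr (a - s.+1) (b - s); 0 @ Mg s.+1 (b - s); 1 @ Mg (a - s.+1) 1;
      1 @ Mg (a - s.+1 + 1) s].
    dstep 5 2 1 (W1m q (a - s.+1) 1 s).
    by dsame.
  rewrite scalerDr !scalerA -!exprD mulr1; congr (_ ^+ _ *: _ + _ ^+ _ *: _); lia.
have EA0 : A 0%N = D2 a b [:: 1 @ Mg 1 b; 0 @ Cr a (1 + b)].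
  by rewrite /A !subn0; dz.
have EU0 : U1 0%N = D2 a b [:: 0 @ Cr a 1; 1 @ Cr a b; 0 @ Mg 1 b].
  by rewrite /U1 !subn0; dz.
move: E1; rewrite E2 /N big_nat_recr // [in RHS]big_nat_recl //= mul0n expr0 scale1r EA0.
have -> : B (a + b).+1 = 0 by dinvalid.
rewrite scaler0 addr0.
under eq_bigr => s _ do rewrite EB scalerDr scalerA -exprD.
under [in RHS]eq_bigr => s _ do rewrite EA.
rewrite !big_split /= addrA => /addIr e.
pose f s := q ^+ (s * s.+1) *: U1 s.
have fN : f (a + b).+1 = 0.
  by rewrite /f (_ : U1 _ = 0) ?scaler0 //; dinvalid.
have e2 : \sum_(0 <= i < (a + b).+1) f i = f 0%N + \sum_(0 <= i < (a + b).+1) f i.+1.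
  by rewrite -big_nat_recl // [RHS]big_nat_recr // fN /= addr0.
by move: e; rewrite -/f [LHS]e2 => /addIr <-; rewrite /f mul0n expr0 scale1r EU0.
Qed.

Lemma slideRL a b : slideR a b /\ slideL a b.
Proof.
have [n] := ubnP (a + b)%N; elim: n a b => // n IH a b hab.
by split; [apply: slideR_step | apply: slideL_step] => a' b' h; apply: IH; lia.
Qed.

Lemma Cr_mergeR1 a b : slideR a b. Proof. by case: (slideRL a b). Qed.
Lemma Cr_mergeL1 a b : slideL a b. Proof. by case: (slideRL a b). Qed.

End SlidesOneStrand.

Section CrossingIdentities.
Context (K : fieldType) (q : K).
Local Notation D := (@D K q).
Context {gq : generic q}.

Lemma explode P a b R (k : K) t d d' : k != 0 ->
  D [:: LB (a + b)] [:: LB (a + b)] [:: 0 @ Sp a b; 0 @ Mg a b] =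
    k *: D [:: LB (a + b)] [:: LB (a + b)] [::] ->
  D (P ++ [:: LB a; LB b] ++ R) t ((size P, Mg a b) :: d) =
    D (P ++ [:: LB a; LB b] ++ R) t ((size P, Mg a b) :: d') ->
  D (P ++ [:: LB (a + b)] ++ R) t d = D (P ++ [:: LB (a + b)] ++ R) t d'.
Proof.
move=> k0 e H.
have [k1 k2 _] := layerK q R (Sp a b) (erefl (size P)).
have [l1 l2 _] := layerK q R (Mg a b) (erefl (size P)).
have key d1 : k *: D (P ++ [:: LB (a + b)] ++ R) t d1 =
    D (P ++ [:: LB (a + b)] ++ R) t ((size P, Sp a b) :: (size P, Mg a b) :: d1).
  have sP : addp (size P) 0 = size P by rewrite addpE addn0.
  have [v|v] := pselect (valid (P ++ [:: LB (a + b)] ++ R) t d1).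
    have [//|L [lin HL]] := @ctx_lin K q (P ++ [:: LB (a + b)] ++ R) t P
      [:: LB (a + b)] [:: LB (a + b)] R [::] d1 _ v.
    have := HL [:: 0 @ Sp a b; 0 @ Mg a b] isT erefl; have := HL [::] isT erefl.
    rewrite /= sP => -> ->; rewrite e.
    by have := lin k (D [:: LB (a + b)] [:: LB (a + b)] [::]) 0;
       have := lin (-1) 0 0; rewrite !scaler0 !addr0 scaleN1r addNr => ->; rewrite addr0.
  rewrite !D_invalid ?scaler0 // => -[_ []].
  by rewrite k2 /= l2.
apply: (scalerI k0); rewrite !key.
exact: (@D_cons_eq _ q _ _ _ (size P, Sp a b) _ _ k1 k2 H).
Qed.

Lemma explodeL P b R t d d' :
  D (P ++ [:: LB 1; LB b] ++ R) t ((size P, Mg 1 b) :: d) =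
    D (P ++ [:: LB 1; LB b] ++ R) t ((size P, Mg 1 b) :: d') ->
  D (P ++ [:: LB (1 + b)] ++ R) t d = D (P ++ [:: LB (1 + b)] ++ R) t d'.
Proof. exact: (explode (qnum_neq0 q b) (W3l b)). Qed.

Lemma explodeR P b R t d d' :
  D (P ++ [:: LB b; LB 1] ++ R) t ((size P, Mg b 1) :: d) =
    D (P ++ [:: LB b; LB 1] ++ R) t ((size P, Mg b 1) :: d') ->
  D (P ++ [:: LB (b + 1)] ++ R) t d = D (P ++ [:: LB (b + 1)] ++ R) t d'.
Proof. exact: (explode (qnum_neq0 q b) (W3r b)). Qed.

Lemma Cr_mergeL a b c : D [:: LB a; LB b; LB c] [:: LB (b + c); LB a]
    [:: 1 @ Mg b c; 0 @ Cr a (b + c)]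
  = D [:: LB a; LB b; LB c] [:: LB (b + c); LB a]
    [:: 0 @ Cr a b; 1 @ Cr a c; 0 @ Mg b c].
Proof.
elim: b => [|b IH]; first by rewrite add0n; dz.
apply: (@explodeL [:: LB a] b [:: LB c]); dcbv.
dstep 0 2 1 (W1m q 1 b c).
dstep 1 2 0 (Cr_mergeL1 q a (b + c)).
dto [:: 0 @ Cr a 1; 2 @ Mg b c; 1 @ Cr a (b + c); 0 @ Mg 1 (b + c)].
dstep 1 2 1 IH.
dstep 3 2 0 (esym (W1m q 1 b c)).
symmetry.
dstep 0 2 0 (Cr_mergeL1 q a b).
by dsame.
Qed.

Lemma Cr_mergeR a b c : D [:: LB a; LB b; LB c] [:: LB c; LB (a + b)]
    [:: 0 @ Mg a b; 0 @ Cr (a + b) c]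
  = D [:: LB a; LB b; LB c] [:: LB c; LB (a + b)]
    [:: 1 @ Cr b c; 0 @ Cr a c; 1 @ Mg a b].
Proof.
elim: b => [|b IH]; first by rewrite addn0; dz.
rewrite -addn1.
apply: (@explodeR [:: LB a] b [:: LB c]); dcbv.
dstep 0 2 0 (esym (W1m q a b 1)).
dstep 1 2 0 (Cr_mergeR1 q (a + b) c).
dto [:: 2 @ Cr 1 c; 0 @ Mg a b; 0 @ Cr (a + b) c; 1 @ Mg (a + b) 1].
dstep 1 2 0 IH.
dstep 3 2 1 (W1m q a b 1).
symmetry.
dstep 0 2 1 (Cr_mergeR1 q b c).
by dsame.
Qed.

Lemma Cr_slide_split p r : D [:: LB 1; LB (p + r)] [:: LB p; LB r; LB 1]
    [:: 0 @ Cr 1 (p + r); 0 @ Sp p r] =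
  D [:: LB 1; LB (p + r)] [:: LB p; LB r; LB 1] [:: 1 @ Sp p r; 0 @ Cr 1 p; 1 @ Cr 1 r].
Proof.
case: p r => [|p] [|r]; rewrite ?addn0 ?add0n; try dz.
set X := D _ _.
have e1 : X [:: 0 @ Mg 1 (p.+1 + r.+1); 0 @ Sp (p.+1 + r.+1) 1; 0 @ Sp p.+1 r.+1] =
    q ^+ r.+2 *: X [:: 1 @ Sp p r.+2; 0 @ Mg 1 p; 1 @ Sp r.+1 1] +
    1 *: X [:: 1 @ Sp p.+1 r.+1; 0 @ Cr 1 p.+1; 1 @ Mg 1 r.+1; 1 @ Sp r.+1 1].
  rewrite /X; dstep 1 2 0 (W1s q p.+1 r.+1 1).
  dto [:: 0 @ Mg 1 (p.+1 + r.+1); 0 @ Sp p.+1 r.+2; 1 @ Sp r.+1 1].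
  by dstep 0 2 0 (@W2l K q (p.+1 + r.+1) p.+1 r.+2).
have e2 : X [:: 1 @ Sp (p + r.+1) 1; 0 @ Mg 1 (p + r.+1); 0 @ Sp p.+1 r.+1] =
    q ^+ r.+1 *: X [:: 1 @ Sp p r.+2; 0 @ Mg 1 p; 1 @ Sp r.+1 1] +
    1 *: X [:: 1 @ Sp p.+1 r.+1; 0 @ Cr 1 p.+1; 2 @ Sp r 1; 1 @ Mg 1 r].
  rewrite /X; etransitivity.
    by dstep 1 2 0 (@W2l K q (p + r.+1) p.+1 r.+1).
  congr (_ *: _ + _ *: _).
    dstep 0 2 1 (W1s q p r.+1 1).
    by dsame.
  dto [:: 1 @ Sp (p.+1 + r) 1; 1 @ Sp p.+1 r; 0 @ Cr 1 p.+1; 1 @ Mg 1 r].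
  dstep 0 2 1 (W1s q p.+1 r 1).
  by dsame.
rewrite /X; transitivity (1 *: X [:: 0 @ Mg 1 (p.+1 + r.+1); 0 @ Sp (p.+1 + r.+1) 1; 0 @ Sp p.+1 r.+1] +
  - q *: X [:: 1 @ Sp (p + r.+1) 1; 0 @ Mg 1 (p + r.+1); 0 @ Sp p.+1 r.+1]).
  by rewrite /X; dstep 0 1 0 (CrL q (p.+1 + r.+1)).
symmetry; transitivity (1 *: X [:: 1 @ Sp p.+1 r.+1; 0 @ Cr 1 p.+1; 1 @ Mg 1 r.+1; 1 @ Sp r.+1 1] +
  - q *: X [:: 1 @ Sp p.+1 r.+1; 0 @ Cr 1 p.+1; 2 @ Sp r 1; 1 @ Mg 1 r]).
  by rewrite /X; dstep 2 1 1 (CrL q r.+1).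
rewrite e1 e2 !scalerDr !scalerA !mul1r mulNr -exprS scaleNr !mulr1.
by rewrite [RHS]addrACA !scaleNr addrN add0r.
Qed.

Lemma qnumD m n : qnum q (m + n) = q ^+ n * qnum q m + q ^- m * qnum q n.
Proof.
rewrite /qnum; have h : q != 0 by apply: q_neq0.
rewrite !mulrA -mulrDl; congr (_ / _).
have hm : q ^+ m != 0 by rewrite expf_neq0.
have hn : q ^+ n != 0 by rewrite expf_neq0.
by rewrite !exprD; field; rewrite hm hn.
Qed.

Lemma qnumS a : qnum q a.+1 = q * qnum q a + q ^- a.
Proof. by rewrite -addn1 qnumD qnum1 mulr1 expr1. Qed.

Lemma CrR_absorb_merge a : D [:: LB a; LB 1] [:: LB (1 + a)] [:: 0 @ Cr a 1; 0 @ Mg 1 a]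
  = q ^- a *: D [:: LB a; LB 1] [:: LB (1 + a)] [:: 0 @ Mg a 1].
Proof.
case: a => [|a]; first by rewrite expr0 invr1 scale1r; dz.
etransitivity; first by dstep 0 1 0 (CrR q a.+1).
have -> : D [:: LB a.+1; LB 1] [:: LB (1 + a.+1)] [:: 0 @ Mg a.+1 1; 0 @ Sp 1 a.+1; 0 @ Mg 1 a.+1]
    = qnum q a.+2 *: D [:: LB a.+1; LB 1] [:: LB (1 + a.+1)] [:: 0 @ Mg a.+1 1].
  by dstep 1 2 0 (W3l a.+1).
have -> : D [:: LB a.+1; LB 1] [:: LB (1 + a.+1)] [:: 0 @ Sp 1 a; 1 @ Mg a 1; 0 @ Mg 1 a.+1]
    = qnum q a.+1 *: D [:: LB a.+1; LB 1] [:: LB (1 + a.+1)] [:: 0 @ Mg a.+1 1].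
  dto [:: 0 @ Sp 1 a; 1 @ Mg a 1; 0 @ Mg 1 (a + 1)].
  dstep 1 2 0 (esym (W1m q 1 a 1)).
  by dstep 0 2 0 (W3l a).
by rewrite !scalerA -scalerDl mul1r [qnum q a.+2]qnumS mulNr addrAC addrN add0r.
Qed.

Lemma CrR_absorb_split a : D [:: LB (a + 1)] [:: LB 1; LB a] [:: 0 @ Sp a 1; 0 @ Cr a 1]
  = q ^- a *: D [:: LB (a + 1)] [:: LB 1; LB a] [:: 0 @ Sp 1 a].
Proof.
case: a => [|a]; first by rewrite expr0 invr1 scale1r; dz.
etransitivity; first by dstep 1 1 0 (CrR q a.+1).
have -> : D [:: LB (a.+1 + 1)] [:: LB 1; LB a.+1] [:: 0 @ Sp a.+1 1; 0 @ Mg a.+1 1; 0 @ Sp 1 a.+1]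
    = qnum q a.+2 *: D [:: LB (a.+1 + 1)] [:: LB 1; LB a.+1] [:: 0 @ Sp 1 a.+1].
  by dstep 0 2 0 (W3r a.+1).
have -> : D [:: LB (a.+1 + 1)] [:: LB 1; LB a.+1] [:: 0 @ Sp a.+1 1; 0 @ Sp 1 a; 1 @ Mg a 1]
    = qnum q a.+1 *: D [:: LB (a.+1 + 1)] [:: LB 1; LB a.+1] [:: 0 @ Sp 1 a.+1].
  dto [:: 0 @ Sp (1 + a) 1; 0 @ Sp 1 a; 1 @ Mg a 1].
  dstep 0 2 0 (W1s q 1 a 1).
  dstep 1 2 1 (W3r a).
  by congr (_ *: _); dsame.
by rewrite !scalerA -scalerDl mul1r [qnum q a.+2]qnumS mulNr addrAC addrN add0r.
Qed.

Lemma CrL_absorb_split a : D [:: LB (1 + a)] [:: LB a; LB 1] [:: 0 @ Sp 1 a; 0 @ Cr 1 a]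
  = q ^- a *: D [:: LB (1 + a)] [:: LB a; LB 1] [:: 0 @ Sp a 1].
Proof.
case: a => [|a]; first by rewrite expr0 invr1 scale1r; dz.
etransitivity; first by dstep 1 1 0 (CrL q a.+1).
have -> : D [:: LB (1 + a.+1)] [:: LB a.+1; LB 1] [:: 0 @ Sp 1 a.+1; 0 @ Mg 1 a.+1; 0 @ Sp a.+1 1]
    = qnum q a.+2 *: D [:: LB (1 + a.+1)] [:: LB a.+1; LB 1] [:: 0 @ Sp a.+1 1].
  by dstep 0 2 0 (W3l a.+1).
have -> : D [:: LB (1 + a.+1)] [:: LB a.+1; LB 1] [:: 0 @ Sp 1 a.+1; 1 @ Sp a 1; 0 @ Mg 1 a]
    = qnum q a.+1 *: D [:: LB (1 + a.+1)] [:: LB a.+1; LB 1] [:: 0 @ Sp a.+1 1].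
  dto [:: 0 @ Sp 1 (a + 1); 1 @ Sp a 1; 0 @ Mg 1 a].
  dstep 0 2 0 (esym (W1s q 1 a 1)).
  dstep 1 2 0 (W3l a).
  by congr (_ *: _); dsame.
by rewrite !scalerA -scalerDl mul1r [qnum q a.+2]qnumS mulNr addrAC addrN add0r.
Qed.

Lemma CiL b : D [:: LB 1; LB b] [:: LB b; LB 1] [:: 0 @ Ci b 1] =
  1 *: D [:: LB 1; LB b] [:: LB b; LB 1] [:: 0 @ Mg 1 b; 0 @ Sp b 1] +
  - q^-1 *: D [:: LB 1; LB b] [:: LB b; LB 1] [:: 1 @ Sp b.-1 1; 0 @ Mg 1 b.-1].
Proof.
case: b => [|b].
  rewrite [X in _ + _ *: X](_ : _ = 0) ?scaler0 ?addr0 ?scale1r; last by dinvalid.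
  by dz.
set X := D _ _.
have e1 : X [:: 0 @ Mg 1 b.+1; 0 @ Sp b.+1 1] =
    q ^- b.+1 *: X [:: 0 @ Mg 1 b.+1; 0 @ Sp 1 b.+1; 0 @ Ci b.+1 1].
  transitivity (X [:: 0 @ Mg 1 b.+1; 0 @ Sp b.+1 1; 0 @ Cr b.+1 1; 0 @ Ci b.+1 1]).
    by rewrite /X; symmetry; dstep 2 2 0 (CK q b.+1 1).
  by rewrite /X; dstep 1 2 0 (CrR_absorb_split b.+1).
have e2 : X [:: 1 @ Sp b 1; 0 @ Mg 1 b] =
    q ^- b *: X [:: 1 @ Sp 1 b; 0 @ Cr 1 1; 1 @ Mg 1 b; 0 @ Ci b.+1 1].
  transitivity (X [:: 1 @ Sp b 1; 0 @ Mg 1 b; 0 @ Cr b.+1 1; 0 @ Ci b.+1 1]).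
    by rewrite /X; symmetry; dstep 2 2 0 (CK q b.+1 1).
  rewrite /X; dto [:: 1 @ Sp b 1; 0 @ Mg 1 b; 0 @ Cr (1 + b) 1; 0 @ Ci b.+1 1].
  dstep 1 2 0 (Cr_mergeR 1 b 1).
  by dstep 0 2 1 (CrR_absorb_split b).
have e3 : X [:: 0 @ Mg 1 b.+1; 0 @ Sp 1 b.+1; 0 @ Ci b.+1 1] =
    q ^+ b.+1 *: X [:: 0 @ Ci b.+1 1] +
    1 *: X [:: 1 @ Sp 1 b; 0 @ Cr 1 1; 1 @ Mg 1 b; 0 @ Ci b.+1 1].
  rewrite /X; etransitivity; first by dstep 0 2 0 (@W2l K q b.+1 1 b.+1).
  by congr (_ *: _ + _); dz.
have h : q != 0 by apply: q_neq0.
rewrite e1 e2 e3 !scale1r scalerDr !scalerA mulVf ?expf_neq0 // scale1r.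
by rewrite mulNr -invfM -exprS -addrA scaleNr addrN addr0.
Qed.

End CrossingIdentities.

(** * Thick dots *)

Section Dots.
Context (K : fieldType) (q : K).
Local Notation sg := (SchurBullet'_sig K).
Local Notation D := (@D K q).
Context {gq : generic q}.
Local Notation term := (tm K sg).
Local Notation eqv := (eqm (SchurBullet'_rel q)).
Local Notation ones y a := (merge_ones a ∘ tpow y a ∘ split_ones a).

Lemma sumn_ones a : sumn (nseq a 1%N) = a.
Proof. by rewrite sumn_nseq mul1n. Qed.

Lemma ones_rec (y : term) a : ty y (bl 1) (bl 1) ->
  eqv (bl a.+1) (bl a.+1) (ones y a.+1) (mm 1 a ∘ (y ⊗ ones y a) ∘ ss 1 a).
Proof.
move=> hy; set w := flatten (map (@bl K) (nseq a 1%N)).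
have tM : ty (merge_ones a : term) w (bl a).
  by have := ty_merges (nseq a 1%N) : ty (merge_ones a : term) _ _; rewrite sumn_ones.
have tS : ty (split_ones a : term) (bl a) w.
  by have := ty_splits (nseq a 1%N) : ty (split_ones a : term) _ _; rewrite sumn_ones.
have tT : ty (tpow y a) w w by apply: ty_tpow.
have i1 := ty_idb 1 : ty (idb 1 : term) _ _.
have tm := ty_mm 1 a : ty (mm 1 a : term) _ _.
have ts := ty_ss 1 a : ty (ss 1 a : term) _ _.
rewrite {1}/merge_ones {1}/split_ones /= -/(merge_ones a) -/(split_ones a) !sumn_ones.
have tA := ty_tens i1 tM; have tB := ty_tens hy tT; have tC := ty_tens i1 tS.
have inner : eqv (bl 1 ++ bl a) (bl 1 ++ bl a)
    ((idb 1 ⊗ merge_ones a) ∘ (y ⊗ tpow y a) ∘ (idb 1 ⊗ split_ones a)) (y ⊗ ones y a).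
  apply: eqm_trans (eqm_comp (eqm_sym (eqm_tens_comp _ i1 hy tM tT)) (eqm_refl _ tC)) _.
  have t1 := ty_comp i1 hy; have t2 := ty_comp tM tT.
  apply: eqm_trans (eqm_sym (eqm_tens_comp _ t1 i1 t2 tS)) _.
  apply: eqm_tens (eqm_refl _ (ty_comp t2 tS)).
  exact: eqm_trans (eqm_compm1 _ t1) (eqm_comp1m _ hy).
apply: eqm_trans (eqm_compA _ (ty_comp (ty_comp tm tA) tB) tC ts) _.
apply: eqm_comp (eqm_refl _ ts).
apply: eqm_trans (eqm_comp (eqm_sym (eqm_compA _ tm tA tB)) (eqm_refl _ tC)) _.
apply: eqm_trans (eqm_sym (eqm_compA _ tm (ty_comp tA tB) tC)) _.
exact: eqm_comp (eqm_refl _ tm) inner.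
Qed.

Definition ydot (e : bool) : term := if e then x1i K else x1 K.

Lemma ydot_ty e : ty (ydot e) (bl 1) (bl 1).
Proof. by case: e; [apply: ty_x1i | apply: ty_x1]. Qed.

Lemma ones_ty e a : ty (ones (ydot e) a) (bl a) (bl a).
Proof. exact/ty_ones/ydot_ty. Qed.

Lemma ones1 (y : term) : ty y (bl 1) (bl 1) -> eqv (bl 1) (bl 1) (ones y 1) y.
Proof.
move=> hy; have i0 := @ty_id K sg [::]; have i1 := ty_idb 1 : ty (idb 1 : term) _ _.
apply: eqm_trans (ones_rec 0 hy) _; rewrite /=.
have e0 : eqv [::] [::] (ones y 0) (tid [::]).
  exact: eqm_trans (eqm_compm1 _ (ty_comp i0 i0)) (eqm_compm1 _ i0).
have e1 : eqv (bl 1) (bl 1) (y ⊗ ones y 0) y.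
  apply: eqm_trans (eqm_tensm1 _ hy).
  exact: (eqm_tens (eqm_refl _ hy) e0).
have t1 := (eqm_ty e1).1.
apply: eqm_trans (eqm_compm1 _ (ty_comp i1 t1)) _.
exact: eqm_trans (eqm_comp1m _ t1) e1.
Qed.

Lemma Dt_ones e a :
  eqv (bl a) (bl a) (atm q (Dt e a)) ((qfact q a)^-1 •: ones (ydot e) a).
Proof.
have t := ones_ty e a.
have r : eqv (bl a) (bl a) ((qfact q a)^-1 •: ones (ydot e) a)
  ((qfact q a)^-1 •: ones (ydot e) a) by apply/eqm_refl/ty_scale.
case: e a t r => [//|] [|[|a]] t r //=.
- rewrite qfact0 invr1; apply: eqm_sym; apply: eqm_trans (eqm_scale1 _ t) _.
  have i0 := @ty_id K sg [::].
  exact: eqm_trans (eqm_compm1 _ (ty_comp i0 i0)) (eqm_compm1 _ i0).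
- rewrite qfact1 invr1; apply: eqm_sym; apply: eqm_trans (eqm_scale1 _ t) _.
  exact: ones1 (ydot_ty false).
Qed.

Lemma mono_x1i : mono q (x1i K) [:: LB 1] [:: LB 1] [:: 0 @ Dt true 1].
Proof.
have [v e] := mono_atom q (Dt true 1); split=> //.
apply: eqm_trans e; rewrite /wds /= ?cats0.
apply: eqm_sym; apply: eqm_trans (Dt_ones true 1) _; rewrite qfact1 invr1.
exact: eqm_trans (eqm_scale1 _ (ones_ty _ _)) (ones1 (ydot_ty true)).
Qed.

Lemma Dt_rec e a : D [:: LB (1 + a)] [:: LB (1 + a)]
    [:: 0 @ Sp 1 a; 0 @ Dt e 1; 1 @ Dt e a; 0 @ Mg 1 a]
  = qnum q a.+1 *: D [:: LB (1 + a)] [:: LB (1 + a)] [:: 0 @ Dt e (1 + a)].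
Proof.
have m : mono q (mm 1 a ∘ (atm q (Dt e 1) ⊗ atm q (Dt e a)) ∘ ss 1 a)
    [:: LB (1 + a)] [:: LB (1 + a)] [:: 0 @ Sp 1 a; 0 @ Dt e 1; 1 @ Dt e a; 0 @ Mg 1 a].
  eapply mono_cast.
  - eapply mono_comp_eq; [eapply mono_comp_eq; [eapply mono_mm| |]|eapply mono_ss|].
    + eapply mono_tens; eapply mono_atom.
    + by dcbv.
    + by dcbv.
  - by [].
  - by [].
  - by [].
have m' := mono_atom q (Dt e (1 + a)).
apply/(repP (rep_mono m) (rep_scale (qnum q a.+1) (rep_mono m'))).
have -> : wds [:: LB (1 + a)] = bl a.+1 by rewrite /wds /= ?cats0.
have tm := ty_mm 1 a : ty (mm 1 a : term) _ _.
have ts := ty_ss 1 a : ty (ss 1 a : term) _ _.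
have to := ones_ty e a.
have e1 : eqv (bl 1) (bl 1) (atm q (Dt e 1)) (ydot e).
  apply: eqm_trans (Dt_ones e 1) _; rewrite qfact1 invr1.
  exact: eqm_trans (eqm_scale1 _ (ones_ty _ _)) (ones1 (ydot_ty e)).
have ty1 := ty_tens (ydot_ty e) to.
have tk := ty_scale (qfact q a)^-1 ty1.
apply: (@eqm_trans _ _ _ _ _ _ (mm 1 a ∘ ((qfact q a)^-1 •: (ydot e ⊗ ones (ydot e) a)) ∘ ss 1 a)).
  apply: eqm_comp (eqm_refl _ ts); apply: eqm_comp (eqm_refl _ tm) _.
  apply: eqm_trans (eqm_tens e1 (Dt_ones e a)) _.
  exact: eqm_tensZr (ydot_ty e) to.
apply: eqm_trans (eqm_comp (eqm_compZr _ _ tm ty1) (eqm_refl _ ts)) _.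
apply: eqm_trans (eqm_compZl _ _ (ty_comp tm ty1) ts) _.
apply: eqm_trans (eqm_scale _ (eqm_sym (ones_rec a (ydot_ty e)))) _.
have to' := ones_ty e a.+1.
apply: eqm_trans _ (eqm_scale _ (eqm_sym (Dt_ones e a.+1))).
apply: eqm_trans _ (eqm_sym (eqm_scaleA _ _ _ to')).
have -> : qnum q a.+1 * (qfact q a.+1)^-1 = (qfact q a)^-1.
  rewrite qfactS invfM mulrCA divff ?mulr1 ?qfact_neq0 //; exact: qnum_neq0.
by apply/eqm_refl/ty_scale.
Qed.

Lemma xK1 e : D [:: LB 1] [:: LB 1] [:: 0 @ Dt e 1; 0 @ Dt (~~ e) 1] =
  D [:: LB 1] [:: LB 1] [::].
Proof.
case: e => /=.
- apply: rel_D; first by apply: (rel'_xVK q).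
    by eapply mono_cast; [eapply mono_comp_eq; [eapply mono_x1|eapply mono_x1i|]|..].
  by apply: rep_mono; mono.
- apply: rel_D; first by apply: (rel'_xK q).
    by eapply mono_cast; [eapply mono_comp_eq; [eapply mono_x1i|eapply mono_x1|]|..].
  by apply: rep_mono; mono.
Qed.

Lemma W4l1 : D [:: LB 1; LB 1] [:: LB 1; LB 1] [:: 0 @ Dt false 1; 0 @ Cr 1 1] =
  D [:: LB 1; LB 1] [:: LB 1; LB 1] [:: 0 @ Ci 1 1; 1 @ Dt false 1].
Proof. by apply: rel_D; [apply: (rel'_W4l q) | mono | apply: rep_mono; mono]. Qed.

Lemma W4r1 : D [:: LB 1; LB 1] [:: LB 1; LB 1] [:: 0 @ Cr 1 1; 0 @ Dt false 1] =
  D [:: LB 1; LB 1] [:: LB 1; LB 1] [:: 1 @ Dt false 1; 0 @ Ci 1 1].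
Proof. by apply: rel_D; [apply: (rel'_W4r q) | mono | apply: rep_mono; mono]. Qed.

Lemma CrDD e : D [:: LB 1; LB 1] [:: LB 1; LB 1] [:: 0 @ Cr 1 1; 0 @ Dt e 1; 1 @ Dt e 1] =
  D [:: LB 1; LB 1] [:: LB 1; LB 1] [:: 0 @ Dt e 1; 1 @ Dt e 1; 0 @ Cr 1 1].
Proof.
have H : D [:: LB 1; LB 1] [:: LB 1; LB 1] [:: 0 @ Cr 1 1; 0 @ Dt false 1; 1 @ Dt false 1] =
  D [:: LB 1; LB 1] [:: LB 1; LB 1] [:: 0 @ Dt false 1; 1 @ Dt false 1; 0 @ Cr 1 1].
  dstep 0 2 0 W4r1.
  dstep 1 2 0 (esym W4l1).
  by dsame.
case: e => //; symmetry.
transitivity (D [:: LB 1; LB 1] [:: LB 1; LB 1] [:: 0 @ Dt true 1; 1 @ Dt true 1; 0 @ Cr 1 1;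
   0 @ Dt false 1; 0 @ Dt true 1; 1 @ Dt false 1; 1 @ Dt true 1]).
  symmetry.
  dstep 3 2 0 (xK1 false).
  dstep 3 2 1 (xK1 false).
  by [].
dto [:: 0 @ Dt true 1; 1 @ Dt true 1; 0 @ Cr 1 1;
   0 @ Dt false 1; 1 @ Dt false 1; 0 @ Dt true 1; 1 @ Dt true 1].
dstep 2 3 0 H.
dto [:: 0 @ Dt true 1; 0 @ Dt false 1; 1 @ Dt true 1; 1 @ Dt false 1; 0 @ Cr 1 1;
   0 @ Dt true 1; 1 @ Dt true 1].
dstep 0 2 0 (xK1 true).
by dstep 0 2 1 (xK1 true).
Qed.

Lemma MgSp1 a : D [:: LB 1; LB a.+1] [:: LB 1; LB a.+1] [:: 0 @ Mg 1 a.+1; 0 @ Sp 1 a.+1] =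
  q ^+ a.+1 *: D [:: LB 1; LB a.+1] [:: LB 1; LB a.+1] [::] +
  1 *: D [:: LB 1; LB a.+1] [:: LB 1; LB a.+1] [:: 1 @ Sp 1 a; 0 @ Cr 1 1; 1 @ Mg 1 a].
Proof. by rewrite (@W2l K q a.+1 1 a.+1) //; congr (_ *: _ + _); dz. Qed.

Lemma W5_1 e a :
  D [:: LB 1; LB a] [:: LB (1 + a)] [:: 0 @ Mg 1 a; 0 @ Dt e (1 + a)] =
  D [:: LB 1; LB a] [:: LB (1 + a)] [:: 0 @ Dt e 1; 1 @ Dt e a; 0 @ Mg 1 a] /\
  D [:: LB (1 + a)] [:: LB 1; LB a] [:: 0 @ Dt e (1 + a); 0 @ Sp 1 a] =
  D [:: LB (1 + a)] [:: LB 1; LB a] [:: 0 @ Sp 1 a; 0 @ Dt e 1; 1 @ Dt e a].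
Proof.
elim: a => [|a [IHm IHs]].
  by split; rewrite addn0; dz.
have Q : D [:: LB 1; LB a.+1] [:: LB 1; LB a.+1]
    [:: 0 @ Mg 1 a.+1; 0 @ Sp 1 a.+1; 0 @ Dt e 1; 1 @ Dt e a.+1] =
  D [:: LB 1; LB a.+1] [:: LB 1; LB a.+1]
    [:: 0 @ Dt e 1; 1 @ Dt e a.+1; 0 @ Mg 1 a.+1; 0 @ Sp 1 a.+1].
  etransitivity; first by dstep 0 2 0 (MgSp1 a).
  symmetry; etransitivity; first by dstep 2 2 0 (MgSp1 a).
  congr (_ + _ *: _); symmetry.
  dto [:: 1 @ Sp 1 a; 0 @ Cr 1 1; 0 @ Dt e 1; 1 @ Mg 1 a; 1 @ Dt e (1 + a)].
  dstep 3 2 1 IHm.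
  dto [:: 1 @ Sp 1 a; 0 @ Cr 1 1; 0 @ Dt e 1; 1 @ Dt e 1; 2 @ Dt e a; 1 @ Mg 1 a].
  dstep 1 3 0 (CrDD e).
  symmetry.
  dto [:: 0 @ Dt e 1; 1 @ Dt e (1 + a); 1 @ Sp 1 a; 0 @ Cr 1 1; 1 @ Mg 1 a].
  dstep 1 2 1 IHs.
  by dsame.
have k0 : qnum q a.+2 != 0 by exact: qnum_neq0.
split; apply: (scalerI k0).
  transitivity (D [:: LB 1; LB a.+1] [:: LB (1 + a.+1)]
    [:: 0 @ Mg 1 a.+1; 0 @ Sp 1 a.+1; 0 @ Dt e 1; 1 @ Dt e a.+1; 0 @ Mg 1 a.+1]).
    by symmetry; dstep 1 4 0 (Dt_rec e a.+1).
  dstep 0 4 0 Q.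
  by dstep 3 2 0 (W3l a.+1).
transitivity (D [:: LB (1 + a.+1)] [:: LB 1; LB a.+1]
  [:: 0 @ Sp 1 a.+1; 0 @ Dt e 1; 1 @ Dt e a.+1; 0 @ Mg 1 a.+1; 0 @ Sp 1 a.+1]).
  by symmetry; dstep 0 4 0 (Dt_rec e a.+1).
dstep 1 4 0 (esym Q).
by dstep 0 2 0 (W3l a.+1).
Qed.

Lemma W5m e a b :
  D [:: LB a; LB b] [:: LB (a + b)] [:: 0 @ Mg a b; 0 @ Dt e (a + b)] =
  D [:: LB a; LB b] [:: LB (a + b)] [:: 0 @ Dt e a; 1 @ Dt e b; 0 @ Mg a b].
Proof.
elim: a => [|a IH]; first by rewrite add0n; dz.
apply: (@explodeL _ _ _ [::] a [:: LB b]); dcbv.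
dstep 0 2 0 (W1m q 1 a b).
dstep 1 2 0 (W5_1 e (a + b)).1.
dto [:: 0 @ Dt e 1; 1 @ Mg a b; 1 @ Dt e (a + b); 0 @ Mg 1 (a + b)].
dstep 1 2 1 IH.
symmetry.
dstep 0 2 0 (W5_1 e a).1.
dto [:: 0 @ Dt e 1; 1 @ Dt e a; 2 @ Dt e b; 0 @ Mg 1 a; 0 @ Mg (1 + a) b].
dstep 3 2 0 (W1m q 1 a b).
by dsame.
Qed.

Lemma W5s e a b :
  D [:: LB (a + b)] [:: LB a; LB b] [:: 0 @ Dt e (a + b); 0 @ Sp a b] =
  D [:: LB (a + b)] [:: LB a; LB b] [:: 0 @ Sp a b; 0 @ Dt e a; 1 @ Dt e b].
Proof.
elim: a => [|a IH]; first by rewrite add0n; dz.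
apply: (scalerI (qnum_neq0 q a)).
transitivity (D [:: LB (1 + a + b)] [:: LB a.+1; LB b]
  [:: 0 @ Dt e (1 + a + b); 0 @ Sp (1 + a) b; 0 @ Sp 1 a; 0 @ Mg 1 a]).
  by symmetry; dstep 2 2 0 (W3l a).
dstep 1 2 0 (W1s q 1 a b).
dstep 0 2 0 (W5_1 e (a + b)).2.
dto [:: 0 @ Sp 1 (a + b); 0 @ Dt e 1; 1 @ Dt e (a + b); 1 @ Sp a b; 0 @ Mg 1 a].
dstep 2 2 1 IH.
dto [:: 0 @ Sp 1 (a + b); 1 @ Sp a b; 0 @ Dt e 1; 1 @ Dt e a; 0 @ Mg 1 a; 1 @ Dt e b].
dstep 0 2 0 (esym (W1s q 1 a b)).
dstep 2 3 0 (esym (W5_1 e a).1).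
by dstep 1 2 0 (W3l a).
Qed.

Lemma xK e a : D [:: LB a] [:: LB a] [:: 0 @ Dt e a; 0 @ Dt (~~ e) a] = D [:: LB a] [:: LB a] [::].
Proof.
elim: a => [|a IH]; first by dz.
apply: (@explodeL _ _ _ [::] a [::]); dcbv.
dstep 0 2 0 (W5_1 e a).1.
dstep 2 2 0 (W5_1 (~~ e) a).1.
dto [:: 0 @ Dt e 1; 0 @ Dt (~~ e) 1; 1 @ Dt e a; 1 @ Dt (~~ e) a; 0 @ Mg 1 a].
dstep 0 2 0 (xK1 e).
by dstep 0 2 1 IH.
Qed.

(* The form of (W4) in which no inverse crossing occurs. *)
Lemma Dt_slide1 b : D [:: LB b; LB 1] [:: LB b; LB 1] [:: 0 @ Cr b 1; 0 @ Dt false 1; 0 @ Cr 1 b] =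
  D [:: LB b; LB 1] [:: LB b; LB 1] [:: 1 @ Dt false 1].
Proof.
elim: b => [|b IH]; first by dz.
apply: (@explodeL _ _ _ [::] b [:: LB 1]); dcbv.
dstep 0 2 0 (Cr_mergeR 1 b 1).
dto [:: 1 @ Cr b 1; 0 @ Cr 1 1; 0 @ Dt false 1; 1 @ Mg 1 b; 0 @ Cr 1 (1 + b)].
dstep 3 2 0 (Cr_mergeL1 q 1 b).
dstep 2 2 0 W4l1.
dstep 1 2 0 (CK q 1 1).
dstep 0 3 1 IH.
by dsame.
Qed.

Lemma Dt_slide a b : D [:: LB b; LB a] [:: LB b; LB a] [:: 0 @ Cr b a; 0 @ Dt false a; 0 @ Cr a b] =
  D [:: LB b; LB a] [:: LB b; LB a] [:: 1 @ Dt false a].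
Proof.
elim: a => [|a IH]; first by dz.
rewrite -addn1.
apply: (@explodeR _ _ _ [:: LB b] a [::]); dcbv.
dstep 0 2 0 (Cr_mergeL b a 1).
dstep 2 2 0 (W5m false a 1).
dstep 4 2 0 (Cr_mergeR1 q a b).
dto [:: 0 @ Cr b a; 0 @ Dt false a; 1 @ Cr b 1; 1 @ Dt false 1; 1 @ Cr 1 b; 0 @ Cr a b; 1 @ Mg a 1].
dstep 2 3 1 (Dt_slide1 b).
dto [:: 0 @ Cr b a; 0 @ Dt false a; 0 @ Cr a b; 2 @ Dt false 1; 1 @ Mg a 1].
dstep 0 3 0 IH.
symmetry.
dstep 0 2 1 (W5m false a 1).
by dsame.
Qed.

Lemma W4l a b : D [:: LB a; LB b] [:: LB b; LB a] [:: 0 @ Dt false a; 0 @ Cr a b] =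
  D [:: LB a; LB b] [:: LB b; LB a] [:: 0 @ Ci b a; 1 @ Dt false a].
Proof.
symmetry.
dstep 1 1 0 (esym (Dt_slide a b)).
by dstep 0 2 0 (CiK q b a).
Qed.

Lemma W4r a b : D [:: LB a; LB b] [:: LB b; LB a] [:: 0 @ Cr a b; 0 @ Dt false b] =
  D [:: LB a; LB b] [:: LB b; LB a] [:: 1 @ Dt false b; 0 @ Ci b a].
Proof.
symmetry.
dstep 0 1 0 (esym (Dt_slide b a)).
by dstep 2 2 0 (CK q b a).
Qed.

End Dots.

(** * Double crossings of a black and a red strand *)

Section DotRedCrossings.
Context (K : fieldType) (q : K).
Local Notation D := (@D K q).
Context {gq : generic q}.

Lemma S2lr1 u : D [:: LB 1; LR u] [:: LB 1; LR u] [:: 0 @ Rr 1 u; 0 @ Ll u 1] =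
  1 *: D [:: LB 1; LR u] [:: LB 1; LR u] [:: 0 @ Dt false 1] +
  - u *: D [:: LB 1; LR u] [:: LB 1; LR u] [::].
Proof.
apply: rel_D; [apply: (rel'_S2lr q u) | mono |].
by apply: rep_add; [rewrite scale1r | apply: rep_scale]; apply: rep_mono; mono.
Qed.

Lemma S2rl1 u : D [:: LR u; LB 1] [:: LR u; LB 1] [:: 0 @ Ll u 1; 0 @ Rr 1 u] =
  1 *: D [:: LR u; LB 1] [:: LR u; LB 1] [:: 1 @ Dt false 1] +
  - u *: D [:: LR u; LB 1] [:: LR u; LB 1] [::].
Proof.
apply: rel_D; [apply: (rel'_S2rl q u) | mono |].
by apply: rep_add; [rewrite scale1r | apply: rep_scale]; apply: rep_mono; mono.
Qed.

Lemma Dt_flip r : D [:: LB (1 + r)] [:: LB (1 + r)] [:: 0 @ Sp 1 r; 1 @ Dt false r; 0 @ Mg 1 r] =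
  (q ^- r * q ^- r) *: D [:: LB (1 + r)] [:: LB (1 + r)] [:: 0 @ Sp r 1; 0 @ Dt false r; 0 @ Mg r 1].
Proof.
dstep 1 1 0 (esym (Dt_slide r 1)).
rewrite -scalerA.
etransitivity; first by dstep 0 2 0 (CrL_absorb_split r).
congr (_ *: _).
by dstep 2 2 0 (CrR_absorb_merge r).
Qed.

Lemma omega_dot r t : D [:: LB (1 + (r + t))] [:: LB (1 + (r + t))]
    [:: 0 @ Sp 1 (r + t); 1 @ Sp r t; 0 @ Dt false 1; 1 @ Dt false r; 1 @ Mg r t; 0 @ Mg 1 (r + t)] =
  qnum q r.+1 *: D [:: LB (1 + (r + t))] [:: LB (1 + (r + t))]
    [:: 0 @ Sp r.+1 t; 0 @ Dt false r.+1; 0 @ Mg r.+1 t].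
Proof.
dstep 0 2 0 (esym (W1s q 1 r t)).
dstep 4 2 0 (esym (W1m q 1 r t)).
by dstep 1 4 0 (Dt_rec false r).
Qed.

Lemma omega_nodot r t : D [:: LB (1 + (r + t))] [:: LB (1 + (r + t))]
    [:: 0 @ Sp 1 (r + t); 1 @ Sp r t; 1 @ Dt false r; 1 @ Mg r t; 0 @ Mg 1 (r + t)] =
  (q ^- r * q ^- r * qnum q t.+1) *: D [:: LB (1 + (r + t))] [:: LB (1 + (r + t))]
    [:: 0 @ Sp r t.+1; 0 @ Dt false r; 0 @ Mg r t.+1].
Proof.
dstep 0 2 0 (esym (W1s q 1 r t)).
dstep 3 2 0 (esym (W1m q 1 r t)).
etransitivity; first by dstep 1 3 0 (Dt_flip r).
rewrite -[RHS]scalerA; congr (_ *: _).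
dto [:: 0 @ Sp (r + 1) t; 0 @ Sp r 1; 0 @ Dt false r; 0 @ Mg r 1; 0 @ Mg (r + 1) t].
dstep 0 2 0 (W1s q r 1 t).
dstep 3 2 0 (W1m q r 1 t).
dto [:: 0 @ Sp r (1 + t); 1 @ Sp 1 t; 1 @ Mg 1 t; 0 @ Dt false r; 0 @ Mg r (1 + t)].
by dstep 1 2 1 (W3l t).
Qed.

Definition kS2 (u : K) a t := (-1) ^+ t * q ^- (t * (a - t)) * u ^+ t.

Lemma qnum0 : qnum q 0 = 0.
Proof. by rewrite /qnum !expr0 invr1 subrr mul0r. Qed.

(* This is where [m+n] = q^n [m] + q^{-m} [n] enters. *)
Lemma kS2_rec u a t : (t <= a.+1)%N ->
  kS2 u a t * qnum q (a.+1 - t) +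
  (if t is t'.+1 then - u * (kS2 u a t' * (q ^- (a - t') * q ^- (a - t') * qnum q t)) else 0) =
  qnum q a.+1 * kS2 u a.+1 t.
Proof.
have h : q != 0 by apply: q_neq0.
case: t => [|t] ht.
  by rewrite addr0 /kS2 !mul0n !expr0 invr1 !mul1r mulr1 subn0.
rewrite subSS; set n := (a - t)%N.
have -> : a = (n + t)%N by rewrite /n; lia.
rewrite /kS2.
have -> : (n + t - t.+1 = n.-1)%N by lia.
have -> : ((n + t).+1 - t.+1 = n)%N by lia.
have -> : (n + t - t = n)%N by lia.
rewrite -[(n + t).+1]addnS qnumD.
have e1 : q ^- (t.+1 * n.-1) * qnum q n = q ^- (t.+1 * n) * q ^+ t.+1 * qnum q n.
  case: n => [|n]; first by rewrite qnum0 !mulr0.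
  by rewrite mulnS exprD invfM; congr (_ * _); rewrite mulrAC mulVf ?mul1r ?expf_neq0.
have e2 : q ^- (t.+1 * n) = q ^- n * q ^- (t * n) by rewrite mulSn exprD invfM.
rewrite [X in X + _](_ : _ = (-1) ^+ t.+1 * u ^+ t.+1 * (q ^- (t.+1 * n.-1) * qnum q n)); last by ring.
rewrite e1 e2 !exprS; move: (q ^- n) (q ^- (t * n)) (qnum q n) (qnum q t.+1) => x y z w.
by ring.
Qed.

Lemma S2_sum (V : lmodType K) u a (O : nat -> V) :
  \sum_(0 <= t < a.+1) kS2 u a t *: (qnum q (a.+1 - t) *: O t) +
  - u *: (\sum_(0 <= t < a.+1)
    kS2 u a t *: ((q ^- (a - t) * q ^- (a - t) * qnum q t.+1) *: O t.+1)) =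
  qnum q a.+1 *: \sum_(0 <= t < a.+2) kS2 u a.+1 t *: O t.
Proof.
rewrite [RHS]scaler_sumr.
have -> : \sum_(0 <= t < a.+2) qnum q a.+1 *: (kS2 u a.+1 t *: O t) =
  \sum_(0 <= t < a.+2) (kS2 u a t * qnum q (a.+1 - t)) *: O t +
  \sum_(0 <= t < a.+2) (if t is t'.+1 then
     - u * (kS2 u a t' * (q ^- (a - t') * q ^- (a - t') * qnum q t)) else 0) *: O t.
  rewrite -big_split /= !big_nat; apply: eq_bigr => t /andP[_ ht].
  by rewrite scalerA -scalerDl kS2_rec.
congr (_ + _).
  rewrite [RHS]big_nat_recr //= subnn qnum0 mulr0 scale0r addr0.
  by apply: eq_bigr => t _; rewrite scalerA.
rewrite [RHS]big_nat_recl //= scale0r add0r scaler_sumr.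
by apply: eq_bigr => t _; rewrite !scalerA !mulrA.
Qed.

Lemma S2lr u a : D [:: LB a; LR u] [:: LB a; LR u] [:: 0 @ Rr a u; 0 @ Ll u a] =
  \sum_(0 <= t < a.+1) kS2 u a t *: D [:: LB a; LR u] [:: LB a; LR u]
    [:: 0 @ Sp (a - t) t; 0 @ Dt false (a - t); 0 @ Mg (a - t) t].
Proof.
elim: a => [|a IH].
  by rewrite big_nat1 /kS2 !expr0 invr1 !mulr1 scale1r; dz.
apply: (scalerI (qnum_neq0 q a)); rewrite -S2_sum.
transitivity (D [:: LB a.+1; LR u] [:: LB a.+1; LR u]
  [:: 0 @ Sp 1 a; 0 @ Mg 1 a; 0 @ Rr (1 + a) u; 0 @ Ll u (1 + a)]).
  by symmetry; dstep 0 2 0 (W3l a).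
dstep 1 2 0 (S1rm q 1 a u).
dstep 3 2 0 (S1lm q 1 a u).
etransitivity; first by dstep 2 2 0 (S2lr1 u).
rewrite scale1r; congr (_ + _ *: _).
  dto [:: 0 @ Sp 1 a; 1 @ Rr a u; 1 @ Ll u a; 0 @ Dt false 1; 0 @ Mg 1 a].
  dstep 1 2 1 IH.
  rewrite !big_nat; apply: eq_bigr => t /andP[_ ht]; congr (_ *: _).
  dto [:: 0 @ Sp 1 (a - t + t); 1 @ Sp (a - t) t; 0 @ Dt false 1; 1 @ Dt false (a - t);
    1 @ Mg (a - t) t; 0 @ Mg 1 (a - t + t)].
  dstep 0 6 0 (omega_dot (a - t) t).
  by have -> : (a.+1 - t = (a - t).+1)%N by lia.
dstep 1 2 1 IH.
rewrite !big_nat; apply: eq_bigr => t /andP[_ ht]; congr (_ *: _).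
dto [:: 0 @ Sp 1 (a - t + t); 1 @ Sp (a - t) t; 1 @ Dt false (a - t);
  1 @ Mg (a - t) t; 0 @ Mg 1 (a - t + t)].
by dstep 0 5 0 (omega_nodot (a - t) t).
Qed.

Lemma S2rl u a : D [:: LR u; LB a] [:: LR u; LB a] [:: 0 @ Ll u a; 0 @ Rr a u] =
  \sum_(0 <= t < a.+1) kS2 u a t *: D [:: LR u; LB a] [:: LR u; LB a]
    [:: 1 @ Sp (a - t) t; 1 @ Dt false (a - t); 1 @ Mg (a - t) t].
Proof.
elim: a => [|a IH].
  by rewrite big_nat1 /kS2 !expr0 invr1 !mulr1 scale1r; dz.
apply: (scalerI (qnum_neq0 q a)); rewrite -S2_sum.
transitivity (D [:: LR u; LB a.+1] [:: LR u; LB a.+1]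
  [:: 1 @ Sp 1 a; 1 @ Mg 1 a; 0 @ Ll u (1 + a); 0 @ Rr (1 + a) u]).
  by symmetry; dstep 0 2 1 (W3l a).
dstep 1 2 0 (S1lm q 1 a u).
dstep 3 2 0 (S1rm q 1 a u).
etransitivity; first by dstep 2 2 1 IH.
rewrite scaler_sumr -big_split /= !big_nat; apply: eq_bigr => t /andP[_ ht].
rewrite [- u *: (_ *: _)]scalerA [- u * _]mulrC -[(_ * - u) *: _]scalerA -scalerDr; congr (_ *: _).
dto [:: 1 @ Sp 1 a; 0 @ Ll u 1; 0 @ Rr 1 u; 2 @ Sp (a - t) t; 2 @ Dt false (a - t);
  2 @ Mg (a - t) t; 1 @ Mg 1 a].
etransitivity; first by dstep 1 2 0 (S2rl1 u).
rewrite scale1r; congr (_ + _ *: _).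
  dto [:: 1 @ Sp 1 (a - t + t); 2 @ Sp (a - t) t; 1 @ Dt false 1; 2 @ Dt false (a - t);
    2 @ Mg (a - t) t; 1 @ Mg 1 (a - t + t)].
  dstep 0 6 1 (omega_dot (a - t) t).
  by have -> : (a.+1 - t = (a - t).+1)%N by lia.
dto [:: 1 @ Sp 1 (a - t + t); 2 @ Sp (a - t) t; 2 @ Dt false (a - t);
  2 @ Mg (a - t) t; 1 @ Mg 1 (a - t + t)].
by dstep 0 5 1 (omega_nodot (a - t) t).
Qed.

End DotRedCrossings.

(** * A crossing dragged across a red strand *)

Section CrossingThroughRed.
Context (K : fieldType) (q : K).
Local Notation D := (@D K q).
Context {gq : generic q}.
Local Notation z := (q^-1 - q).

Lemma S3_11 u : D [:: LB 1; LR u; LB 1] [:: LB 1; LR u; LB 1]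
    [:: 0 @ Rr 1 u; 1 @ Cr 1 1; 0 @ Ll u 1] =
  1 *: D [:: LB 1; LR u; LB 1] [:: LB 1; LR u; LB 1] [:: 1 @ Ll u 1; 0 @ Cr 1 1; 1 @ Rr 1 u] +
  - z *: D [:: LB 1; LR u; LB 1] [:: LB 1; LR u; LB 1] [:: 2 @ Dt false 1].
Proof.
apply: rel_D; [apply: (rel'_S3 q u) | mono |].
by apply: rep_add; [rewrite scale1r | apply: rep_scale]; apply: rep_mono; mono.
Qed.

Lemma S3_1 u b : D [:: LB 1; LR u; LB b] [:: LB b; LR u; LB 1]
    [:: 0 @ Rr 1 u; 1 @ Cr 1 b; 0 @ Ll u b] =
  1 *: D [:: LB 1; LR u; LB b] [:: LB b; LR u; LB 1] [:: 1 @ Ll u b; 0 @ Cr 1 b; 1 @ Rr 1 u] +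
  - z *: D [:: LB 1; LR u; LB b] [:: LB b; LR u; LB 1]
    [:: 2 @ Sp b.-1 1; 1 @ Ll u b.-1; 3 @ Dt false 1; 0 @ Mg 1 b.-1].
Proof.
elim: b => [|b IH].
  rewrite [X in _ + _ *: X](_ : _ = 0) ?scaler0 ?addr0 ?scale1r; last by dinvalid.
  by dz.
pose X := D [:: LB 1; LR u; LB 1; LB b] [:: LB b.+1; LR u; LB 1].
have E : X [:: 2 @ Mg 1 b; 0 @ Rr 1 u; 1 @ Cr 1 b.+1; 0 @ Ll u b.+1] =
  1 *: X [:: 2 @ Mg 1 b; 1 @ Ll u b.+1; 0 @ Cr 1 b.+1; 1 @ Rr 1 u] +
  - z *: X [:: 2 @ Mg 1 b; 2 @ Sp b 1; 1 @ Ll u b; 3 @ Dt false 1; 0 @ Mg 1 b].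
  have T1 : X [:: 2 @ Mg 1 b; 1 @ Ll u b.+1; 0 @ Cr 1 b.+1; 1 @ Rr 1 u] =
    X [:: 1 @ Ll u 1; 0 @ Cr 1 1; 2 @ Ll u b; 1 @ Cr 1 b; 2 @ Rr 1 u; 0 @ Mg 1 b].
    rewrite /X; dstep 0 2 1 (S1lm q 1 b u).
    dto [:: 1 @ Ll u 1; 2 @ Ll u b; 1 @ Mg 1 b; 0 @ Cr 1 (1 + b); 1 @ Rr 1 u].
    dstep 2 2 0 (Cr_mergeL1 q 1 b).
    by dsame.
  have T2 : X [:: 1 @ Ll u 1; 0 @ Cr 1 1; 3 @ Sp b.-1 1; 2 @ Ll u b.-1; 4 @ Dt false 1;
      1 @ Mg 1 b.-1; 0 @ Mg 1 b] =
    q^-1 *: X [:: 3 @ Sp b.-1 1; 2 @ Mg 1 b.-1; 1 @ Ll u b; 3 @ Dt false 1; 0 @ Mg 1 b].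
    rewrite /X; case: b {IH T1 X} => [|b].
      rewrite [LHS](_ : _ = 0) ?[X in _ *: X](_ : _ = 0) ?scaler0 //; dinvalid.
    dto [:: 1 @ Ll u 1; 0 @ Cr 1 1; 3 @ Sp b 1; 2 @ Ll u b; 4 @ Dt false 1;
      1 @ Mg 1 b; 0 @ Mg 1 (1 + b)].
    dstep 5 2 0 (esym (W1m q 1 1 b)).
    dto [:: 1 @ Ll u 1; 0 @ Cr 1 1; 0 @ Mg 1 1; 2 @ Sp b 1; 1 @ Ll u b; 3 @ Dt false 1; 0 @ Mg (1 + 1) b].
    etransitivity; first by dstep 1 2 0 (CrR_absorb_merge 1).
    rewrite expr1; congr (_ *: _).
    dto [:: 1 @ Ll u 1; 3 @ Sp b 1; 2 @ Ll u b; 4 @ Dt false 1; 0 @ Mg 1 1; 0 @ Mg (1 + 1) b].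
    dstep 4 2 0 (W1m q 1 1 b).
    dto [:: 3 @ Sp b 1; 1 @ Ll u 1; 2 @ Ll u b; 1 @ Mg 1 b; 3 @ Dt false 1; 0 @ Mg 1 (1 + b)].
    dstep 1 3 1 (esym (S1lm q 1 b u)).
    by dsame.
  have T3 : X [:: 2 @ Dt false 1; 2 @ Cr 1 b; 1 @ Ll u b; 0 @ Mg 1 b] =
    1 *: X [:: 2 @ Mg 1 b; 2 @ Sp b 1; 1 @ Ll u b; 3 @ Dt false 1; 0 @ Mg 1 b] +
    - q^-1 *: X [:: 3 @ Sp b.-1 1; 2 @ Mg 1 b.-1; 1 @ Ll u b; 3 @ Dt false 1; 0 @ Mg 1 b].
    rewrite /X; dstep 0 2 2 (W4l 1 b).
    etransitivity; first by dstep 0 1 2 (CiL b).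
    by congr (_ *: _ + _ *: _); dsame.
  transitivity (1 *: X [:: 1 @ Ll u 1; 0 @ Cr 1 1; 1 @ Rr 1 u; 2 @ Cr 1 b; 1 @ Ll u b; 0 @ Mg 1 b] +
    - z *: X [:: 2 @ Dt false 1; 2 @ Cr 1 b; 1 @ Ll u b; 0 @ Mg 1 b]).
    rewrite /X; dto [:: 0 @ Rr 1 u; 2 @ Mg 1 b; 1 @ Cr 1 (1 + b); 0 @ Ll u b.+1].
    dstep 1 2 1 (Cr_mergeL1 q 1 b).
    dto [:: 0 @ Rr 1 u; 1 @ Cr 1 1; 2 @ Cr 1 b; 1 @ Mg 1 b; 0 @ Ll u (1 + b)].
    dstep 3 2 0 (S1lm q 1 b u).
    dto [:: 0 @ Rr 1 u; 1 @ Cr 1 1; 0 @ Ll u 1; 2 @ Cr 1 b; 1 @ Ll u b; 0 @ Mg 1 b].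
    by dstep 0 3 0 (S3_11 u).
  have -> : X [:: 1 @ Ll u 1; 0 @ Cr 1 1; 1 @ Rr 1 u; 2 @ Cr 1 b; 1 @ Ll u b; 0 @ Mg 1 b] =
    1 *: X [:: 1 @ Ll u 1; 0 @ Cr 1 1; 2 @ Ll u b; 1 @ Cr 1 b; 2 @ Rr 1 u; 0 @ Mg 1 b] +
    - z *: X [:: 1 @ Ll u 1; 0 @ Cr 1 1; 3 @ Sp b.-1 1; 2 @ Ll u b.-1; 4 @ Dt false 1;
      1 @ Mg 1 b.-1; 0 @ Mg 1 b].
    by rewrite /X; dstep 2 3 1 IH.
  rewrite -T1 T2 T3 !scale1r -addrA; congr (_ + _).
  by rewrite -scalerDr [- q^-1 *: _]scaleNr addrCA addrN addr0.
apply: (scalerI (qnum_neq0 q b)).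
transitivity (D [:: LB 1; LR u; LB b.+1] [:: LB b.+1; LR u; LB 1]
  [:: 2 @ Sp 1 b; 2 @ Mg 1 b; 0 @ Rr 1 u; 1 @ Cr 1 b.+1; 0 @ Ll u b.+1]).
  by symmetry; dstep 0 2 2 (W3l b).
etransitivity; first by dstep 1 4 0 E.
rewrite scalerDr !scale1r [qnum q b.+1 *: (- z *: _)]scalerA [qnum q b.+1 * _]mulrC.
rewrite -[(- z * qnum q b.+1) *: _]scalerA; congr (_ + _ *: _).
  by dstep 0 2 2 (W3l b).
by dstep 0 2 2 (W3l b).
Qed.

Lemma Ci_absorb_merge s : D [:: LB 1; LB s] [:: LB (s + 1)] [:: 0 @ Ci s 1; 0 @ Mg s 1] =
  q ^+ s *: D [:: LB 1; LB s] [:: LB (s + 1)] [:: 0 @ Mg 1 s].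
Proof.
have h : q ^+ s != 0 by rewrite expf_neq0 // q_neq0.
have e : D [:: LB 1; LB s] [:: LB (s + 1)] [:: 0 @ Mg 1 s] =
  q ^- s *: D [:: LB 1; LB s] [:: LB (s + 1)] [:: 0 @ Ci s 1; 0 @ Mg s 1].
  transitivity (D [:: LB 1; LB s] [:: LB (s + 1)] [:: 0 @ Ci s 1; 0 @ Cr s 1; 0 @ Mg 1 s]).
    by symmetry; dstep 0 2 0 (CiK q s 1).
  by dstep 1 2 0 (CrR_absorb_merge s).
by rewrite e scalerA divff // scale1r.
Qed.

Definition kS3 s := (-1) ^+ s * q ^+ (s * s.-1)./2 * z ^+ s * qfact q s.

Lemma half_mul_pred s : ((s.+1 * s)./2 = (s * s.-1)./2 + s)%N.
Proof.
case: s => // s; have -> : (s.+2 * s.+1 = s.+1 * s + s.+1.*2)%N by lia.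
by rewrite halfD odd_double andbF add0n doubleK.
Qed.

Lemma kS3S s : kS3 s.+1 = kS3 s * q ^+ s * (- z * qnum q s.+1).
Proof.
rewrite /kS3 qfactS /= half_mul_pred exprD !exprS.
by move: (q ^+ s) (z ^+ s) => x y; ring.
Qed.

Lemma S3 u a b N : (minn a b < N)%N ->
  D [:: LB a; LR u; LB b] [:: LB b; LR u; LB a] [:: 0 @ Rr a u; 1 @ Cr a b; 0 @ Ll u b] =
  \sum_(0 <= s < N) kS3 s *: D [:: LB a; LR u; LB b] [:: LB b; LR u; LB a]
    [:: 0 @ Sp s (a - s); 3 @ Sp (b - s) s; 4 @ Dt false s; 2 @ Ll u (b - s);
      1 @ Cr (a - s) (b - s); 2 @ Rr (a - s) u; 0 @ Mg s (b - s); 2 @ Mg (a - s) s].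
Proof.
elim: a => [|a IH] hN.
  case: N hN => // N _; rewrite big_nat_recl // big1 ?addr0 => [|s _]; last first.
    by rewrite [X in _ *: X](_ : _ = 0) ?scaler0 //; dinvalid.
  by rewrite /kS3 qfact0 !expr0 !mulr1 scale1r !subn0; dz.
have {}IH := IH ltac:(lia).
pose X := D [:: LB a; LB 1; LR u; LB b] [:: LB b; LR u; LB (a + 1)].
pose V1 s := X [:: 0 @ Sp s (a - s); 1 @ Mg (a - s) 1; 3 @ Sp (b - s) s; 4 @ Dt false s;
   2 @ Ll u (b - s); 1 @ Cr (a - s + 1) (b - s); 2 @ Rr (a - s + 1) u; 0 @ Mg s (b - s);
   2 @ Mg (a - s + 1) s].
pose V2 s := X [:: 0 @ Sp s (a - s); 1 @ Cr (a - s) 1; 0 @ Mg s 1; 3 @ Sp (b - s).-1 s.+1;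
   4 @ Dt false s.+1; 2 @ Ll u (b - s).-1; 1 @ Cr (a - s) (b - s).-1; 2 @ Rr (a - s) u;
   0 @ Mg s.+1 (b - s).-1; 2 @ Mg (a - s) s.+1].
pose W s := X [:: 0 @ Mg a 1; 0 @ Sp s (a + 1 - s); 3 @ Sp (b - s) s; 4 @ Dt false s;
   2 @ Ll u (b - s); 1 @ Cr (a + 1 - s) (b - s); 2 @ Rr (a + 1 - s) u; 0 @ Mg s (b - s);
   2 @ Mg (a + 1 - s) s].
have EL : X [:: 0 @ Mg a 1; 0 @ Rr (a + 1) u; 1 @ Cr (a + 1) b; 0 @ Ll u b] =
    \sum_(0 <= s < N) kS3 s *: (q ^+ s *: (V1 s + (- z * qnum q s.+1) *: V2 s)).
  rewrite {1}/X; dstep 0 2 0 (S1rm q a 1 u).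
  dstep 2 2 1 (Cr_mergeR1 q a b).
  dto [:: 1 @ Rr 1 u; 2 @ Cr 1 b; 0 @ Rr a u; 1 @ Cr a b; 0 @ Ll u b; 2 @ Mg a 1].
  dstep 2 3 0 IH.
  apply: eq_bigr => s _; congr (_ *: _).
  have [h|h] := boolP ((s <= a) && (s <= b))%N; last first.
    rewrite (_ : V1 s = 0); last by dinvalid.
    rewrite (_ : V2 s = 0); last by dinvalid.
    by rewrite scaler0 addr0 scaler0; dinvalid.
  dto [:: 1 @ Rr 1 u; 2 @ Cr 1 (b - s + s); 2 @ Sp (b - s) s; 0 @ Sp s (a - s); 4 @ Dt false s;
    2 @ Ll u (b - s); 1 @ Cr (a - s) (b - s); 2 @ Rr (a - s) u; 0 @ Mg s (b - s);
    2 @ Mg (a - s) s; 2 @ Mg a 1].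
  dstep 1 2 2 (Cr_slide_split q (b - s) s).
  dto [:: 1 @ Rr 1 u; 3 @ Sp (b - s) s; 2 @ Cr 1 (b - s); 3 @ Cr 1 s; 3 @ Dt false s; 0 @ Sp s (a - s);
    2 @ Ll u (b - s); 1 @ Cr (a - s) (b - s); 2 @ Rr (a - s) u; 0 @ Mg s (b - s);
    2 @ Mg (a - s) s; 2 @ Mg (a - s + s) 1].
  dstep 3 2 3 (W4r 1 s).
  dstep 10 2 2 (W1m q (a - s) s 1).
  dto [:: 1 @ Rr 1 u; 3 @ Sp (b - s) s; 2 @ Cr 1 (b - s); 4 @ Dt false s; 3 @ Ci s 1; 3 @ Mg s 1;
    0 @ Sp s (a - s);
    2 @ Ll u (b - s); 1 @ Cr (a - s) (b - s); 2 @ Rr (a - s) u; 0 @ Mg s (b - s);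
    2 @ Mg (a - s) (s + 1)].
  etransitivity; first by dstep 4 2 3 (Ci_absorb_merge s).
  congr (_ *: _).
  dto [:: 0 @ Sp s (a - s); 4 @ Sp (b - s) s; 5 @ Dt false s; 2 @ Rr 1 u; 3 @ Cr 1 (b - s);
    2 @ Ll u (b - s); 1 @ Cr (a - s) (b - s); 2 @ Rr (a - s) u; 0 @ Mg s (b - s);
    3 @ Mg 1 s; 2 @ Mg (a - s) (1 + s)].
  etransitivity; first by dstep 3 3 2 (S3_1 u (b - s)).
  rewrite scale1r -scalerA; congr (_ + _ *: _).
    symmetry; rewrite /V1 /X.
    dto [:: 0 @ Sp s (a - s); 4 @ Sp (b - s) s; 5 @ Dt false s; 3 @ Ll u (b - s); 1 @ Mg (a - s) 1;
      1 @ Cr (a - s + 1) (b - s); 2 @ Rr (a - s + 1) u; 0 @ Mg s (b - s); 2 @ Mg (a - s + 1) s].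
    dstep 4 2 1 (Cr_mergeR1 q (a - s) (b - s)).
    dstep 6 2 2 (S1rm q (a - s) 1 u).
    dto [:: 0 @ Sp s (a - s); 4 @ Sp (b - s) s; 5 @ Dt false s; 3 @ Ll u (b - s);
      2 @ Cr 1 (b - s); 1 @ Cr (a - s) (b - s); 3 @ Rr 1 u; 2 @ Rr (a - s) u; 0 @ Mg s (b - s);
      2 @ Mg (a - s) 1; 2 @ Mg (a - s + 1) s].
    dstep 9 2 2 (W1m q (a - s) 1 s).
    by dsame.
  have [p0|p0] := posnP (b - s)%N.
    rewrite (_ : V2 s = 0); last by dinvalid.
    by rewrite scaler0; dinvalid.
  rewrite /V2 /X.
  dto [:: 0 @ Sp s (a - s); 4 @ Sp ((b - s).-1 + 1) s; 4 @ Sp (b - s).-1 1; 6 @ Dt false s;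
    3 @ Ll u (b - s).-1; 5 @ Dt false 1; 2 @ Mg 1 (b - s).-1;
    1 @ Cr (a - s) (1 + (b - s).-1); 2 @ Rr (a - s) u; 0 @ Mg s (1 + (b - s).-1);
    3 @ Mg 1 s; 2 @ Mg (a - s) (1 + s)].
  dstep 1 2 4 (W1s q (b - s).-1 1 s).
  dto [:: 0 @ Sp s (a - s); 4 @ Sp (b - s).-1 (1 + s); 5 @ Sp 1 s; 5 @ Dt false 1; 6 @ Dt false s;
    5 @ Mg 1 s; 3 @ Ll u (b - s).-1; 2 @ Mg 1 (b - s).-1;
    1 @ Cr (a - s) (1 + (b - s).-1); 2 @ Rr (a - s) u; 0 @ Mg s (1 + (b - s).-1);
    2 @ Mg (a - s) (1 + s)].
  etransitivity; first by dstep 2 4 5 (Dt_rec false s).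
  congr (_ *: _).
  dstep 4 2 1 (Cr_mergeL1 q (a - s) (b - s).-1).
  dto [:: 0 @ Sp s (a - s); 4 @ Sp (b - s).-1 (1 + s); 5 @ Dt false (1 + s); 3 @ Ll u (b - s).-1;
    1 @ Cr (a - s) 1; 2 @ Cr (a - s) (b - s).-1; 1 @ Mg 1 (b - s).-1; 0 @ Mg s (1 + (b - s).-1);
    1 @ Rr (a - s) u; 2 @ Mg (a - s) (1 + s)].
  dstep 6 2 0 (esym (W1m q s 1 (b - s).-1)).
  by dsame.
have EW0 : W 0%N = V1 0%N.
  rewrite {1}/W /X; etransitivity; first by dstep 0 2 0 (@W2r K q a 0 (a + 1 - 0)).
  rewrite expr0 !scale1r [X in _ + X](_ : _ = 0) ?addr0; last by dinvalid.
  by rewrite /V1 /X; dsame.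
have EWS s : W s.+1 = q ^+ s.+1 *: V1 s.+1 + V2 s.
  have [h|h] := boolP ((s <= a) && (s < b))%N; last first.
    rewrite (_ : W s.+1 = 0); last by dinvalid.
    rewrite (_ : V1 s.+1 = 0); last by dinvalid.
    rewrite (_ : V2 s = 0); last by dinvalid.
    by rewrite scaler0 addr0.
  rewrite {1}/W /X; etransitivity; first by dstep 0 2 0 (@W2r K q a s.+1 (a + 1 - s.+1)).
  rewrite scale1r; congr (_ *: _ + _); last by rewrite /V2 /X; dsame.
  have [h'|h'] := boolP (s < a)%N; first by rewrite /V1 /X; dsame.
  by rewrite (_ : V1 s.+1 = 0); dinvalid.
have E : X [:: 0 @ Mg a 1; 0 @ Rr (a + 1) u; 1 @ Cr (a + 1) b; 0 @ Ll u b] =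
    \sum_(0 <= s < N) kS3 s *: W s.
  case: N hN IH EL => // N hN _ ->.
  under eq_bigr => s _ do rewrite scalerDr scalerDr scalerA scalerA scalerA -kS3S.
  rewrite big_split /= [X in _ + X]big_nat_recr //= (_ : V2 N = 0) ?scaler0 ?addr0; last by dinvalid.
  rewrite big_nat_recl // -addrA -big_split /= [RHS]big_nat_recl // EW0.
  rewrite expr0 mulr1; congr (_ + _); apply: eq_bigr => s _.
  by rewrite EWS scalerDr scalerA.
apply: (scalerI (qnum_neq0 q a)).
transitivity (D [:: LB a.+1; LR u; LB b] [:: LB b; LR u; LB a.+1]
  [:: 0 @ Sp a 1; 0 @ Mg a 1; 0 @ Rr (a + 1) u; 1 @ Cr (a + 1) b; 0 @ Ll u b]).
  by symmetry; dstep 0 2 0 (W3r a); congr (_ *: _); dsame.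
dstep 1 4 0 E.
rewrite scaler_sumr; apply: eq_bigr => s _; rewrite [RHS]scalerA [_ * kS3 s]mulrC -[RHS]scalerA; congr (_ *: _).
have [h|h] := boolP ((s <= a.+1) && (s <= b))%N.
  dstep 0 2 0 (W3r a).
  by congr (_ *: _); dsame.
by rewrite [X in _ *: X](_ : _ = 0) ?scaler0; dinvalid.
Qed.

End CrossingThroughRed.

(** * Functors between presented categories *)

Section TypeUniqueness.
Context (K : fieldType) (S : signature).

Lemma ty_uniq (f : tm K S) v w v' w' : ty f v w -> ty f v' w' -> v = v' /\ w = w'.
Proof.
move=> h; elim: h v' w' => {f v w}.
- by move=> v v' w' h; inversion h.
- by move=> g v' w' h; inversion h.
- move=> u v w f g _ IHf _ IHg v' w' h; inversion h as [| |? x ? ? ? hf hg| | | |]; subst.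
  by have [_ ->] := IHf _ _ hf; have [-> _] := IHg _ _ hg.
- move=> v w x y f g _ IHf _ IHg v' w' h; inversion h as [| | |? ? ? ? ? ? hf hg| | |]; subst.
  by have [-> ->] := IHf _ _ hf; have [-> ->] := IHg _ _ hg.
- by move=> v w v' w' h; inversion h.
- by move=> v w f g _ IHf _ _ v' w' h; inversion h as [| | | | |? ? ? ? hf hg|]; subst; apply: IHf.
- by move=> v w k f _ IHf v' w' h; inversion h as [| | | | | |? ? ? ? hf]; subst; apply: IHf.
Qed.
End TypeUniqueness.

Section PresentedFunctors.
Context (K : fieldType) (O M1 M2 : Type) (d1 c1 : M1 -> seq O) (d2 c2 : M2 -> seq O).
Local Notation S1 := (@Signature O M1 d1 c1).
Local Notation S2 := (@Signature O M2 d2 c2).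
Context (phi : M1 -> tm K S2).

Fixpoint tmap (f : tm K S1) : tm K S2 :=
  match f with
  | tid v => @tid K S2 v
  | tgen g => phi g
  | f ∘ g => tmap f ∘ tmap g
  | f ⊗ g => tmap f ⊗ tmap g
  | tzero v w => @tzero K S2 v w
  | f ⊞ g => tmap f ⊞ tmap g
  | k •: f => k •: tmap f
  end.

Lemma tmap_sum (I : Type) (r : seq I) (P : pred I) (F : I -> tm K S1) v w :
  tmap (\big[tadd/tzero v w]_(i <- r | P i) F i) =
  \big[tadd/@tzero K S2 v w]_(i <- r | P i) tmap (F i).
Proof. exact: (big_morph tmap (op1 := tadd) (op2 := tadd)). Qed.

Hypothesis phi_ty : forall g, ty (phi g) (d1 g) (c1 g).

Lemma tmap_ty f v w : ty f v w -> ty (tmap f) v w.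
Proof.
elim=> {f v w} /=.
- exact: (@ty_id K S2).
- exact: phi_ty.
- by move=> u v w f g _ hf _ hg; apply: ty_comp hf hg.
- by move=> v w v' w' f g _ hf _ hg; apply: (ty_tens hf hg).
- exact: (@ty_zero K S2).
- by move=> v w f g _ hf _ hg; apply: ty_add.
- by move=> v w k f _ hf; apply: ty_scale.
Qed.

Context (rel1 : tm K S1 -> tm K S1 -> Prop) (rel2 : tm K S2 -> tm K S2 -> Prop).
Hypothesis phi_rel : forall f g v w, ty f v w -> ty g v w -> rel1 f g ->
  eqm rel2 v w (tmap f) (tmap g).

Lemma tmap_eqm f g v w : eqm rel1 v w f g -> eqm rel2 v w (tmap f) (tmap g).
Proof.
elim=> {f g v w} /=; try by move=> *; eauto using tmap_ty, eqm.
move=> u v w u' v' w' f g f' g' h1 h2 h3 h4.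
by apply: (@eqm_tens_comp K S2 _ u v w u' v' w'); apply: tmap_ty.
Qed.

Definition pmap v w (x : phom rel1 v w) : phom rel2 v w :=
  cls rel2 (tmap_ty (tvalP (repr x))).

Lemma pmapE v w f (h : ty f v w) : pmap (cls rel1 h) = cls rel2 (tmap_ty h).
Proof. exact/clsP/tmap_eqm/eqm_repr. Qed.

Fact pmap_lin v w k (x y : phom rel1 v w) : pmap (k *: x + y) = k *: pmap x + pmap y.
Proof.
elim/clsW: x => f hf; elim/clsW: y => g hg.
rewrite cls_scale cls_add !pmapE cls_scale cls_add; apply/clsP/eqm_refl.
exact/(tmap_ty (ty_add (ty_scale k hf) hg)).
Qed.

Fact pmap_id v : pmap (cls rel1 (ty_id K v)) = cls rel2 (@ty_id K S2 v).
Proof. by rewrite pmapE; apply/clsP/eqm_refl/(@ty_id K S2). Qed.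

Fact pmap_comp u v w (x : phom rel1 v w) (y : phom rel1 u v) :
  pmap (Defs.pcomp x y) = Defs.pcomp (pmap x) (pmap y).
Proof.
elim/clsW: x => f hf; elim/clsW: y => g hg.
by rewrite pcompE !pmapE pcompE; apply/clsP/eqm_refl/(tmap_ty (ty_comp hf hg)).
Qed.

Fact pmap_tens u v u' v' (x : phom rel1 u v) (y : phom rel1 u' v') :
  pmap (ptens x y) = ptens (pmap x) (pmap y).
Proof.
elim/clsW: x => f hf; elim/clsW: y => g hg.
by rewrite ptensE !pmapE ptensE; apply/clsP/eqm_refl/(tmap_ty (ty_tens hf hg)).
Qed.

Definition presented_functor : slmfunctor (presented rel1) (presented rel2).
Proof.
refine (@SLMFunctor K (presented rel1) (presented rel2) (fun v => v) pmap
  pmap_lin pmap_id pmap_comp erefl (fun _ _ => erefl) _).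
by move=> a b c d f g; congr arr; apply: pmap_tens.
Defined.

End PresentedFunctors.

Section PresentedIso.
Context (K : fieldType) (O M1 M2 : Type) (d1 c1 : M1 -> seq O) (d2 c2 : M2 -> seq O).
Local Notation S1 := (@Signature O M1 d1 c1).
Local Notation S2 := (@Signature O M2 d2 c2).
Context (phi : M1 -> tm K S2) (psi : M2 -> tm K S1).
Hypothesis (phi_ty : forall g, ty (phi g) (d1 g) (c1 g)).
Hypothesis (psi_ty : forall g, ty (psi g) (d2 g) (c2 g)).
Context (rel1 : tm K S1 -> tm K S1 -> Prop) (rel2 : tm K S2 -> tm K S2 -> Prop).
Hypothesis psiK : forall g, eqm rel1 (d1 g) (c1 g) (tmap psi (phi g)) (@tgen K S1 g).

Lemma tmapK f v w : ty f v w -> eqm rel1 v w (tmap psi (tmap phi f)) f.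
Proof.
elim=> {f v w} /=.
- by move=> v; apply/eqm_refl/(@ty_id K S1).
- exact: psiK.
- by move=> u v w f g _ hf _ hg; apply: eqm_comp hf hg.
- by move=> v w v' w' f g _ hf _ hg; apply: (eqm_tens hf hg).
- by move=> v w; apply/eqm_refl/(@ty_zero K S1).
- by move=> v w f g _ hf _ hg; apply: eqm_add.
- by move=> v w k f _ hf; apply: eqm_scale.
Qed.

Hypothesis phi_rel : forall f g v w, ty f v w -> ty g v w -> rel1 f g ->
  eqm rel2 v w (tmap phi f) (tmap phi g).
Hypothesis psi_rel : forall f g v w, ty f v w -> ty g v w -> rel2 f g ->
  eqm rel1 v w (tmap psi f) (tmap psi g).

Lemma pmapK v w (x : phom rel1 v w) :
  pmap psi_ty rel1 (pmap phi_ty rel2 x) = x.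
Proof.
elim/clsW: x => f hf; rewrite (pmapE _ phi_rel) (pmapE _ psi_rel); apply/clsP.
exact: tmapK.
Qed.

End PresentedIso.

Section DotMaps.
Context (K : fieldType) (q : K) (D1 D2 : Type) (th1 : D1 -> nat) (th2 : D2 -> nat).
Local Notation S2 := (ssig K th2).
Context (X Y : D1 -> tm K S2).

Definition dotmap (g : sgen K D1) : tm K S2 :=
  match g with
  | GM a b => @tgen K S2 (GM a b)
  | GS a b => @tgen K S2 (GS a b)
  | GC a b => @tgen K S2 (GC a b)
  | GCi a b => @tgen K S2 (GCi a b)
  | GR a u => @tgen K S2 (GR a u)
  | GL u a => @tgen K S2 (GL u a)
  | GX d => X d
  | GXi d => Y d
  end.

Local Notation F := (@tmap K (strand K) (sgen K D1) (sgen K D2) (sdom th1) (scod th1) (sdom th2) (scod th2) dotmap).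

Lemma dotmap_ty : (forall d, ty (X d) (bl (th1 d)) (bl (th1 d))) ->
  (forall d, ty (Y d) (bl (th1 d)) (bl (th1 d))) ->
  forall g, ty (dotmap g) (sdom th1 g) (scod th1 g).
Proof.
move=> hX hY [a b|a b|a b|a b|a u|u a|d|d] //=; exact: (@ty_gen K S2).
Qed.

Lemma tmap_mm a b : F (mm a b) = mm a b. Proof. by case: a b => [|a] [|b]. Qed.
Lemma tmap_ss a b : F (ss a b) = ss a b. Proof. by case: a b => [|a] [|b]. Qed.
Lemma tmap_cc a b : F (cc a b) = cc a b. Proof. by case: a b => [|a] [|b]. Qed.
Lemma tmap_cci a b : F (cci a b) = cci a b. Proof. by case: a b => [|a] [|b]. Qed.
Lemma tmap_rr a u : F (rr a u) = rr a u. Proof. by case: a. Qed.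
Lemma tmap_ll u a : F (ll u a) = ll u a. Proof. by case: a. Qed.
Definition tmapE := (tmap_mm, tmap_ss, tmap_cc, tmap_cci, tmap_rr, tmap_ll).

Lemma tmap_ones y a : F (merge_ones a ∘ tpow y a ∘ split_ones a) =
  merge_ones a ∘ tpow (F y) a ∘ split_ones a.
Proof.
have m w : F (merges w) = merges w.
  elim: w => // b w IH.
  have -> : F (merges (b :: w)) = F (mm b (sumn w)) ∘ (idb b ⊗ F (merges w)) by [].
  by rewrite IH tmap_mm.
have s w : F (splits w) = splits w.
  elim: w => // b w IH.
  have -> : F (splits (b :: w)) = (idb b ⊗ F (splits w)) ∘ F (ss b (sumn w)) by [].
  by rewrite IH tmap_ss.
have t n : F (tpow y n) = tpow (F y) n by elim: n => //= n ->.
have -> : F (merge_ones a ∘ tpow y a ∘ split_ones a) =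
  F (merge_ones a) ∘ F (tpow y a) ∘ F (split_ones a) by [].
by rewrite /merge_ones /split_ones m s t.
Qed.

Lemma web_tmap f g : web_rel q f g -> web_rel q (F f) (F g).
Proof.
case; intros; cbn [tmap]; rewrite ?tmapE; try by constructor.
rewrite tmap_sum; under eq_bigr => s _ do (rewrite tmap_sum;
  under eq_bigr => t _ do (cbn [tmap]; rewrite !tmapE)).
exact: rel_W2.
Qed.

End DotMaps.

Section Comparison.
Context (K : fieldType) (q : K) {gq : generic q}.
Local Notation sg := (SchurBullet_sig K).
Local Notation sg' := (SchurBullet'_sig K).
Local Notation rel := (SchurBullet_rel q).
Local Notation rel' := (SchurBullet'_rel q).
Local Notation th := succn.
Local Notation th' := (fun _ : unit => 1%N).

Definition phi : sgen K unit -> tm K sg := dotmap (th2 := th) (fun _ => xx K 1) (fun _ => xxi K 1).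
Definition psi : sgen K nat -> tm K sg' :=
  dotmap (th2 := th') (fun a => xx' q a.+1) (fun a => xxi' q a.+1).
Local Notation F := (@tmap K (strand K) (sgen K unit) (sgen K nat) (sdom th') (scod th') (sdom th) (scod th) phi).
Local Notation G := (@tmap K (strand K) (sgen K nat) (sgen K unit) (sdom th) (scod th) (sdom th') (scod th') psi).

Lemma phi_ty g : ty (phi g) (sdom th' g) (scod th' g).
Proof. by apply: dotmap_ty => _; [apply: (ty_xx K 1) | apply: (ty_xxi K 1)]. Qed.

Lemma psi_ty g : ty (psi g) (sdom th g) (scod th g).
Proof. by apply: dotmap_ty => d; [apply: (ty_xx' q d.+1) | apply: (ty_xxi' q d.+1)]. Qed.

Lemma G_xx a : G (xx K a) = xx' q a. Proof. by case: a. Qed.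
Lemma G_xxi a : (0 < a)%N -> G (xxi K a) = xxi' q a. Proof. by case: a. Qed.

Lemma x1i_xxi' : eqm rel' (bl 1) (bl 1) (x1i K) (xxi' q 1).
Proof.
have [_ e] := mono_x1i (q := q); apply: eqm_trans e _.
have [_ e'] := mono_xxi' q 1; exact: eqm_sym e'.
Qed.

Lemma psiK g : eqm rel' (sdom th' g) (scod th' g) (G (phi g)) (@tgen K sg' g).
Proof.
case: g => [a b|a b|a b|a b|a u|u a|[]|[]] /=;
  try by apply: eqm_refl; exact: (@ty_gen K sg').
exact/eqm_sym/x1i_xxi'.
Qed.

Lemma F_ones (y' : tm K sg') (y x : tm K sg) a : F y' = y -> ty y (bl 1) (bl 1) ->
  ty x (bl a) (bl a) ->
  rel (merge_ones a ∘ tpow y a ∘ split_ones a) (qfact q a •: x) ->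
  eqm rel (bl a) (bl a) (F ((qfact q a)^-1 •: merge_ones a ∘ tpow y' a ∘ split_ones a)) x.
Proof.
move=> e hy hx r; cbn [tmap].
rewrite -[(_ ∘ _ ∘ _)]/(F (merge_ones a ∘ tpow y' a ∘ split_ones a)) tmap_ones e.
have hk := ty_scale (qfact q a) hx.
apply: eqm_trans (eqm_scale _ (eqm_rel (ty_ones a hy) hk r)) _.
apply: eqm_trans (eqm_scaleA _ _ _ hx) _; rewrite mulVf ?qfact_neq0 //.
exact: eqm_scale1.
Qed.

Lemma F_xx' a : (0 < a)%N -> eqm rel (bl a) (bl a) (F (xx' q a)) (xx K a).
Proof.
case: a => [|[|a]] // _; first by apply/eqm_refl/(ty_xx K 1).
by apply: F_ones => //; [apply: (ty_xx K 1) | apply: ty_xx | apply: rel_W6].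
Qed.

Lemma F_xxi' a : (0 < a)%N -> eqm rel (bl a) (bl a) (F (xxi' q a)) (xxi K a).
Proof.
move=> a0.
by apply: F_ones => //; [apply: (ty_xxi K 1) | apply: ty_xxi | apply: rel_W6V].
Qed.

Lemma phiK g : eqm rel (sdom th g) (scod th g) (F (psi g)) (@tgen K sg g).
Proof.
case: g => [a b|a b|a b|a b|a u|u a|d|d] /=;
  try by apply: eqm_refl; exact: (@ty_gen K sg).
- exact: (@F_xx' d.+1).
- exact: (@F_xxi' d.+1).
Qed.

Lemma eqm_at (S : signature) (r : tm K S -> tm K S -> Prop) f g v w v' w' :
  ty f v w -> eqm r v' w' f g -> eqm r v w f g.
Proof.
move=> h e; have [hf _] := eqm_ty e.
by have [<- <-] := ty_uniq hf h.
Qed.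

Lemma eqm_rep (f g : tm K sg') s t (x y : phom rel' (wds s) (wds t)) v w :
  ty f v w -> rep f x -> rep g y -> x = y -> eqm rel' v w f g.
Proof. by move=> h hx hy e; apply: eqm_at h _; apply/(repP hx hy). Qed.

Lemma tpow_eqm (S1 : tm K sg' -> tm K sg' -> Prop) (y y' : tm K sg') n :
  eqm S1 (bl 1) (bl 1) y y' ->
  eqm S1 (flatten (map (@bl K) (nseq n 1%N))) (flatten (map (@bl K) (nseq n 1%N)))
    (tpow y n) (tpow y' n).
Proof.
move=> e; elim: n => [|n IH] /=; first by apply/eqm_refl/(@ty_id K sg').
exact: (eqm_tens e IH).
Qed.

Lemma ones_eqm (y : tm K sg') a : eqm rel' (bl 1) (bl 1) y (xxi' q 1) ->
  eqm rel' (bl a) (bl a) (merge_ones a ∘ tpow y a ∘ split_ones a)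
    (merge_ones a ∘ tpow (x1i K) a ∘ split_ones a).
Proof.
move=> e; have e' := eqm_trans e (eqm_sym x1i_xxi').
have tM : ty (merge_ones a : tm K sg') _ _ := ty_merges (nseq a 1%N).
have tS : ty (split_ones a : tm K sg') _ _ := ty_splits (nseq a 1%N).
have -> : bl a = bl (sumn (nseq a 1%N)) :> seq (strand K) by rewrite sumn_ones.
apply: eqm_comp (eqm_refl _ tS); apply: eqm_comp (eqm_refl _ tM) _.
exact: tpow_eqm.
Qed.

Lemma Dt_ones_scale e a :
  eqm rel' (bl a) (bl a) (merge_ones a ∘ tpow (ydot K e) a ∘ split_ones a)
    (qfact q a •: atm q (Dt e a)).
Proof.
have to := ones_ty K e a.
apply: eqm_sym; apply: eqm_trans (eqm_scale _ (Dt_ones e a)) _.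
apply: eqm_trans (eqm_scaleA _ _ _ to) _; rewrite mulfV ?qfact_neq0 //.
exact: eqm_scale1.
Qed.

Lemma psi_rel f g v w : ty f v w -> ty g v w -> rel f g -> eqm rel' v w (G f) (G g).
Proof.
move=> hf hg r; have := tmap_ty psi_ty hg; have := tmap_ty psi_ty hf.
case: r {hf hg}.
- by move=> {}f {}g r h h'; apply: eqm_rel => //; exact/rel'_web/web_tmap.
- move=> a a0; cbn [tmap]; rewrite G_xx G_xxi // => h _.
  by apply: (eqm_rep h _ _ (xK false a)); apply: rep_mono; mono.
- move=> a a0; cbn [tmap]; rewrite G_xx G_xxi // => h _.
  by apply: (eqm_rep h _ _ (xK true a)); apply: rep_mono; mono.
- move=> a b _ _; cbn [tmap]; rewrite G_xx !tmapE => h _.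
  by apply: (eqm_rep h _ _ (W4l a b)); apply: rep_mono; mono.
- move=> a b _ _; cbn [tmap]; rewrite G_xx !tmapE => h _.
  by apply: (eqm_rep h _ _ (W4r a b)); apply: rep_mono; mono.
- move=> a b _ _; cbn [tmap]; rewrite !G_xx !tmapE => h _.
  by apply: (eqm_rep h _ _ (W5s false a b)); apply: rep_mono; mono.
- move=> a b _ _; cbn [tmap]; rewrite !G_xx !tmapE => h _.
  by apply: (eqm_rep h _ _ (W5m false a b)); apply: rep_mono; mono.
- move=> a a0; rewrite tmap_ones; cbn [tmap]; rewrite !G_xx => h _.
  exact: eqm_at h (Dt_ones_scale false a).
- move=> a a0; rewrite tmap_ones; cbn [tmap]; rewrite !G_xxi // => h _.
  apply: eqm_at h (eqm_trans (ones_eqm a _) (Dt_ones_scale true a)).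
  exact/eqm_refl/ty_xxi'.
- move=> a u a0; rewrite tmap_sum; cbn [tmap]; rewrite !tmapE => h _.
  apply: (eqm_rep h _ _ (S2lr u a)); first by apply: rep_mono; mono.
  apply: rep_sum => [||t ht _]; rewrite /wds /= ?cats0 //.
  rewrite /omega; cbn [tmap]; rewrite !tmapE G_xx.
  by apply: rep_scale; apply: rep_mono; mono.
- move=> a u a0; rewrite tmap_sum; cbn [tmap]; rewrite !tmapE => h _.
  apply: (eqm_rep h _ _ (S2rl u a)); first by apply: rep_mono; mono.
  apply: rep_sum => [||t ht _]; rewrite /wds /= ?cats0 //.
  rewrite /omega; cbn [tmap]; rewrite !tmapE G_xx.
  by apply: rep_scale; apply: rep_mono; mono.
- move=> a b u a0 b0; rewrite tmap_sum; cbn [tmap]; rewrite !tmapE => h _.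
  apply: (eqm_rep h _ _ (@S3 K q gq u a b _ (ltnSn _))); first by apply: rep_mono; mono.
  apply: rep_sum => [||s hs _]; rewrite /wds /= ?cats0 //.
  cbn [tmap]; rewrite !tmapE !G_xx.
  by apply: rep_scale; apply: rep_mono; mono.
Qed.

End Comparison.

Section Units.
Context (K : fieldType) (S : signature) (r : tm K S -> tm K S -> Prop).
Local Notation eqv := (eqm r).

Lemma eqm_tens_ids u v w : eqv (u ++ v ++ w) (u ++ v ++ w) (tid u ⊗ tid v ⊗ tid w) (tid (u ++ v ++ w)).
Proof. exact: whisk_id. Qed.

Lemma eqm_sandwich A B f g v w : eqv w w A (tid w) -> eqv v v B (tid v) ->
  eqv v w f g -> eqv v w (A ∘ f ∘ B) g.
Proof.
move=> hA hB e; have [_ hg] := eqm_ty e.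
apply: eqm_trans (eqm_comp (eqm_comp hA e) hB) _.
apply: eqm_trans (eqm_compm1 _ (ty_comp (ty_id _ _) hg)) _.
exact: eqm_comp1m.
Qed.

Lemma eqm_scale_eq1 k f g v w : k = 1 -> eqv v w f g -> eqv v w (k •: f) g.
Proof.
move=> -> e; apply: eqm_trans (eqm_scale _ e) _.
by apply: eqm_scale1; case: (eqm_ty e).
Qed.

Lemma eqm_addr0 f v w : ty f v w -> eqv v w (f ⊞ tzero v w) f.
Proof.
by move=> hf; apply: eqm_trans (eqm_addC _ hf (ty_zero _ _ _)) (eqm_add0 _ hf).
Qed.

Lemma eqm_sum2 F f g v w : eqv v w (F 0%N) f -> eqv v w (F 1%N) g ->
  eqv v w (\big[tadd/tzero v w]_(0 <= i < 2) F i) (f ⊞ g).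
Proof.
move=> e0 e1; have [_ hg] := eqm_ty e1.
rewrite big_ltn // big_ltn // big_geq //; apply: eqm_add e0 _.
exact: eqm_trans (eqm_add e1 (eqm_refl _ (ty_zero _ _ _))) (eqm_addr0 hg).
Qed.

End Units.

Section ComparisonRelations.
Context (K : fieldType) (q : K) {gq : generic q}.
Local Notation sg := (SchurBullet_sig K).
Local Notation rel := (SchurBullet_rel q).
Local Notation rel' := (SchurBullet'_rel q).
Local Notation term := (tm K sg).
Local Notation th := succn.
Local Notation th' := (fun _ : unit => 1%N).
Local Notation F := (@tmap K (strand K) (sgen K unit) (sgen K nat) (sdom th') (scod th') (sdom th) (scod th) (@phi K)).

Let tb := @ty_idb K nat th.
Let tr := @ty_idr K nat th.

Lemma omega11 : eqm rel (bl 1) (bl 1) (omega K 1 1) (xx K 1).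
Proof.
rewrite /omega /=; apply: eqm_sandwich; try exact/eqm_refl/(tb 1).
exact: eqm_tensm1 (ty_xx K 1).
Qed.

Lemma omega10 : eqm rel (bl 1) (bl 1) (omega K 1 0) (idb 1).
Proof.
rewrite /omega /=; apply: eqm_sandwich; try exact/eqm_refl/(tb 1).
exact: eqm_tens1m (tb 1).
Qed.

Lemma phi_rel f g v w : ty f v w -> ty g v w -> rel' f g -> eqm rel v w (F f) (F g).
Proof.
move=> hf hg r; have := tmap_ty (@phi_ty K) hg; have := tmap_ty (@phi_ty K) hf.
case: r {hf hg}.
- by move=> {}f {}g r h h'; apply: eqm_rel => //; exact/rel_web/web_tmap.
- by move=> h h'; apply: eqm_rel => //; apply: (rel_xK q (a := 1)).
- by move=> h h'; apply: eqm_rel => //; apply: (rel_xVK q (a := 1)).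
- by move=> h h'; apply: eqm_rel => //; apply: (@rel_W4l K q 1 1).
- by move=> h h'; apply: eqm_rel => //; apply: (@rel_W4r K q 1 1).
- move=> u h h'; apply: eqm_at h _.
  have e : eqm rel (bl 1 ++ rd u) (bl 1 ++ rd u)
    (\big[tadd/@tzero K sg (bl 1 ++ rd u) (bl 1 ++ rd u)]_(0 <= t < 2)
     ((-1) ^+ t * q ^- (t * (1 - t)) * u ^+ t •: omega K 1 (1 - t) ⊗ idr u))
    (xx K 1 ⊗ idr u ⊞ (- u •: idb 1 ⊗ idr u)).
    apply: eqm_sum2.
      apply: eqm_scale_eq1; first by rewrite !expr0 invr1 !mulr1.
      exact: (eqm_tens omega11 (eqm_refl _ (tr u))).
    rewrite subnn muln0 expr0 invr1 mulr1 !expr1 mulN1r.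
    by apply: eqm_scale; exact: (eqm_tens omega10 (eqm_refl _ (tr u))).
  have [hs _] := eqm_ty e.
  apply: eqm_trans (eqm_rel _ hs _) e; last exact: (@rel_S2lr K q 1 u).
  exact: (ty_comp (ty_ll u 1) (ty_rr 1 u)).
- move=> u h h'; apply: eqm_at h _.
  have e : eqm rel (rd u ++ bl 1) (rd u ++ bl 1)
    (\big[tadd/@tzero K sg (rd u ++ bl 1) (rd u ++ bl 1)]_(0 <= t < 2)
     ((-1) ^+ t * q ^- (t * (1 - t)) * u ^+ t •: idr u ⊗ omega K 1 (1 - t)))
    (idr u ⊗ xx K 1 ⊞ (- u •: idr u ⊗ idb 1)).
    apply: eqm_sum2.
      apply: eqm_scale_eq1; first by rewrite !expr0 invr1 !mulr1.
      exact: (eqm_tens (eqm_refl _ (tr u)) omega11).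
    rewrite subnn muln0 expr0 invr1 mulr1 !expr1 mulN1r.
    by apply: eqm_scale; exact: (eqm_tens (eqm_refl _ (tr u)) omega10).
  have [hs _] := eqm_ty e.
  apply: eqm_trans (eqm_rel _ hs _) e; last exact: (@rel_S2rl K q 1 u).
  exact: (ty_comp (ty_rr 1 u) (ty_ll u 1)).
- move=> u h h'; apply: eqm_at h _.
  pose w3 : seq (gob sg) := bl 1 ++ rd u ++ bl 1.
  pose B : term := (idb 1 ⊗ rr 1 u) ∘ (cc 1 1 ⊗ idr u) ∘ (idb 1 ⊗ ll u 1).
  have tB : ty B w3 w3.
    exact: (ty_comp (ty_comp (ty_tens (tb 1) (ty_rr 1 u)) (ty_tens (ty_cc 1 1) (tr u)))
      (ty_tens (tb 1) (ty_ll u 1))).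
  have i3 : eqm rel w3 w3 (idb 1 ⊗ idr u ⊗ idb 1) (tid w3).
    exact: (@eqm_tens_ids K sg rel (bl 1) (rd u) (bl 1)).
  have e : eqm rel w3 w3
    (\big[tadd/@tzero K sg w3 w3]_(0 <= s < 2)
         ((-1) ^+ s * q ^+ (s * s.-1)./2 * (q^-1 - q) ^+ s * qfact q s •:
            (mm s (1 - s) ⊗ idr u ⊗ mm (1 - s) s)
            ∘ (idb s ⊗ ((idb (1 - s) ⊗ rr (1 - s) u)
                        ∘ (cc (1 - s) (1 - s) ⊗ idr u)
                        ∘ (idb (1 - s) ⊗ ll u (1 - s))) ⊗ xx K s)
            ∘ (ss s (1 - s) ⊗ idr u ⊗ ss (1 - s) s)))
    (B ⊞ (- (q^-1 - q) •: idb 1 ⊗ idr u ⊗ xx K 1)).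
    apply: eqm_sum2.
      apply: eqm_scale_eq1; first by rewrite !expr0 qfact0 !mulr1.
      apply: (eqm_sandwich i3 i3).
      have tB0 := ty_tens (ty_id K [::] : ty (idb 0 : term) [::] [::]) tB.
      exact: eqm_trans (eqm_tensm1 _ tB0) (eqm_tens1m _ tB).
    rewrite mul1n !expr1 expr0 mulr1 qfact1 mulr1 mulN1r.
    apply: eqm_scale; apply: (eqm_sandwich i3 i3).
    have ru : eqm rel (rd u) (rd u)
      ((idb 0 ⊗ idr u) ∘ (idb 0 ⊗ idr u) ∘ (idb 0 ⊗ idr u)) (idr u).
      have e1 := eqm_tens1m rel (tr u).
      exact: (eqm_sandwich e1 e1 e1).
    have := eqm_tens (eqm_tens (eqm_refl rel (tb 1)) ru) (eqm_refl rel (ty_xx K 1)).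
    exact.
  have [hs _] := eqm_ty e.
  apply: eqm_trans (eqm_rel _ hs _) e; last exact: (@rel_S3 K q 1 1 u).
  exact: (ty_comp (ty_comp (ty_tens (ty_ll u 1) (tb 1)) (ty_tens (tr u) (ty_cc 1 1)))
    (ty_tens (ty_rr 1 u) (tb 1))).
Qed.

End ComparisonRelations.

Lemma generic_expr_neq1 (K : fieldType) (q : K) : q != 0 ->
  (forall m, (0 < m)%N -> q ^+ m != 1) -> generic q.
Proof.
move=> q0 h; have d m : (0 < m)%N -> q ^+ m - q ^- m != 0.
  move=> m0; rewrite subr_eq0; apply/eqP => e.
  have := h (m + m)%N; rewrite exprD {1}e mulVf ?expf_neq0 // eqxx addn_gt0 m0.
  by move=> /(_ isT).
by split=> // n; rewrite /qnum mulf_neq0 ?invr_neq0 ?d //; have := d 1%N isT; rewrite expr1.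
Qed.

Lemma generic_tofracX (F : fieldType) : @generic ({fraction {poly F}} : fieldType) (tofrac 'X).
Proof.
apply: generic_expr_neq1 => [|m m0].
  by rewrite tofrac_eq0 polyX_eq0.
rewrite -tofracXn -tofrac1 tofrac_eq; apply/eqP.
move/(congr1 (fun p : {poly _} => size p)).
rewrite size_polyXn size_poly1; lia.
Qed.

Lemma generic_qvar (R : realType) : generic (qvar R).
Proof. exact: generic_tofracX. Qed.

Theorem dot_presentations_iso (K : fieldType) (q : K) (gq : generic q) :
  exists F : slmfunctor (SchurBullet' q) (SchurBullet q),
    is_slmiso F /\
    (forall a : nat, (0 < a)%N -> F (bl a) = bl a) /\
    (forall u : K, F (rd u) = rd u) /\
    (forall a b : nat, (0 < a)%N -> (0 < b)%N ->
       arr (fmor F (pmor _ (ty_mm a b))) = arr (pmor _ (ty_mm a b))) /\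
    (forall a b : nat, (0 < a)%N -> (0 < b)%N ->
       arr (fmor F (pmor _ (ty_ss a b))) = arr (pmor _ (ty_ss a b))) /\
    (forall a b : nat, (0 < a)%N -> (0 < b)%N ->
       arr (fmor F (pmor _ (ty_cc a b))) = arr (pmor _ (ty_cc a b))) /\
    (forall (a : nat) (u : K), (0 < a)%N ->
       arr (fmor F (pmor _ (ty_rr a u))) = arr (pmor _ (ty_rr a u))) /\
    (forall (u : K) (a : nat), (0 < a)%N ->
       arr (fmor F (pmor _ (ty_ll u a))) = arr (pmor _ (ty_ll u a))) /\
    (forall a : nat, (0 < a)%N ->
       arr (fmor F (pmor _ (ty_xx' q a))) = arr (pmor _ (ty_xx K a))) /\
    (forall a : nat, (0 < a)%N ->
       arr (fmor F (pmor _ (ty_xxi' q a))) = arr (pmor _ (ty_xxi K a))).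
Proof.
have PF := @phi_rel _ q gq; have PG := @psi_rel _ q gq.
pose F := presented_functor (@phi_ty _) PF.
pose G := presented_functor (@psi_ty _ q) PG.
have FE (f : tm K (SchurBullet'_sig K)) (g : tm K (SchurBullet_sig K)) v w
    (hf : ty f v w) (hg : ty g v w) : eqm (SchurBullet_rel q) v w (tmap (@phi _) f) g ->
    arr (fmor F (pmor (SchurBullet'_rel q) hf)) = arr (pmor (SchurBullet_rel q) hg).
  by move=> e; congr arr; apply: etrans (pmapE (@phi_ty K) PF hf) _; apply/clsP.
exists F; split.
  exists G; split=> // v w x; congr arr.
  - exact: (pmapK _ _ (@psiK _ q gq) PF PG).
  - exact: (pmapK _ _ (@phiK _ q gq) PG PF).
do 2!split=> //.
split=> [a b _ _|]; first by apply: FE; rewrite tmap_mm; apply/eqm_refl/ty_mm.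
split=> [a b _ _|]; first by apply: FE; rewrite tmap_ss; apply/eqm_refl/ty_ss.
split=> [a b _ _|]; first by apply: FE; rewrite tmap_cc; apply/eqm_refl/ty_cc.
split=> [a u _|]; first by apply: FE; rewrite tmap_rr; apply/eqm_refl/ty_rr.
split=> [u a _|]; first by apply: FE; rewrite tmap_ll; apply/eqm_refl/ty_ll.
split=> a a0; apply: FE; first exact: F_xx'.
exact: F_xxi'.
Qed.

Theorem theorem3p5 (R : realType) :
  exists F : slmfunctor (SchurBullet' (qvar R)) (SchurBullet (qvar R)),
    is_slmiso F /\
    (forall a : nat, (0 < a)%N -> F (bl a) = bl a) /\
    (forall u : Cq R, F (rd u) = rd u) /\
    (forall a b : nat, (0 < a)%N -> (0 < b)%N ->
       arr (fmor F (pmor _ (ty_mm a b))) = arr (pmor _ (ty_mm a b))) /\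
    (forall a b : nat, (0 < a)%N -> (0 < b)%N ->
       arr (fmor F (pmor _ (ty_ss a b))) = arr (pmor _ (ty_ss a b))) /\
    (forall a b : nat, (0 < a)%N -> (0 < b)%N ->
       arr (fmor F (pmor _ (ty_cc a b))) = arr (pmor _ (ty_cc a b))) /\
    (forall (a : nat) (u : Cq R), (0 < a)%N ->
       arr (fmor F (pmor _ (ty_rr a u))) = arr (pmor _ (ty_rr a u))) /\
    (forall (u : Cq R) (a : nat), (0 < a)%N ->
       arr (fmor F (pmor _ (ty_ll u a))) = arr (pmor _ (ty_ll u a))) /\
    (forall a : nat, (0 < a)%N ->
       arr (fmor F (pmor _ (ty_xx' (qvar R) a))) = arr (pmor _ (ty_xx (Cq R) a))) /\
    (forall a : nat, (0 < a)%N ->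
       arr (fmor F (pmor _ (ty_xxi' (qvar R) a))) = arr (pmor _ (ty_xxi (Cq R) a))).
Proof. exact: dot_presentations_iso (generic_qvar R). Qed.
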